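(* For every integer $n\ge 1$ the following hold for the family of piecewise polynomial systems $$\begin{cases}\dot x=-y+\varepsilon p^{+}(x,y),\\ \dot y=1-x+\varepsilon q^{+}(x,y),\end{cases}\ x\ge 0,\qquad \begin{cases}\dot x=-y+\varepsilon p^{-}(x,y),\\ \dot y=x+\varepsilon q^{-}(x,y),\end{cases}\ x<0,$$ where $\varepsilon>0$ is small and $p^{\pm},q^{\pm}$ are arbitrary real polynomials of degree at most $n$: (1) $N_{Hopf}(n)\ge n+\left[\frac{n+1}{2}\right]$; (2) $N_{homoc}(n)\ge n+\left[\frac{n+1}{2}\right]$. Here $N_{Hopf}(n)$ and $N_{homoc}(n)$ denote the maximal numbers of limit cycles that bifurcate for small $\varepsilon>0$, respectively, near the origin and near the homoclinic loop $L_0$ of the unperturbed system, over all such $p^{\pm},q^{\pm}$ (precise definitions in the context).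
   Context: $[\cdot]$ denotes the integer part. Write $p^{\pm}(x,y)=\sum_{i+j=0}^{n}a^{\pm}_{ij}x^iy^j$ and $q^{\pm}(x,y)=\sum_{i+j=0}^{n}b^{\pm}_{ij}x^iy^j$ with real coefficients. Unperturbed system ($\varepsilon=0$): it is piecewise Hamiltonian ($\dot x=H_y,\ \dot y=-H_x$) with $H^{+}(x,y)=\frac12((x-1)^2-y^2)$ for $x\ge0$ and $H^{-}(x,y)=-\frac12(x^2+y^2)$ for $x<0$. For $0<h<1$ it has the periodic orbit $L_h$, oriented anticlockwise, consisting of the arc $x=1-\sqrt{h+y^2}$, $|y|\le\sqrt{1-h}$ (on which $H^+=h/2$, $x\ge 0$) and the half circle $x^2+y^2=1-h$, $x<0$ (on which $H^-=(h-1)/2$). As $h\to1$, $L_h$ shrinks to the origin, a center; as $h\to0$, $L_h$ tends to the homoclinic loop $L_0=\{x=1-|y|,\ |y|\le 1\}\cup\{x^2+y^2=1,\ x<0\}$, which passes through the saddle $(1,0)$. A limit cycle of the perturbed system is an isolated periodic orbit (closed curve crossing the line $x=0$ and formed by orbit arcs of the right subsystem in $x\geq 0$ and of the left subsystem in $x<0$). $N_{Hopf}(n)$ (respectively $N_{homoc}(n)$) is the maximal number $k$ with the following property: there is a compact set $D$ of coefficient vectors $(a^{\pm}_{ij},b^{\pm}_{ij})$ such that for every neighbourhood $U$ of the origin (respectively of $L_0$) there exist coefficients in $D$ and $\varepsilon^*>0$ such that for all $0<\varepsilon<\varepsilon^*$ the perturbed system has at least $k$ limit cycles contained in $U$. (The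 inequality $N\ge m$ means that this property holds for $k=m$.) *)

(* Defs.v *)
From mathcomp Require Import all_boot all_order all_algebra.
From mathcomp Require Import all_classical all_reals all_analysis.

Set Implicit Arguments.
Unset Strict Implicit.
Unset Printing Implicit Defensive.

Import Order.TTheory GRing.Theory Num.Theory.
Import numFieldNormedType.Exports.

Local Open Scope classical_set_scope.
Local Open Scope ring_scope.

(* Only the entries [c i j] with [i + j <= n] are used, so that [poly2 c] is
   an arbitrary real polynomial of degree at most [n] in two variables. *)
Definition poly2 (R : realType) (n : nat) (c : 'M[R]_n.+1) (z : R * R) : R :=
  \sum_(i < n.+1) \sum_(j < n.+1 | (i + j <= n)%N)
    c i j * z.1 ^+ i * z.2 ^+ j.

(* Coefficients ((a^+, b^+), (a^-, b^-)) of p^+, q^+, p^-, q^-. *)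
Notation coef_space R n :=
  (('M[R]_n.+1 * 'M[R]_n.+1) * ('M[R]_n.+1 * 'M[R]_n.+1))%type.

Definition right_field (R : realType) (n : nat) (c : coef_space R n) (e : R)
    (z : R * R) : R * R :=
  (- z.2 + e * poly2 c.1.1 z, 1 - z.1 + e * poly2 c.1.2 z).

Definition left_field (R : realType) (n : nat) (c : coef_space R n) (e : R)
    (z : R * R) : R * R :=
  (- z.2 + e * poly2 c.2.1 z, z.1 + e * poly2 c.2.2 z).

(* [g] is required to be globally continuous where this is used, so that an
   arc solves the equation on the closed interval in the one-sided sense. *)
Definition solves_on (R : realType) (F : R * R -> R * R) (g : R -> R * R)
    (s t : R) : Prop :=
  forall u, s < u < t ->
    is_derive u (1 : R) (fun v => (g v).1) (F (g u)).1 /\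
    is_derive u (1 : R) (fun v => (g v).2) (F (g u)).2.

Definition right_arc (R : realType) (F : R * R -> R * R) (g : R -> R * R)
    (s t : R) : Prop :=
  solves_on F g s t /\ forall u, s < u < t -> 0 <= (g u).1.

Definition left_arc (R : realType) (F : R * R -> R * R) (g : R -> R * R)
    (s t : R) : Prop :=
  solves_on F g s t /\ forall u, s < u < t -> (g u).1 < 0.

(* [O] is the simple closed curve traced by a continuous function of minimal
   period [T] which is a concatenation of finitely many arcs.  Orbits lying in
   a single half plane are included. *)
Definition periodic_orbit (R : realType) (Fr Fl : R * R -> R * R)
    (O : set (R * R)) : Prop :=
  exists (g : R -> R * R) (T : R) (m : nat) (tau : nat -> R),
    [/\ continuous g,
        0 < T /\ (forall u, g (u + T) = g u),
        forall u v, 0 <= u < T -> 0 <= v < T -> g u = g v -> u = v,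
        [/\ tau 0%N = 0, tau m = T &
            forall i, (i < m)%N -> tau i < tau i.+1 /\
              (right_arc Fr g (tau i) (tau i.+1) \/
               left_arc Fl g (tau i) (tau i.+1))] &
        O = range g].

(* Isolation is required among all periodic orbits, crossing or not. *)
Definition limit_cycle (R : realType) (Fr Fl : R * R -> R * R)
    (O : set (R * R)) : Prop :=
  [/\ periodic_orbit Fr Fl O,
      (exists2 z, O z & z.1 < 0) /\ (exists2 z, O z & 0 < z.1) &
      exists2 V, set_nbhs O V &
        forall O', periodic_orbit Fr Fl O' -> O' `<=` V -> O' = O].

Definition bifurcate_near (R : realType) (n : nat) (A : set (R * R))
    (k : nat) : Prop :=
  exists2 D : set (coef_space R n), compact D &
    forall U : set (R * R), set_nbhs A U ->
      exists2 c, D c & exists2 e0 : R, 0 < e0 &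
        forall e : R, 0 < e < e0 ->
          exists2 O : 'I_k -> set (R * R), injective O &
            forall i, limit_cycle (right_field c e) (left_field c e) (O i) /\
                      O i `<=` U.

Definition homoclinic_loop (R : realType) : set (R * R) :=
  [set z | z.1 = 1 - `|z.2| /\ `|z.2| <= 1] `|`
  [set z | z.1 ^+ 2 + z.2 ^+ 2 = 1 /\ z.1 < 0].

(* The inequalities k <= N_Hopf(n) and k <= N_homoc(n), where N is the maximal
   k, possibly infinite, for which k limit cycles bifurcate; the property is
   monotone in k. *)
Definition N_Hopf_ge (R : realType) (n k : nat) : Prop :=
  bifurcate_near n [set ((0, 0) : R * R)] k.

Definition N_homoc_ge (R : realType) (n k : nat) : Prop :=
  bifurcate_near n (@homoclinic_loop R) k.

(* Main.v *)
Require Import Defs.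
From mathcomp Require Import all_boot all_order all_algebra.
From mathcomp Require Import all_classical all_reals all_analysis.
From mathcomp Require Import ring lra.

Set Implicit Arguments.
Unset Strict Implicit.
Unset Printing Implicit Defensive.

Import Order.TTheory GRing.Theory Num.Theory.
Import numFieldNormedType.Exports.

Local Open Scope classical_set_scope.
Local Open Scope ring_scope.

(* Perturb by
     x' = -y + e (A'(y) + (1 - x) B((1 - x)^2 - y^2)),  y' = 1 - x          (right),
     x' = -y + e x f(x^2 + y^2),  y' = x + e y f(x^2 + y^2)                 (left),
   and let v be the square root of the unperturbed first integral.  The half-return
   maps between the two halves of the y-axis are computed on the left with the
   polar angle as time, and on the right with s = y / v as time, for which the
   y-axis is exactly s = -1 and s = 1.  The return map to the positive y-axis is
   a + e M(a) + o(e), where the remainder is also o(e)-Lipschitz in a, and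
     M(a) = pi a f(a^2) + (A(a) - A(-a)) / a + B(1 - a^2) L(a),
     L(a) = 1 + (1 - a^2) / (2 a) ln ((1 + a) / (1 - a)).
   Hence a simple zero of M in ]0, 1[ yields one fixed point nearby, and its orbit
   is the only periodic orbit in a thin annulus.  The functions M range over the
   span of a^i, i <= n, and (1 - a^2)^j L(a), j < [(n + 1) / 2].  These
   N = n + 1 + [(n + 1) / 2] functions are independent on every interval, since
   the logarithm is transcendental over the rational functions, and N functions
   with that property have a linear combination with N - 1 simple zeros in any
   prescribed interval: near 0 for the origin, near 1 for the loop. *)

(** * Derivatives and mean values *)

(** The perturbations are shaped so that each half system keeps an explicit clock. On the left the
    perturbation is radial, so the angle keeps speed exactly one. On the right it enters [x'] only,
    so [dy = (1 - x) dt] is unchanged and the first integral [E = v^2] satisfies [dE = 2 e P dy],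
    with [P] the perturbation; the [B] term is then a constant times the integral of
    [sqrt (1 - a^2 + y^2)], whence the logarithm. Since both sections sit at fixed values of the
    clocks, transit times, which would require an implicit function argument, never have to be
    solved for. The main obstacle is isolation: a limit cycle must be isolated among all periodic
    orbits of the definition, also those that wind several times or stay in one half plane. Hence an
    arbitrary closed orbit in the annulus is followed forward in time and compared with the
    constructed solutions by a Gronwall argument; a sign condition on the return map then excludes
    every orbit but one. The compact set of coefficients is fixed before the neighbourhood, so the
    combinations that produce the zeros have to be normalized. *)

Lemma continuous_pair (T U V : topologicalType) (f : T -> U) (g : T -> V) :
  continuous f -> continuous g -> continuous (fun x => (f x, g x)).
Proof. by move=> cf cg x; exact: (cvg_pair (cf x) (cg x)). Qed.

Lemma der_cst (R : realType) (c x : R) : is_derive x (1 : R) (fun=> c) 0.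
Proof. exact: is_derive_cst. Qed.

Lemma der_id (R : realType) (x : R) : is_derive x (1 : R) (fun s => s) 1.
Proof. exact: is_derive_id. Qed.

Lemma derD (R : realType) (f g : R -> R) (x a b : R) :
  is_derive x (1 : R) f a -> is_derive x (1 : R) g b ->
  is_derive x (1 : R) (fun s => f s + g s) (a + b).
Proof. exact: is_deriveD. Qed.

Lemma derN (R : realType) (f : R -> R) (x a : R) :
  is_derive x (1 : R) f a -> is_derive x (1 : R) (fun s => - f s) (- a).
Proof. exact: is_deriveN. Qed.

Lemma derM (R : realType) (f g : R -> R) (x a b : R) :
  is_derive x (1 : R) f a -> is_derive x (1 : R) g b ->
  is_derive x (1 : R) (fun s => f s * g s) (a * g x + f x * b).
Proof.
move=> fa gb; have := is_deriveM fa gb.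
by rewrite /GRing.scale /= => h; apply: is_derive_eq; ring.
Qed.

Lemma derX (R : realType) (f : R -> R) (n : nat) (x a : R) :
  is_derive x (1 : R) f a ->
  is_derive x (1 : R) (fun s => f s ^+ n) (n%:R * f x ^+ n.-1 * a).
Proof. by move=> fa; have := is_deriveX n fa; rewrite exprfctE. Qed.

Lemma derV (R : realType) (f : R -> R) (x a : R) :
  f x != 0 -> is_derive x (1 : R) f a ->
  is_derive x (1 : R) (fun s => (f s)^-1) (- (f x) ^- 2 * a).
Proof. by move=> f0 fa; exact: is_deriveV. Qed.

Lemma der_comp (R : realType) (f g : R -> R) (x a b : R) :
  is_derive (g x) (1 : R) f a -> is_derive x (1 : R) g b ->
  is_derive x (1 : R) (fun s => f (g s)) (a * b).
Proof. by move=> fa gb; exact: is_derive1_comp. Qed.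

Lemma der_sqrt (R : realType) (g : R -> R) (x b : R) :
  0 < g x -> is_derive x (1 : R) g b ->
  is_derive x (1 : R) (fun s => Num.sqrt (g s)) ((2 * Num.sqrt (g x))^-1 * b).
Proof. by move=> g0 gb; apply: der_comp gb; exact: is_derive1_sqrt. Qed.

Lemma der_sin (R : realType) (g : R -> R) (x b : R) :
  is_derive x (1 : R) g b ->
  is_derive x (1 : R) (fun s => sin (g s)) (cos (g x) * b).
Proof. by move=> gb; apply: der_comp gb; exact: is_derive_sin. Qed.

Lemma der_cos (R : realType) (g : R -> R) (x b : R) :
  is_derive x (1 : R) g b ->
  is_derive x (1 : R) (fun s => cos (g s)) (- sin (g x) * b).
Proof. by move=> gb; apply: der_comp gb; exact: is_derive_cos. Qed.

Lemma der_ln (R : realType) (g : R -> R) (x b : R) :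
  0 < g x -> is_derive x (1 : R) g b ->
  is_derive x (1 : R) (fun s => ln (g s)) ((g x)^-1 * b).
Proof. by move=> g0 gb; apply: der_comp gb; exact: is_derive1_ln. Qed.

Lemma der_eq (R : realType) (f : R -> R) (x a b : R) :
  is_derive x (1 : R) f a -> a = b -> is_derive x (1 : R) f b.
Proof. by move=> ? <-. Qed.

Lemma der_uniq (R : realType) (f : R -> R) (x a b : R) :
  is_derive x (1 : R) f a -> is_derive x (1 : R) f b -> a = b.
Proof. by move=> [_ <-] [_ <-]. Qed.

Lemma der_continuous (R : realType) (f : R -> R) (x a : R) :
  is_derive x (1 : R) f a -> {for x, continuous f}.
Proof.
by move=> [fa _]; apply: differentiable_continuous; exact/derivable1_diffP.
Qed.

Lemma der_near (R : realType) (f g : R -> R) (p q x a : R) :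
  p < x < q -> (forall s, p < s < q -> f s = g s) ->
  is_derive x (1 : R) f a -> is_derive x (1 : R) g a.
Proof.
move=> pxq fg; apply: near_eq_is_derive.
have : \forall y \near x, y \in `]p, q[ by apply: near_in_itvoo; rewrite in_itv.
by apply: filterS => y; rewrite in_itv /=; exact: fg.
Qed.

Lemma der_shift (R : realType) (f : R -> R) (k x a : R) :
  is_derive (x + k) (1 : R) f a -> is_derive x (1 : R) (fun s => f (s + k)) a.
Proof.
move=> fa; rewrite -[a]mulr1; apply: (@der_comp _ f (fun s => s + k)) => //.
by apply: der_eq (derD (der_id x) (der_cst k x)) _; rewrite addr0.
Qed.

Lemma mean_value_in (R : realType) (f : R -> R) (a b : R) :
  a < b -> (forall s, a <= s <= b -> {for s, continuous f}) ->
  (forall s, a < s < b -> exists d, is_derive s (1 : R) f d) ->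
  exists c d, [/\ a < c < b, is_derive c (1 : R) f d & f b - f a = d * (b - a)].
Proof.
move=> ab cf df.
have h x : x \in `]a, b[ -> is_derive x (1 : R) f ('D_1 f x).
  rewrite in_itv /= => /df[d fd]; have E := @derive_val _ _ _ _ _ _ _ fd.
  by rewrite E.
have cf' : {within `[a, b], continuous f}.
  apply: continuous_in_subspaceT => x; rewrite inE /= in_itv /=; exact: cf.
have [c cab E] := MVT ab h cf'.
exists c, ('D_1 f c); split; [by move: cab; rewrite in_itv| exact: h|exact: E].
Qed.

Lemma mean_value (R : realType) (f : R -> R) (a b : R) :
  a < b -> continuous f ->
  (forall s, a < s < b -> exists d, is_derive s (1 : R) f d) ->
  exists c d, [/\ a < c < b, is_derive c (1 : R) f d & f b - f a = d * (b - a)].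
Proof. by move=> ab cf; apply: mean_value_in => // s _; exact: cf. Qed.

Lemma mean_value_le (R : realType) (f : R -> R) (a b C : R) :
  a <= b -> continuous f ->
  (forall s, a < s < b -> exists2 d, is_derive s (1 : R) f d & `|d| <= C) ->
  `|f b - f a| <= C * (b - a).
Proof.
rewrite le_eqVlt => /predU1P[<- _ _|ab cf df]; first by rewrite !subrr normr0 mulr0.
have [|c [d [cab fd ->]]] := mean_value ab cf.
  by move=> s /df[d ? _]; exists d.
have [d' fd' d'C] := df _ cab.
rewrite normrM (gtr0_norm (_ : 0 < b - a)) ?subr_gt0//.
by rewrite ler_pM2r ?subr_gt0// (der_uniq fd fd').
Qed.

Lemma mean_value_le_sym (R : realType) (f : R -> R) (p q C : R) :
  continuous f ->
  (forall s, p < s < q -> exists2 d, is_derive s (1 : R) f d & `|d| <= C) ->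
  forall a b, p <= a <= q -> p <= b <= q -> `|f b - f a| <= C * `|b - a|.
Proof.
move=> cf df; wlog ab : / forall a b, p <= a <= q -> p <= b <= q -> a <= b ->
    `|f b - f a| <= C * `|b - a|.
  move=> W a b ha hb; apply: W ha hb => {}a {}b /andP[pa aq] /andP[pb bq] ab.
  rewrite (ger0_norm (_ : 0 <= b - a)) ?subr_ge0//.
  apply: mean_value_le => // s /andP[as_ sb]; apply: df.
  by rewrite (le_lt_trans pa as_) (lt_le_trans sb bq).
move=> a b ha hb; case: (leP a b) => [|/ltW] h; first exact: ab.
by rewrite distrC [`|b - a|]distrC; exact: ab.
Qed.

Lemma continuous_primitive_seg (R : realType) (f : R -> R) (a b : R) :
  a < b -> continuous f ->
  exists F : R -> R, forall x, a < x < b -> is_derive x (1 : R) F (f x).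
Proof.
move=> ab cf.
pose mu := @lebesgue_measure R.
exists (fun x => \int[mu]_(t in `[a, x]) (f t)).
move=> x /andP[ax xb].
have itg : mu.-integrable `[a, b] (EFin \o f).
  by apply: continuous_compact_integrable; [exact: segment_compact|exact: continuous_subspaceT].
have [d e] := @continuous_FTC1_closed _ f a x b xb itg ax (cf x).
by apply: DeriveDef; [exact: d|rewrite -derive1E; exact: e].
Qed.

Lemma der0_eq (R : realType) (f : R -> R) (p q : R) :
  (forall s, p < s < q -> is_derive s (1 : R) f 0) ->
  forall a b, p < a < q -> p < b < q -> f a = f b.
Proof.
move=> df; have W a b : p < a < q -> p < b < q -> a < b -> f a = f b.
  move=> /andP[pa _] /andP[_ bq] ab.
  have [s /andP[as_ sb]|s /andP[as_ sb]|c [d [/andP[ac cb] fd E]]] := @mean_value_in _ f a b ab.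
  - apply: (@der_continuous _ _ _ 0); apply: df.
    by rewrite (lt_le_trans pa as_) (le_lt_trans sb bq).
  - by exists 0; apply: df; rewrite (lt_trans pa as_) (lt_trans sb bq).
  have d0 : d = 0.
    by apply: (der_uniq fd); apply: df; rewrite (lt_trans pa ac) (lt_trans cb bq).
  by move: E; rewrite d0 mul0r => /eqP; rewrite subr_eq0 => /eqP.
move=> a b ha hb; case: (ltgtP a b) => [|/W ->//|->//]; exact: W.
Qed.

(** Primitives on growing symmetric intervals, normalized to vanish at [x0], agree on overlaps; the
    value at [x] is read from the interval whose index is the integer part of [|x - x0|]. *)
Lemma continuous_primitive (R : realType) (f : R -> R) (x0 : R) :
  continuous f ->
  exists F : R -> R, F x0 = 0 /\ forall x, is_derive x (1 : R) F (f x).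
Proof.
move=> cf.
have H (n : nat) : exists F : R -> R, F x0 = 0 /\
    forall x, x0 - n%:R - 1 < x < x0 + n%:R + 1 -> is_derive x (1 : R) F (f x).
  have n0 : 0 <= n%:R :> R by [].
  have [|F FE] := @continuous_primitive_seg _ f (x0 - n%:R - 1) (x0 + n%:R + 1) _ cf.
    by lra.
  exists (fun x => F x - F x0); split; first by rewrite subrr.
  by move=> x hx; apply: der_eq (derD (FE x hx) (der_cst _ x)) _; rewrite addr0.
have [F FE] := choice H.
have U n m x : (n <= m)%N -> x0 - n%:R - 1 < x < x0 + n%:R + 1 -> F n x = F m x.
  move=> nm hx; have nm' : n%:R <= m%:R :> R by rewrite ler_nat.
  have n0 : 0 <= n%:R :> R by [].
  have D s : x0 - n%:R - 1 < s < x0 + n%:R + 1 ->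
      is_derive s (1 : R) (fun t => F n t + - F m t) 0.
    move=> hs; apply: der_eq (derD ((FE n).2 s hs) (derN ((FE m).2 s _))) _.
      by case/andP: hs => h1 h2; apply/andP; split; lra.
    by rewrite subrr.
  have := @der0_eq _ _ _ _ D x0 x _ hx.
  rewrite (FE n).1 (FE m).1 => /(_ _)/esym E.
  by apply/eqP; rewrite -subr_eq0 E ?subrr//; apply/andP; split; lra.
have B x : `|x - x0| < (Num.truncn `|x - x0|).+1%:R by apply: truncnS_gt.
exists (fun x => F (Num.truncn `|x - x0|) x); split.
  exact: (FE _).1.
(* One more than the index used at [x], so that [F n] represents the glued function on a whole
   neighbourhood of [x]. *)
move=> x; pose n := (Num.truncn `|x - x0|).+1.
have Bx := B x; rewrite -/n in Bx.
apply: (@der_near _ (F n) _ (x0 - n%:R) (x0 + n%:R)).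
- by move: Bx; rewrite ltr_norml => /andP[h1 h2]; apply/andP; split; lra.
- move=> s hs; apply/esym; apply: U.
    have : `|s - x0| < n%:R by rewrite ltr_norml; case/andP: hs => h1 h2; apply/andP; split; lra.
    move=> h; have := truncn_le `|s - x0|; rewrite normr_ge0 => h2.
    by apply: ltnW; rewrite -(ltr_nat R); exact: le_lt_trans h2 h.
  have := B s; rewrite -natr1 ltr_norml => /andP[h1 h2]; apply/andP; split; lra.
- apply: (FE n).2; move: Bx; rewrite ltr_norml => /andP[h1 h2]; apply/andP; split; lra.
Qed.

Lemma mean_value_cc (R : realType) (f f' : R -> R) (p q C : R) :
  (forall s, p <= s <= q -> is_derive s (1 : R) f (f' s)) ->
  (forall s, p <= s <= q -> `|f' s| <= C) ->
  forall a b, p <= a <= q -> p <= b <= q -> `|f b - f a| <= C * `|b - a|.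
Proof.
move=> df fC; have W a b : p <= a <= q -> p <= b <= q -> a < b ->
    `|f b - f a| <= C * `|b - a|.
  move=> /andP[pa aq] /andP[pb bq] ab.
  have h s : a <= s <= b -> p <= s <= q.
    by move=> /andP[h1 h2]; rewrite (le_trans pa h1) (le_trans h2 bq).
  have [s /h hs|s /andP[/ltW h1 /ltW h2]|c [d [/andP[/ltW h1 /ltW h2] fd ->]]] := @mean_value_in _ f a b ab.
  - exact: der_continuous (df s hs).
  - by exists (f' s); apply: df; apply: h; rewrite h1.
  have hc : p <= c <= q by apply: h; rewrite h1.
  rewrite normrM; apply: ler_wpM2r => //.
  by rewrite (der_uniq fd (df c hc)); exact: fC.
move=> a b ha hb; case: (ltgtP a b) => [|ba|->]; first exact: W.
  by rewrite distrC [X in _ * X]distrC; exact: W.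
by rewrite !subrr normr0 mulr0.
Qed.

(** * Exit times and a one-sided Gronwall lemma *)

Lemma init_sup (R : realType) (P : R -> Prop) (a b : R) :
  a <= b -> ~ P b ->
  exists c, [/\ a <= c <= b, forall s, a <= s < c -> P s &
    forall e, 0 < e -> exists s, [/\ c <= s < c + e, s <= b & ~ P s]].
Proof.
move=> ab Pb.
pose A := [set t | a <= t <= b /\ forall s, a <= s < t -> P s].
have Aa : A a by split; [rewrite lexx ab|move=> s /andP[h1 h2]; lra].
have ubA : ubound A b by move=> t [/andP[]].
have sA : has_sup A by split; [exists a|exists b].
exists (sup A); split.
- have -> /= : a <= sup A by apply: ub_le_sup => //; exists b.
  by apply: ge_sup => //; exists a.
- move=> s /andP[as_ sc].
  have [|t [tb Pt] st] := @sup_adherent _ A (sup A - s) _ sA; first by rewrite subr_gt0.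
  by apply: Pt; rewrite as_ /=; lra.
move=> e e0; apply: contrapT => nex.
have [h|h] := leP b (sup A).
  apply: nex; exists b; split=> //; have := ge_sup (ex_intro _ _ Aa) ubA.
  by move=> h2; apply/andP; split; lra.
(* Were [P] to hold up to [sup A + e], this point of [A] would exceed its supremum. *)
have : A (Num.min b (sup A + e)).
  split.
    rewrite le_min ge_min lexx ab /= andbT.
    have : a <= sup A by apply: ub_le_sup => //; exists b.
    by lra.
  move=> s; rewrite lt_min => /and3P[as_ sb se].
  have [hs|hs] := ltP s (sup A).
    have [|t [tb Pt] st] := @sup_adherent _ A (sup A - s) _ sA; first by rewrite subr_gt0.
    by apply: Pt; rewrite as_ /=; lra.
  by apply: contrapT => nP; apply: nex; exists s; rewrite hs se (ltW sb).
move=> /(ub_le_sup (ex_intro _ b ubA)); rewrite ge_min => /orP[]; lra.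
Qed.

Lemma continuous_gt (R : realType) (f : R -> R) (x c : R) :
  {for x, continuous f} -> c < f x ->
  exists2 e, 0 < e & forall s, `|s - x| < e -> c < f s.
Proof.
move=> cf fx; have : \forall s \near x, c < f s by exact: cvgr_gt cf _ fx.
move=> /nbhs_ballP[e e0 he]; exists e => // s hs; apply: he.
by rewrite /ball /= distrC.
Qed.

Lemma continuous_lt (R : realType) (f : R -> R) (x c : R) :
  {for x, continuous f} -> f x < c ->
  exists2 e, 0 < e & forall s, `|s - x| < e -> f s < c.
Proof.
move=> cf fx; have : \forall s \near x, f s < c by exact: cvgr_lt cf _ fx.
move=> /nbhs_ballP[e e0 he]; exists e => // s hs; apply: he.
by rewrite /ball /= distrC.
Qed.

Lemma first_ge0 (R : realType) (f : R -> R) (a b : R) :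
  a <= b -> continuous f -> 0 <= f b ->
  exists c, [/\ a <= c <= b, 0 <= f c & forall s, a <= s < c -> f s < 0].
Proof.
move=> ab cf fb; have [|c [cab cP cN]] := @init_sup _ (fun s => f s < 0) _ _ ab.
  by apply/negP; rewrite -leNgt.
exists c; split=> //; rewrite leNgt; apply/negP => fc.
have [e e0 he] := continuous_lt (cf c) fc.
have [s [/andP[cs se] _]] := cN _ e0; apply; apply: he.
by rewrite ger0_norm; lra.
Qed.

Lemma exit_ge0 (R : realType) (f : R -> R) (a b : R) :
  a <= b -> continuous f -> 0 <= f a -> f b < 0 ->
  exists c, [/\ a <= c < b, forall s, a <= s <= c -> 0 <= f s &
    forall e, 0 < e -> exists s, [/\ c < s < c + e, s <= b & f s < 0]].
Proof.
move=> ab cf fa fb.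
have [|c [/andP[ac cb] cP cN]] := @init_sup _ (fun s => 0 <= f s) _ _ ab.
  by move=> ?; lra.
have fc : 0 <= f c.
  rewrite leNgt; apply/negP => fc.
  have [e e0 he] := continuous_lt (cf c) fc.
  have [h|h] := leP c a; first by have := (le_anti (introT andP (conj ac h))) => ?; subst; lra.
  pose s := Num.max a (c - e / 2).
  have sc : s < c by rewrite /s gt_max; apply/andP; split; lra.
  have sa : a <= s by rewrite /s le_max lexx.
  have : 0 <= f s by apply: cP; rewrite sa sc.
  have : f s < 0.
    apply: he; rewrite distrC ger0_norm ?subr_ge0 ?(ltW sc)//.
    by have : c - e / 2 <= s by [rewrite /s le_max lexx orbT]; lra.
  by lra.
exists c; split.
- rewrite ac /= lt_neqAle cb andbT; apply/eqP => E; subst; lra.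
- move=> s /andP[as_]; rewrite le_eqVlt => /predU1P[->//|sc].
  by apply: cP; rewrite as_.
move=> e e0; have [s [/andP[cs se] sb /negP]] := cN _ e0; rewrite -ltNge => fs.
exists s; split=> //; rewrite se andbT lt_neqAle cs andbT.
by apply/eqP => E; subst; lra.
Qed.

(** At the last point [c] up to which [f] vanishes, take a step so short that the mean value bound
    makes the maximum of [|f|] at most half of itself. Differentiability is asked only just after
    each time, because an orbit is known to follow an arc only forward from a given time. *)
Lemma gronwall0 (R : realType) (f : R -> R) (p q C : R) :
  continuous f -> f p = 0 ->
  (forall t, p <= t < q -> exists2 e, 0 < e & forall s, t < s < t + e ->
     s < q -> exists2 d, is_derive s (1 : R) f d & `|d| <= C * `|f s|) ->
  forall t, p <= t <= q -> f t = 0.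
Proof.
move=> cf fp H t /andP[pt tq]; apply: contrapT => ft.
have cg : continuous (fun s => - `|f s|).
  by move=> x; apply: cvgN; apply: cvg_norm; exact: cf.
have [||c [/andP[pc ct] cP cN]] := @exit_ge0 _ _ _ _ pt cg.
- by rewrite fp normr0 oppr0.
- by rewrite oppr_lt0 normr_gt0; apply/eqP.
have fc : f c = 0.
  by apply/eqP; rewrite -normr_le0 -oppr_ge0; apply: cP; rewrite pc lexx.
have [|e e0 He] := H c; first by rewrite pc (lt_le_trans ct tq).
pose K := `|C| + 1.
have K0 : 0 < K by rewrite /K; have := normr_ge0 C; lra.
(* The last entry gives [K * e' <= 1/2], the contraction. *)
pose e' := Num.min e (Num.min (q - c) (2 * K)^-1).
have e'0 : 0 < e'.
  rewrite /e' !lt_min e0 subr_gt0 (lt_le_trans ct tq) /= invr_gt0; lra.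
have e'e : e' <= e by rewrite /e' ge_min lexx.
have e'q : e' <= q - c by rewrite /e' !ge_min lexx orbT.
have e'K : e' <= (2 * K)^-1 by rewrite /e' !ge_min lexx !orbT.
have [||m mI Hm] := @EVT_max R (fun s => `|f s|) c (c + e').
- by lra.
- by apply: continuous_subspaceT => x; apply: cvg_norm; exact: cf.
have fm : `|f m| <= 0.
  move: mI; rewrite in_itv /= => /andP[cm me].
  have := @mean_value_le _ f c m (K * `|f m|) cm cf.
  rewrite fc subr0 => /(_ _)/[dup] HH.
  have : `|f m| <= K * `|f m| * (m - c).
    apply: HH => s /andP[cs sm]; have [||d fd dC] := He s; [by apply/andP; split; lra|lra|].
    exists d => //; apply: (le_trans dC); apply: (@le_trans _ _ (K * `|f s|)).
      by apply: ler_wpM2r => //; rewrite /K; have := ler_norm C; lra.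
    by rewrite ler_pM2l//; apply: Hm; rewrite in_itv /=; apply/andP; split; lra.
  have : K * `|f m| * (m - c) <= K * `|f m| * (2 * K)^-1.
    by apply: ler_wpM2l; [rewrite mulr_ge0// ltW|lra].
  have -> : K * `|f m| * (2 * K)^-1 = `|f m| / 2 by field; lra.
  by lra.
have [s [/andP[cs se] st]] := cN _ e'0.
have : `|f s| <= `|f m| by apply: Hm; rewrite in_itv /=; apply/andP; split; lra.
by have := normr_ge0 (f s); lra.
Qed.

(** * Fixed points of Volterra operators *)

Lemma le_add_geometric (R : realType) (x y c : R) :
  (forall k : nat, x <= y + c * 2^-1 ^+ k) -> x <= y.
Proof.
move=> H; apply/ler_addgt0Pr => e e0.
have [c0|c0] := leP c 0.
  by have := H 0%N; rewrite expr0; lra.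
have : (fun k : nat => (2^-1 : R) ^+ k) @ \oo --> (0 : R).
  by apply: cvg_expr; rewrite ger0_norm; lra.
move=> /cvgrPdist_lt /(_ (e / c)) []; first by rewrite divr_gt0.
move=> k _ /(_ k); rewrite /= leqnn sub0r normrN => /(_ isT) hk.
have h2 : 2^-1 ^+ k < e / c by apply: le_lt_trans hk; exact: ler_norm.
have := H k; have : c * 2^-1 ^+ k <= e by rewrite mulrC -ler_pdivlMr// ltW.
lra.
Qed.

(** With [d k] the tail sum of the bounds, the intervals from [a k - d k] to [a k + d k] are nested;
    the supremum of their left ends lies in all of them. *)
Lemma geometric_limit (R : realType) (a : nat -> R) (c : R) :
  (forall k, `|a k.+1 - a k| <= c * 2^-1 ^+ k) ->
  exists l, forall k, `|l - a k| <= 2 * c * 2^-1 ^+ k.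
Proof.
move=> H; pose d k := 2 * c * 2^-1 ^+ k : R.
have dS k : d k.+1 = d k - c * 2^-1 ^+ k.
  by rewrite /d exprS; field.
have lo m n : (m <= n)%N -> a m - d m <= a n - d n.
  elim: n => [|n IH]; first by rewrite leqn0 => /eqP ->.
  rewrite leq_eqVlt => /predU1P[->//|/IH] h; apply: (le_trans h).
  by have := H n; rewrite dS ler_norml => /andP[]; lra.
have hi m n : (m <= n)%N -> a n + d n <= a m + d m.
  elim: n => [|n IH]; first by rewrite leqn0 => /eqP ->.
  rewrite leq_eqVlt => /predU1P[->//|/IH] h; apply: (le_trans _ h).
  by have := H n; rewrite dS ler_norml => /andP[]; lra.
have d0 k : 0 <= d k.
  by have := le_trans (normr_ge0 _) (H k); rewrite /d; lra.
have lohi m n : a m - d m <= a n + d n.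
  apply: (le_trans (lo _ _ (leq_maxl m n))); apply: (le_trans _ (hi _ _ (leq_maxr m n))).
  by have := d0 (maxn m n); lra.
pose A := [set a k - d k | k in [set: nat]].
have ubA : has_ubound A by exists (a 0%N + d 0%N) => _ [k _ <-]; exact: lohi.
exists (sup A) => k; rewrite -/(d k) ler_distl; apply/andP; split.
  by apply: ub_le_sup => //; exists k.
by apply: ge_sup; [exists (a k - d k), k|move=> _ [j _ <-]; exact: lohi].
Qed.

Lemma lipschitz_continuous (R : realType) (f : R -> R) (B : R) :
  (forall s t, `|f s - f t| <= B * `|s - t|) -> continuous f.
Proof.
move=> H x; apply/cvgrPdist_le => e e0.
near=> s; apply: (le_trans (H _ _)); apply: (@le_trans _ _ ((`|B| + 1) * `|x - s|)).
  by apply: ler_wpM2r => //; have := ler_norm B; lra.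
rewrite mulrC -ler_pdivlMr; last by have := normr_ge0 B; lra.
near: s; apply: cvgr_dist_le; first exact: cvg_id.
by rewrite divr_gt0//; have := normr_ge0 B; lra.
Unshelve. all: by end_near. Qed.

(** The 1-Lipschitz retraction of the line onto [[a, b]]; composing with it turns local bounds into
    global ones. *)
Definition clamp (R : realType) (a b x : R) : R := Num.max a (Num.min b x).

Lemma clamp_itv (R : realType) (a b x : R) : a <= b -> a <= clamp a b x <= b.
Proof. by move=> ab; rewrite /clamp le_max lexx ge_max ab ge_min lexx. Qed.

Lemma clamp_id (R : realType) (a b x : R) : a <= x <= b -> clamp a b x = x.
Proof. by rewrite /clamp => /andP[h1 h2]; rewrite (min_idPr h2) (max_idPr h1). Qed.

Lemma clamp_lipschitz (R : realType) (a b x y : R) :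
  `|clamp a b x - clamp a b y| <= `|x - y|.
Proof.
wlog xy : x y / x <= y => [W|].
  by case: (leP x y) => [/W//|/ltW/W]; rewrite distrC [leRHS]distrC.
rewrite [leRHS]distrC [leRHS]ger0_norm ?subr_ge0// ler_norml /clamp /Order.max /Order.min.
case: (ltP b x) => ?; case: (ltP b y) => ?; case: (ltP a b) => ?;
  case: (ltP a x) => ?; case: (ltP a y) => ?; apply/andP; split; lra.
Qed.

Lemma clamp_continuous (R : realType) (a b : R) : continuous (clamp a b).
Proof.
by apply: (@lipschitz_continuous _ _ 1) => s t; rewrite mul1r; exact: clamp_lipschitz.
Qed.

(** Fixed point of the integral operator, a contraction of factor [K * S]. Time is clamped to
    distance [S] from [x0], so continuity and the final bound hold on the whole line although the
    equation holds only inside. *)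
Lemma picard (R : realType) (Phi : R -> R -> R) (x0 u0 S B K : R) :
  0 < S -> 0 <= K -> K * S <= 2^-1 ->
  (forall v : R -> R, continuous v -> continuous (fun s => Phi s (v s))) ->
  (forall s u, `|Phi s u| <= B) ->
  (forall s u w, `|Phi s u - Phi s w| <= K * `|u - w|) ->
  exists u : R -> R, [/\ continuous u, u x0 = u0,
    forall s, `|s - x0| < S -> is_derive s (1 : R) u (Phi s (u s)) &
    forall s, `|u s - u0| <= B * S].
Proof.
move=> S0 K0 KS cPhi PhiB PhiK.
have B0 : 0 <= B by exact: le_trans (PhiB 0 0).
(* The default for discontinuous [v] only serves to make the operator [G] total. *)
have H (v : R -> R) : exists F : R -> R, continuous v ->
    F x0 = 0 /\ forall x, is_derive x (1 : R) F (Phi x (v x)).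
  case: (pselect (continuous v)) => cv; last by exists (fun=> 0).
  by have [F FE] := continuous_primitive x0 (cPhi v cv); exists F.
have [G GE] := choice H => {H}.
pose cl := clamp (x0 - S) (x0 + S).
have clI s : x0 - S <= cl s <= x0 + S by apply: clamp_itv; lra.
have clx0 : cl x0 = x0 by apply: clamp_id; apply/andP; split; lra.
pose T (v : R -> R) (s : R) := u0 + G v (cl s).
have cG v : continuous v -> continuous (G v).
  by move=> cv x; apply: der_continuous ((GE v cv).2 x).
have Tlip v : continuous v -> forall s t, `|T v s - T v t| <= B * `|s - t|.
  move=> cv s t; rewrite /T (_ : _ - _ = G v (cl s) - G v (cl t)); last by ring.
  apply: (@le_trans _ _ (B * `|cl s - cl t|)); last first.
    by apply: ler_wpM2l => //; exact: clamp_lipschitz.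
  apply: (@mean_value_le_sym _ _ (x0 - S) (x0 + S)) => //; first exact: cG.
  move=> x _; exists (Phi x (v x)); [exact: (GE v cv).2|exact: PhiB].
have Tc v : continuous v -> continuous (T v).
  by move=> cv; apply: lipschitz_continuous; exact: Tlip.
have Tx0 v : continuous v -> T v x0 = u0.
  by move=> cv; rewrite /T clx0 (GE v cv).1 addr0.
have TB v : continuous v -> forall s, `|T v s - u0| <= B * S.
  move=> cv s; have Tcl : T v s = T v (cl s) by rewrite /T [cl (cl s)]clamp_id ?clI.
  rewrite Tcl -[in X in `|_ - X|](Tx0 v cv); apply: (le_trans (Tlip v cv _ _)).
  by apply: ler_wpM2l => //; rewrite ler_distl; have /andP[h1 h2] := clI s; apply/andP; split; lra.
have TK v w M : continuous v -> continuous w -> (forall s, `|v s - w s| <= M) ->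
    forall s, `|T v s - T w s| <= M * 2^-1.
  move=> cv cw vw s.
  have M0 : 0 <= M by exact: le_trans (vw 0).
  rewrite /T (_ : _ - _ = (G v (cl s) - G w (cl s)) - (G v x0 - G w x0)); last first.
    by rewrite (GE v cv).1 (GE w cw).1; ring.
  apply: (@le_trans _ _ (K * M * `|cl s - x0|)).
    apply: (@mean_value_le_sym _ (fun s => G v s - G w s) (x0 - S) (x0 + S)) => //.
    - by move=> x; apply: cvgB; exact: cG.
    - move=> x _; exists (Phi x (v x) - Phi x (w x)).
        exact: derD ((GE v cv).2 x) (derN ((GE w cw).2 x)).
      by apply: (le_trans (PhiK _ _ _)); apply: ler_wpM2l.
    - by apply/andP; split; lra.
  rewrite -mulrA mulrCA; apply: ler_wpM2l => //; apply: le_trans KS.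
  by apply: ler_wpM2l => //; rewrite ler_distl; have /andP[h1 h2] := clI s; apply/andP; split; lra.
pose u_ k := iter k T (fun=> u0).
have uc k : continuous (u_ k) by elim: k => [|k IH]; [exact: cst_continuous|exact: Tc].
have ud k s : `|u_ k.+1 s - u_ k s| <= B * S * 2^-1 ^+ k.
  elim: k s => [|k IH] s; first by rewrite expr0 mulr1; apply: TB; exact: cst_continuous.
  by rewrite exprSr mulrA; exact: (TK _ _ _ (uc k.+1) (uc k) IH).
have [u uE] := choice (fun s => geometric_limit (fun k => ud k s)).
(* Continuity of the limit: every iterate is [B]-Lipschitz and [u] is within a geometrically small
   distance of it. *)
have ulip s t : `|u s - u t| <= B * `|s - t|.
  apply: (@le_add_geometric _ _ _ (4 * (B * S))) => k.
  have lipk : `|u_ k.+1 s - u_ k.+1 t| <= B * `|s - t| by exact: Tlip.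
  have hs := uE s k.+1; have ht := uE t k.+1.
  have h0 : 0 <= B * S * 2^-1 ^+ k by exact: le_trans (ud k s).
  rewrite exprS in hs ht.
  rewrite (_ : u s - u t = (u s - u_ k.+1 s) + (u_ k.+1 s - u_ k.+1 t) - (u t - u_ k.+1 t)); last by ring.
  apply: (le_trans (ler_normB _ _)); apply: (le_trans (lerD (ler_normD _ _) (lexx _))).
  lra.
have cu := lipschitz_continuous ulip.
have Tu s : T u s = u s.
  apply/eqP; rewrite -subr_eq0 -normr_le0.
  apply: (@le_add_geometric _ _ _ (2 * (B * S))) => k; rewrite add0r.
  have h1 : `|T u s - T (u_ k) s| <= 2 * (B * S) * 2^-1 ^+ k * 2^-1.
    by apply: TK => // t; exact: uE.
  have h2 := uE s k.+1; rewrite exprS in h2.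
  rewrite (_ : T u s - u s = (T u s - T (u_ k) s) - (u s - u_ k.+1 s)); last by rewrite /u_ /=; ring.
  by apply: (le_trans (ler_normB _ _)); lra.
exists u; split=> //; first by rewrite -Tu Tx0.
- move=> s; rewrite ltr_distl => hs.
  apply: (@der_near _ (fun t => u0 + G u t) _ (x0 - S) (x0 + S)) => //.
    by move=> t /andP[h1 h2]; rewrite -Tu /T /cl clamp_id// !ltW.
  by apply: der_eq (derD (der_cst _ _) ((GE u cu).2 s)) _; rewrite add0r.
- by move=> s; rewrite -Tu; exact: TB.
Qed.

(** * Uniform strict differentiability *)

(* [F e s v] is strictly differentiable in [v] at [v = r], uniformly in [s] and
   in small [e >= 0]; this passes to the time maps of [v' = e * F e s v]. *)
Definition strict_diff (R : realType) (r : R) (F : R -> R -> R -> R) : Prop :=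
  exists (F1 : R -> R) (B : R),
  [/\ continuous F1,
      forall s, `|F1 s| <= B /\ `|F 0 s r| <= B,
      forall k, 0 < k -> exists2 d, 0 < d & forall e s v w, 0 <= e < d ->
        `|v - r| < d -> `|w - r| < d -> `|F e s v - F 0 s r| <= k /\
        `|F e s v - F e s w - F1 s * (v - w)| <= k * `|v - w| &
      exists2 d, 0 < d & forall e (v : R -> R), 0 <= e < d -> continuous v ->
        (forall s, `|v s - r| < d) -> continuous (fun s => F e s (v s))].

Lemma small_factor (R : realType) (k C : R) : 0 < k -> 0 <= C ->
  exists2 k', 0 < k' <= 1 & k' * C <= k.
Proof.
move=> k0 C0; exists (Num.min 1 (k / (C + 1))).
  by rewrite lt_min ltr01 ge_min lexx /= andbT divr_gt0//; lra.
apply: (@le_trans _ _ (k / (C + 1) * (C + 1))).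
  by apply: ler_pM; rewrite ?ge_min ?lexx ?orbT//; [rewrite le_min ler01 /= divr_ge0//; lra|lra].
by rewrite divfK//; lra.
Qed.

Lemma strict_diff0 (R : realType) (r : R) (F : R -> R -> R -> R) :
  strict_diff r F -> continuous (fun s => F 0 s r).
Proof.
move=> [F1 [B [_ _ _ [d d0 H]]]]; apply: (H 0 (fun=> r)); first by rewrite lexx.
  exact: cst_continuous.
by move=> s; rewrite subrr normr0.
Qed.

Lemma sd_fun (R : realType) (r : R) (g : R -> R) (B : R) :
  continuous g -> (forall s, `|g s| <= B) -> strict_diff r (fun _ s _ => g s).
Proof.
move=> cg gB; exists (fun=> 0), B; split.
- exact: cst_continuous.
- by move=> s; rewrite normr0 gB (le_trans (normr_ge0 _) (gB 0)).
- move=> k k0; exists 1 => // e s v w _ _ _.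
  by rewrite /= !subrr mul0r subr0 normr0 (ltW k0) mulr_ge0// ltW.
- by exists 1.
Qed.

Lemma sd_cst (R : realType) (r c : R) : strict_diff r (fun _ _ _ => c).
Proof.
by apply: (@sd_fun _ r (fun=> c) `|c|) => //; exact: cst_continuous.
Qed.

Lemma sd_eps (R : realType) (r : R) : strict_diff r (fun e _ _ => e).
Proof.
exists (fun=> 0), 0; split.
- exact: cst_continuous.
- by move=> s; rewrite normr0.
- move=> k k0; exists k => // e s v w /andP[e0 ek] _ _.
  rewrite /= subr0 (ger0_norm e0) (ltW ek) subrr mul0r subrr normr0.
  by rewrite mulr_ge0// ltW.
- by exists 1 => // e v _ _ _; exact: cst_continuous.
Qed.

Lemma sd_var (R : realType) (r : R) : strict_diff r (fun _ _ v => v).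
Proof.
exists (fun=> 1), (`|r| + 1); split.
- exact: cst_continuous.
- by move=> s; rewrite normr1; split; have := normr_ge0 r; lra.
- move=> k k0; exists k => // e s v w _ hv hw; split; first exact: ltW.
  by rewrite mul1r subrr normr0 mulr_ge0// ltW.
- by exists 1.
Qed.

Lemma sd_add (R : realType) (r : R) (F G : R -> R -> R -> R) :
  strict_diff r F -> strict_diff r G ->
  strict_diff r (fun e s v => F e s v + G e s v).
Proof.
move=> [F1 [B [cF FB FK [d d0 Fc]]]] [G1 [C [cG GC GK [d' d'0 Gc]]]].
exists (fun s => F1 s + G1 s), (B + C); split.
- by move=> x; apply: cvgD; [exact: cF|exact: cG].
- move=> s; have [h1 h2] := FB s; have [h3 h4] := GC s.
  by split; apply: (le_trans (ler_normD _ _)); apply: lerD.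
- move=> k k0; have k20 : 0 < k / 2 by rewrite divr_gt0.
  have [a a0 Ha] := FK _ k20; have [b b0 Hb] := GK _ k20.
  exists (Num.min a b); first by rewrite lt_min a0.
  move=> e s v w; rewrite !lt_min => /and3P[e0 ea eb] /andP[va vb] /andP[wa wb].
  have [|h1 h2] := Ha e s v w _ va wa; first by rewrite e0.
  have [|h3 h4] := Hb e s v w _ vb wb; first by rewrite e0.
  split.
    rewrite /= [X in `|X| <= _](_ : _ = (F e s v - F 0 s r) + (G e s v - G 0 s r)); last by ring.
    by apply: (le_trans (ler_normD _ _)); lra.
  rewrite /= [X in `|X| <= _](_ : _ = (F e s v - F e s w - F1 s * (v - w)) +
    (G e s v - G e s w - G1 s * (v - w))); last by ring.
  by apply: (le_trans (ler_normD _ _)); lra.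
- exists (Num.min d d'); first by rewrite lt_min d0.
  move=> e v; rewrite lt_min => /and3P[e0 ed ed'] cv vd x.
  have h s : `|v s - r| < d /\ `|v s - r| < d' by apply/andP; rewrite -lt_min.
  apply: cvgD; [apply: Fc => //|apply: Gc => //]; rewrite ?e0//.
  - by move=> s; have [] := h s.
  - by move=> s; have [] := h s.
Qed.

Lemma sd_mul (R : realType) (r : R) (F G : R -> R -> R -> R) :
  strict_diff r F -> strict_diff r G ->
  strict_diff r (fun e s v => F e s v * G e s v).
Proof.
move=> SF SG; have cF0 := strict_diff0 SF; have cG0 := strict_diff0 SG.
move: SF SG => [F1 [B [cF FB FK [d d0 Fc]]]] [G1 [C [cG GC GK [d' d'0 Gc]]]].
have B0 : 0 <= B by exact: le_trans (FB 0).1.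
have C0 : 0 <= C by exact: le_trans (GC 0).1.
exists (fun s => F1 s * G 0 s r + F 0 s r * G1 s), (B * C + B * C); split.
- by move=> x; apply: cvgD; apply: cvgM; [exact: cF|exact: cG0|exact: cF0|exact: cG].
- move=> s; have [h1 h2] := FB s; have [h3 h4] := GC s.
  have BC0 : 0 <= B * C by rewrite mulr_ge0.
  split.
    apply: (le_trans (ler_normD _ _)); rewrite !normrM; apply: lerD; exact: ler_pM.
  rewrite normrM; apply: (@le_trans _ _ (B * C)); [exact: ler_pM|lra].
- move=> k k0.
  have M0 : 0 <= 2 * B + 2 * C + 2 by lra.
  have [q /andP[q0 q1] qM] := small_factor k0 M0.
  have [a a0 Ha] := FK _ q0; have [b b0 Hb] := GK _ q0.
  exists (Num.min a b); first by rewrite lt_min a0.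
  move=> e s v w; rewrite !lt_min => /and3P[e0 ea eb] /andP[va vb] /andP[wa wb].
  have [|h1 h2] := Ha e s v w _ va wa; first by rewrite e0.
  have [|h3 h4] := Hb e s v w _ vb wb; first by rewrite e0.
  have [|h5 _] := Ha e s w v _ wa va; first by rewrite e0.
  have [k1 k2] := FB s; have [k3 k4] := GC s.
  have Gv : `|G e s v| <= C + 1.
    rewrite -(subrK (G 0 s r) (G e s v)); apply: (le_trans (ler_normD _ _)).
    by move: h3 k4 q1; clear; lra.
  have Fw : `|F e s w| <= B + 1.
    rewrite -(subrK (F 0 s r) (F e s w)); apply: (le_trans (ler_normD _ _)).
    by move: h5 k2 q1; clear; lra.
  have w0 := normr_ge0 (v - w).
  split.
    rewrite /= [X in `|X| <= _](_ : _ = (F e s v - F 0 s r) * G e s v + F 0 s r * (G e s v - G 0 s r)); last by ring.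
    apply: (le_trans (ler_normD _ _)); rewrite !normrM.
    have := ler_pM (normr_ge0 _) (normr_ge0 _) h1 Gv.
    have := ler_pM (normr_ge0 _) (normr_ge0 _) k2 h3.
    by move: (mulr_ge0 (ltW q0) B0) (mulr_ge0 (ltW q0) C0) (ltW q0) qM; clear; lra.
  (* The product remainder is split so that each of the four terms carries a factor [q] and a factor
     [|v - w|]. *)
  rewrite /= [X in `|X| <= _](_ : _ = (F e s v - F e s w - F1 s * (v - w)) * G e s v +
     F1 s * (v - w) * (G e s v - G 0 s r) +
     F e s w * (G e s v - G e s w - G1 s * (v - w)) +
     (F e s w - F 0 s r) * (G1 s * (v - w))); last by ring.
  apply: (le_trans (ler_normD _ _)).
  apply: (le_trans (lerD (ler_normD _ _) (lexx _))).
  apply: (le_trans (lerD (lerD (ler_normD _ _) (lexx _)) (lexx _))).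
  have p1 : `|(F e s v - F e s w - F1 s * (v - w)) * G e s v| <= q * `|v - w| * (C + 1).
    by rewrite normrM; exact: ler_pM.
  have p2 : `|F1 s * (v - w) * (G e s v - G 0 s r)| <= B * `|v - w| * q.
    by rewrite !normrM; apply: ler_pM => //; rewrite ?mulr_ge0//; exact: ler_wpM2r.
  have p3 : `|F e s w * (G e s v - G e s w - G1 s * (v - w))| <= (B + 1) * (q * `|v - w|).
    by rewrite normrM; exact: ler_pM.
  have p4 : `|(F e s w - F 0 s r) * (G1 s * (v - w))| <= q * (C * `|v - w|).
    by rewrite !normrM; apply: ler_pM => //; rewrite ?mulr_ge0//; exact: ler_wpM2r.
  have p5 : q * (2 * B + 2 * C + 2) * `|v - w| <= k * `|v - w| by exact: ler_wpM2r.
  have p6 := mulr_ge0 (ltW q0) w0.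
  by move: p1 p2 p3 p4 p5 p6; clear; lra.
- exists (Num.min d d'); first by rewrite lt_min d0.
  move=> e v; rewrite lt_min => /and3P[e0 ed ed'] cv vd x.
  have h s : `|v s - r| < d /\ `|v s - r| < d' by apply/andP; rewrite -lt_min.
  apply: cvgM; [apply: Fc => //|apply: Gc => //]; rewrite ?e0//.
  - by move=> s; have [] := h s.
  - by move=> s; have [] := h s.
Qed.

Lemma sd_opp (R : realType) (r : R) (F : R -> R -> R -> R) :
  strict_diff r F -> strict_diff r (fun e s v => - F e s v).
Proof.
move=> SF; have := sd_mul (sd_cst r (-1)) SF.
by congr (strict_diff r _); apply/funext => e; apply/funext => s; apply/funext => v; rewrite mulN1r.
Qed.

Lemma sd_horner (R : realType) (r : R) (p : {poly R}) (F : R -> R -> R -> R) :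
  strict_diff r F -> strict_diff r (fun e s v => p.[F e s v]).
Proof.
move=> SF; elim/poly_ind: p => [|p c IH].
  have := sd_cst r 0; congr (strict_diff r _).
  by apply/funext => e; apply/funext => s; apply/funext => v; rewrite horner0.
have := sd_add (sd_mul IH SF) (sd_cst r c); congr (strict_diff r _).
by apply/funext => e; apply/funext => s; apply/funext => v; rewrite hornerMXaddC.
Qed.

(** Chain rule: the bound on [f2] makes the first-order remainder of [f] uniform in [s], and the
    margin [b] keeps [F e s v] in [[m, M]] for small [e] and [v] near [r]. *)
Lemma sd_comp (R : realType) (r : R) (F : R -> R -> R -> R)
    (f f1 f2 : R -> R) (m M b L : R) :
  0 < b -> (forall x, m <= x <= M -> is_derive x (1 : R) f (f1 x)) ->
  (forall x, m <= x <= M -> is_derive x (1 : R) f1 (f2 x)) ->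
  (forall x, m <= x <= M -> [/\ `|f x| <= L, `|f1 x| <= L & `|f2 x| <= L]) ->
  (forall s, m + b <= F 0 s r <= M - b) ->
  strict_diff r F -> strict_diff r (fun e s v => f (F e s v)).
Proof.
move=> b0 df df1 fL F0 SF; have cF0 := strict_diff0 SF.
have F0' s : m <= F 0 s r <= M by have /andP[? ?] := F0 s; apply/andP; split; lra.
have L0 : 0 <= L by have [/(le_trans (normr_ge0 _))] := fL _ (F0' 0).
(* The slope is taken at a third point [c], later the unperturbed value [F 0 s r], because the
   linear part in [strict_diff] depends on neither [e], [v] nor [w]. *)
have mv (g g1 g2 : R -> R) : (forall x, m <= x <= M -> is_derive x (1 : R) g (g1 x)) ->
    (forall x, m <= x <= M -> is_derive x (1 : R) g1 (g2 x)) ->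
    (forall x, m <= x <= M -> `|g2 x| <= L) ->
    forall x y c, m <= x <= M -> m <= y <= M -> m <= c <= M ->
    `|g x - g y - g1 c * (x - y)| <= L * (`|x - c| + `|y - c|) * `|x - y|.
  move=> dg dg1 gL x y c hx hy hc.
  pose h t := g t - g1 c * t.
  have -> : g x - g y - g1 c * (x - y) = h x - h y by rewrite /h; ring.
  pose p := Num.min x y; pose q := Num.max x y.
  have pI t : p <= t <= q -> m <= t <= M.
    rewrite /p /q ge_min le_max => /andP[/orP h1 /orP h2].
    case/andP: hx hy => ? ? /andP[? ?]; apply/andP; split; case: h1; case: h2; lra.
  apply: (@mean_value_cc _ h (fun t => g1 t - g1 c) p q).
  - move=> t /pI ht; have := derD (dg t ht) (derN (derM (der_cst (g1 c) t) (der_id t))).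
    by move=> /der_eq; apply; ring.
  - move=> t ht; have h1 : `|g1 t - g1 c| <= L * `|t - c|.
      by apply: (@mean_value_cc _ g1 g2 m M) => //; exact: pI.
    apply: (le_trans h1); apply: ler_wpM2l => //.
    move: ht; rewrite /p /q ge_min le_max => /andP[/orP h2 /orP h3].
    have [c1 c2] : - `|x - c| <= x - c /\ x - c <= `|x - c| by split; [rewrite lerNl -normrN ler_norm|exact: ler_norm].
    have [c3 c4] : - `|y - c| <= y - c /\ y - c <= `|y - c| by split; [rewrite lerNl -normrN ler_norm|exact: ler_norm].
    by rewrite ler_norml; have := normr_ge0 (x - c); have := normr_ge0 (y - c);
      case: h2; case: h3 => s1 s2 n1 n2;
      move: s1 s2 n1 n2 c1 c2 c3 c4; clear; move=> *; apply/andP; split; lra.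
  - by rewrite /p /q ge_min le_max !lexx !orbT.
  - by rewrite /p /q ge_min le_max !lexx.
have flip x y : m <= x <= M -> m <= y <= M -> `|f x - f y| <= L * `|x - y|.
  move=> hx hy; apply: (@mean_value_cc _ f f1 m M) => // t ht.
  by have [] := fL t ht.
have f1lip x y : m <= x <= M -> m <= y <= M -> `|f1 x - f1 y| <= L * `|x - y|.
  move=> hx hy; apply: (@mean_value_cc _ f1 f2 m M) => // t ht.
  by have [] := fL t ht.
have mvf := mv f f1 f2 df df1 (fun x hx => let: And3 _ _ h := fL x hx in h).
case: SF => [F1 [B [cF FB FK [d d0 Fc]]]].
have B0 : 0 <= B by exact: le_trans (FB 0).1.
have [db db0 Hb] := FK _ b0.
have FmM e s v : 0 <= e < db -> `|v - r| < db -> m <= F e s v <= M.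
  move=> he hv; have [h _] := Hb e s v v he hv hv.
  by move: h; rewrite ler_norml => /andP[? ?]; have /andP[? ?] := F0 s; apply/andP; split; lra.
exists (fun s => f1 (F 0 s r) * F1 s), (L * B + L); split.
- move=> s; apply: cvgM; last exact: cF.
  apply: (@continuous_comp _ _ _ (fun s => F 0 s r) f1); first exact: cF0.
  exact: der_continuous (df1 _ (F0' s)).
- move=> s; have [h1 h2 h3] := fL _ (F0' s); have [h4 _] := FB s.
  have LB : 0 <= L * B by exact: mulr_ge0.
  split; last by lra.
  by rewrite normrM; apply: (@le_trans _ _ (L * B)); [exact: ler_pM|lra].
- move=> k k0.
  have M0 : 0 <= L + L * (2 * (B + 2)) by have := mulr_ge0 L0 B0; lra.
  have [q /andP[q0 q1] qM] := small_factor k0 M0.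
  have [a a0 Ha] := FK _ q0.
  exists (Num.min a db); first by rewrite lt_min a0.
  move=> e s v w; rewrite !lt_min => /and3P[e0 ea eb] /andP[va vb] /andP[wa wb].
  have [|h1 h2] := Ha e s v w _ va wa; first by rewrite e0.
  have [|h5 _] := Ha e s w v _ wa va; first by rewrite e0.
  have hv : m <= F e s v <= M by apply: FmM; rewrite ?e0.
  have hw : m <= F e s w <= M by apply: FmM; rewrite ?e0.
  have [k1 k2] := FB s.
  split=> /=.
    apply: (le_trans (flip _ _ hv (F0' s))).
    have : L * `|F e s v - F 0 s r| <= L * q by exact: ler_wpM2l.
    by have := mulr_ge0 (mulr_ge0 L0 (ltW q0)) B0; move: (mulr_ge0 L0 (ltW q0)) qM; clear; nra.
  have w0 := normr_ge0 (v - w).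
  have Fvw : `|F e s v - F e s w| <= (B + q) * `|v - w|.
    rewrite -[F e s v - F e s w](subrK (F1 s * (v - w))).
    apply: (le_trans (ler_normD _ _)); rewrite normrM mulrDl addrC; apply: lerD => //.
    exact: ler_wpM2r.
  have h6 := mvf _ _ _ hv hw (F0' s).
  rewrite /= [X in `|X| <= _](_ : _ = (f (F e s v) - f (F e s w) - f1 (F 0 s r) * (F e s v - F e s w)) +
    f1 (F 0 s r) * (F e s v - F e s w - F1 s * (v - w))); last by ring.
  apply: (le_trans (ler_normD _ _)).
  have p1 : `|f1 (F 0 s r) * (F e s v - F e s w - F1 s * (v - w))| <= L * (q * `|v - w|).
    by rewrite normrM; apply: ler_pM => //; have [] := fL _ (F0' s).
  have p2 : L * (`|F e s v - F 0 s r| + `|F e s w - F 0 s r|) * `|F e s v - F e s w| <=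
      L * (q + q) * ((B + 2) * `|v - w|).
    apply: ler_pM => //; first by apply: mulr_ge0 => //; exact: addr_ge0.
      by apply: ler_wpM2l => //; exact: lerD.
    by apply: (le_trans Fvw); apply: ler_wpM2r => //; move: q1; clear; lra.
  have p5 : q * (L + L * (2 * (B + 2))) * `|v - w| <= k * `|v - w| by exact: ler_wpM2r.
  by move: h6 p1 p2 p5; clear; lra.
- exists (Num.min d db); first by rewrite lt_min d0.
  move=> e v; rewrite lt_min => /and3P[e0 ed ed'] cv vd s.
  have h t : `|v t - r| < d /\ `|v t - r| < db by apply/andP; rewrite -lt_min.
  apply: (@continuous_comp _ _ _ (fun s => F e s (v s)) f).
    apply: Fc => //; first by rewrite e0.
    by move=> t; have [] := h t.
  apply: (@der_continuous _ _ _ (f1 (F e s (v s)))); apply: df; apply: FmM; first by rewrite e0.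
  by have [] := h s.
Qed.

(** The values of [F 0 s r] lie between [m] and [B]; widening by [m / 2] on both sides leaves room
    for the perturbation while the inverse stays bounded by [q]. *)
Lemma sd_inv (R : realType) (r : R) (F : R -> R -> R -> R) (m : R) :
  0 < m -> (forall s, m <= F 0 s r) ->
  strict_diff r F -> strict_diff r (fun e s v => (F e s v)^-1).
Proof.
move=> m0 Fm SF; have [F1 [B [_ FB _ _]]] := SF.
pose f1 (x : R) := - x ^- 2; pose f2 (x : R) := 2 * x ^- 3.
pose q := (m / 2)^-1.
have q0 : 0 < q by rewrite invr_gt0; lra.
have xq x : m / 2 <= x -> 0 < x /\ `|x^-1| <= q.
  move=> h; have x0 : 0 < x by lra.
  by split=> //; rewrite ger0_norm ?invr_ge0 ?(ltW x0)// /q lef_pV2 ?posrE//; lra.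
apply: (@sd_comp _ r F _ f1 f2 (m / 2) (B + m / 2) (m / 2) (q + q ^+ 2 + 2 * q ^+ 3)).
- by lra.
- move=> x /andP[/xq[x0 _] _]; apply: der_eq (derV _ (der_id x)) _; first by rewrite gt_eqF.
  by rewrite mulr1.
- move=> x /andP[/xq[x0 _] _].
  have x20 : x ^+ 2 != 0 by rewrite expf_neq0// gt_eqF.
  apply: der_eq (derN (@derV _ (fun t : R => t ^+ 2) x _ x20 (derX 2 (der_id x)))) _.
  by rewrite /f2 /= expr1 mulr1; field; rewrite gt_eqF.
- move=> x /andP[/xq[x0 xq'] _].
  have q2 : 0 <= q ^+ 2 by exact: sqr_ge0.
  have q3 : 0 <= q ^+ 3 by rewrite exprn_ge0// ltW.
  split.
  + by apply: (le_trans xq'); lra.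
  + rewrite /f1 normrN -exprVn normrX; have : `|x^-1| ^+ 2 <= q ^+ 2 by apply: lerXn2r; rewrite ?nnegrE// ltW.
    by lra.
  + rewrite /f2 normrM -exprVn normrX (ger0_norm (_ : 0 <= 2))//.
    have : `|x^-1| ^+ 3 <= q ^+ 3 by apply: lerXn2r; rewrite ?nnegrE// ltW.
    by lra.
- move=> s; have := Fm s; have := (FB s).2; have := ler_norm (F 0 s r) => *.
  by apply/andP; split; lra.
- exact: SF.
Qed.

Lemma sd_sqrt (R : realType) (r : R) (F : R -> R -> R -> R) (m : R) :
  0 < m -> (forall s, m <= F 0 s r) ->
  strict_diff r F -> strict_diff r (fun e s v => Num.sqrt (F e s v)).
Proof.
move=> m0 Fm SF; have [F1 [B [_ FB _ _]]] := SF.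
pose f1 (x : R) := (2 * Num.sqrt x)^-1.
pose f2 (x : R) := - (1 / 4) * (Num.sqrt x)^-1 ^+ 3.
pose q := (Num.sqrt (m / 2))^-1.
have m20 : 0 < m / 2 by lra.
have q0 : 0 < q by rewrite invr_gt0 sqrtr_gt0.
have xq x : m / 2 <= x -> [/\ 0 < x, 0 < Num.sqrt x & `|(Num.sqrt x)^-1| <= q].
  move=> h; have x0 : 0 < x by lra.
  have sx : 0 < Num.sqrt x by rewrite sqrtr_gt0.
  split=> //; rewrite ger0_norm ?invr_ge0 ?(ltW sx)// /q lef_pV2 ?posrE ?sqrtr_gt0//.
  by rewrite ler_sqrt// ltW.
have q3 : 0 <= q ^+ 3 by rewrite exprn_ge0// ltW.
have B0 : 0 <= B by exact: le_trans (FB 0).1.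
apply: (@sd_comp _ r F _ f1 f2 (m / 2) (B + m / 2) (m / 2) (Num.sqrt (B + m / 2) + q + q ^+ 3)).
- by lra.
- move=> x /andP[/xq[x0 _ _] _]; apply: der_eq (der_sqrt x0 (der_id x)) _.
  by rewrite mulr1.
- move=> x /andP[/xq[x0 sx _] _].
  have x20 : 2 * Num.sqrt x != 0 by rewrite mulf_neq0// gt_eqF.
  apply: der_eq (@derV _ (fun t : R => 2 * Num.sqrt t) x _ x20 (derM (der_cst 2 x) (der_sqrt x0 (der_id x)))) _.
  by rewrite /f2; field; rewrite gt_eqF.
- move=> x /andP[/xq[x0 sx xq'] xB].
  split.
  + rewrite ger0_norm ?sqrtr_ge0//; have : Num.sqrt x <= Num.sqrt (B + m / 2) by rewrite ler_sqrt//; lra.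
    by lra.
  + rewrite /f1 invfM normrM (ger0_norm (_ : 0 <= 2^-1))//.
    by have := normr_ge0 (Num.sqrt x)^-1; have := sqrtr_ge0 (B + m / 2); lra.
  + rewrite /f2 normrM normrX normrN (ger0_norm (_ : 0 <= 1 / 4)) ?divr_ge0//.
    have : `|(Num.sqrt x)^-1| ^+ 3 <= q ^+ 3 by apply: lerXn2r; rewrite ?nnegrE// ltW.
    by have := exprn_ge0 3 (normr_ge0 (Num.sqrt x)^-1); have := sqrtr_ge0 (B + m / 2); lra.
- move=> s; have := Fm s; have := (FB s).2; have := ler_norm (F 0 s r) => *.
  by apply/andP; split; lra.
- exact: SF.
Qed.

Lemma der_littleo (R : realType) (f : R -> R) (r l : R) :
  (forall k, 0 < k -> exists2 d, 0 < d & forall a, `|a - r| < d ->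
     `|f a - f r - l * (a - r)| <= k * `|a - r|) ->
  is_derive r (1 : R) f l.
Proof.
move=> H; have C : (fun h => h^-1 *: (f (h *: 1 + r) - f r)) @ 0^' --> l.
  apply/cvgrPdist_le => k k0; have [d d0 Hd] := H _ k0.
  near=> h.
  have h0 : h != 0 by near: h; exact: nbhs_dnbhs_neq.
  have hd : `|h| < d.
    near: h; apply: dnbhs0_lt; exact: d0.
  have := Hd (h + r); rewrite addrK => /(_ hd) E.
  rewrite /GRing.scale /= mulr1 distrC.
  rewrite (_ : _ - l = h^-1 * (f (h + r) - f r - l * h)); last by field.
  by rewrite normrM normfV mulrC ler_pdivrMr ?normr_gt0.
by apply: DeriveDef; [apply/cvg_ex; exists l|exact: cvg_lim].
Unshelve. all: by end_near. Qed.

(** First-order expansion in [e] of the time map of [v' = e * F e s v] from [p] to [q]: [T0] gives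
    the displacement at [r], and its derivative [J1], the integral of [F1], gives the slope of the
    displacement up to a Lipschitz error. The radius [d] depends on the slope precision [k] alone,
    so the precision [k2] of the value at [r] can be chosen later, small compared with [d]; the sign
    change that produces a fixed point relies on this order. *)
Lemma half_map (R : realType) (r p q : R) (F : R -> R -> R -> R)
    (T0 : R -> R -> R) :
  p < q -> strict_diff r F ->
  (exists2 d, 0 < d & forall a s, `|a - r| < d -> p <= s <= q ->
     is_derive s (1 : R) (T0 a) (F 0 s a)) ->
  exists2 J1, is_derive r (1 : R) (fun a => T0 a q - T0 a p) J1 &
  forall k, 0 < k -> exists2 d, 0 < d & forall k2, 0 < k2 ->
  exists2 e0, 0 < e0 & forall e, 0 < e < e0 -> exists v : R -> R -> R,
  [/\ forall a, `|a - r| < d ->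
        [/\ continuous (v a), v a p = a,
            forall s, p - 1 < s < q + 1 ->
              is_derive s (1 : R) (v a) (e * F e s (v a s)),
            forall s, `|v a s - r| < k & forall s, `|v a s - a| <= k2],
      forall a b, `|a - r| < d -> `|b - r| < d ->
        `|(v a q - a) - (v b q - b) - e * J1 * (a - b)| <= k * e * `|a - b| &
      `|v r q - r - e * (T0 r q - T0 r p)| <= k2 * e].
Proof.
move=> pq [F1 [B [cF FB FK [dc dc0 Fc]]]] [dT dT0 HT].
have [G [_ GE]] := continuous_primitive 0 cF.
exists (G q - G p).
  apply: der_littleo => k k0.
  have qp0 : 0 <= q - p by lra.
  have [k' /andP[k'0 _] k'k] := small_factor k0 qp0.
  have [d d0 Hd] := FK _ k'0; exists (Num.min d dT); first by rewrite lt_min d0.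
  move=> a; rewrite lt_min => /andP[ad adT].
  pose X s := T0 a s - T0 r s - (a - r) * G s.
  have -> : T0 a q - T0 a p - (T0 r q - T0 r p) - (G q - G p) * (a - r) = X q - X p.
    by rewrite /X; ring.
  apply: (@le_trans _ _ (k' * `|a - r| * `|q - p|)); last first.
    by rewrite (ger0_norm qp0) mulrAC; apply: ler_wpM2r.
  have rr d' : 0 < d' -> `|r - r| < d' by rewrite subrr normr0.
  apply: (@mean_value_cc _ X (fun s => F 0 s a - F 0 s r - (a - r) * F1 s) p q) => //.
  - move=> s hs; have h1 := HT a s adT hs; have h2 := HT r s (rr _ dT0) hs.
    apply: der_eq (derD (derD h1 (derN h2)) (derN (derM (der_cst (a - r) s) (GE s)))) _.
    by ring.
  - move=> s hs; have [|_] := Hd 0 s a r _ ad (rr _ d0); first by rewrite lexx.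
    by rewrite (mulrC (a - r)).
  - by rewrite lexx ltW.
  - by rewrite lexx ltW.
move=> k k0.
have B0 : 0 <= B by exact: le_trans (FB 0).1.
(* The extra unit makes the equation hold on a neighbourhood of the closed interval from [p] to
   [q]. *)
pose S := q - p + 1; have S0 : 0 < S by rewrite /S; lra.
have pS s : p <= s <= q -> `|s - p| <= S.
  by rewrite /S => /andP[h1 h2]; rewrite ger0_norm; clear - h1 h2; lra.
have pS1 s : p - 1 < s < q + 1 -> `|s - p| < S.
  rewrite /S => /andP[h1 h2]; rewrite ltr_norml; apply/andP; split; clear - h1 h2 pq; lra.
have sub s : p <= s <= q -> p - 1 < s < q + 1.
  by move=> /andP[h1 h2]; apply/andP; split; clear - h1 h2; lra.
have ppq : p <= p <= q by rewrite lexx ltW.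
have qpq : p <= q <= q by rewrite lexx ltW.
pose L := B + 1; have L0 : 0 < L by rewrite /L; clear - B0; lra.
have S40 : 0 <= 4 * S by lra.
have [k1 /andP[k10 k1le] k1k] := small_factor k0 S40.
have [d1 d10 H1] := FK _ k10.
have [D D0 [Dd1 Ddc Dk]] : exists2 D, 0 < D & [/\ D <= d1, D <= dc & D <= k].
  exists (Num.min d1 (Num.min dc k)); first by rewrite !lt_min d10 dc0 k0.
  by rewrite !ge_min !lexx !orbT.
exists (D / 4); first by rewrite divr_gt0.
move=> k2 k20.
have [k3 /andP[k30 _] k3k] := small_factor k20 (ltW S0).
have [d2 d20 H2] := FK _ k30.
have LS0 : 0 <= L * S by rewrite mulr_ge0// ltW.
have half0 : 0 < 2^-1 :> R by rewrite invr_gt0.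
have D40 : 0 < D / 4 by rewrite divr_gt0.
have d220 : 0 < d2 / 2 by rewrite divr_gt0.
have k20' : 0 < k / 2 by rewrite divr_gt0.
have BLS : 0 <= 2 * B * (L * S) * S by rewrite !mulr_ge0// ltW.
(* [e1] makes Picard iteration contract; [e2] keeps solutions starting within [D / 4] of [r] within
   [D / 2]; [e3] keeps the solution from [r] where [H2] applies; [e4] absorbs the second-order slope
   error; [e5] bounds the total displacement by [k2]. *)
have [e1 /andP[e10 _] e1E] := small_factor half0 LS0.
have [e2 /andP[e20 _] e2E] := small_factor D40 LS0.
have [e3 /andP[e30 _] e3E] := small_factor d220 LS0.
have [e4 /andP[e40 _] e4E] := small_factor k20' BLS.
have [e5 /andP[e50 _] e5E] := small_factor k20 LS0.
exists (Num.min D (Num.min d2 (Num.min e1 (Num.min e2 (Num.min e3 (Num.min e4 e5)))))).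
  by rewrite !lt_min D0 d20 e10 e20 e30 e40.
move=> e; rewrite !lt_min => /and5P[e0 eD ed2 ee1 /and4P[ee2 ee3 ee4 ee5]].
have {}e5E : e * (L * S) <= k2 by apply: le_trans e5E; apply: ler_wpM2r => //; exact: ltW.
have {}e1E : e * (L * S) <= 2^-1 by apply: le_trans e1E; apply: ler_wpM2r => //; exact: ltW.
have {}e2E : e * (L * S) <= D / 4 by apply: le_trans e2E; apply: ler_wpM2r => //; exact: ltW.
have {}e3E : e * (L * S) <= d2 / 2 by apply: le_trans e3E; apply: ler_wpM2r => //; exact: ltW.
have {}e4E : e * (2 * B * (L * S) * S) <= k / 2 by apply: le_trans e4E; apply: ler_wpM2r => //; exact: ltW.
pose cl := clamp (r - D / 2) (r + D / 2).
have clD u : `|cl u - r| < D.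
  have : r - D / 2 <= cl u <= r + D / 2 by apply: clamp_itv; clear - D0; lra.
  by move=> /andP[h1 h2]; rewrite ltr_distl; apply/andP; split; clear - D0 h1 h2; lra.
(* Clamping the state makes the field globally bounded and Lipschitz; by the choice of [e2] the
   relevant solutions never notice it. *)
pose Phi s u := e * F e s (cl u).
have he : 0 <= e < d1 by rewrite (ltW e0) (lt_le_trans eD Dd1).
have FL s v w : `|v - r| < D -> `|w - r| < D -> `|F e s v - F e s w| <= L * `|v - w|.
  move=> hv hw; have [_ h] := H1 e s v w he (lt_le_trans hv Dd1) (lt_le_trans hw Dd1).
  rewrite -[F e s v - F e s w](subrK (F1 s * (v - w))).
  apply: (le_trans (ler_normD _ _)); rewrite normrM /L mulrDl mul1r addrC; apply: lerD.
    by apply: ler_wpM2r => //; have [] := FB s.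
  by apply: (le_trans h); rewrite -[leRHS]mul1r; exact: ler_wpM2r.
have FBd s v : `|v - r| < D -> `|F e s v| <= L.
  move=> hv; have [h _] := H1 e s v v he (lt_le_trans hv Dd1) (lt_le_trans hv Dd1).
  rewrite -(subrK (F 0 s r) (F e s v)); apply: (le_trans (ler_normD _ _)).
  by have [_ h2] := FB s; rewrite /L; clear - h h2 k1le; lra.
have P1 v : continuous v -> continuous (fun s => Phi s (v s)).
  move=> cv x; apply: cvgM; first exact: cvg_cst.
  apply: (Fc e (fun s => cl (v s))).
  - by rewrite (ltW e0) (lt_le_trans eD Ddc).
  - move=> y; apply: (@continuous_comp _ _ _ v cl); first exact: cv.
    exact: clamp_continuous.
  - by move=> s; exact: lt_le_trans (clD _) Ddc.
have P2 s u : `|Phi s u| <= e * L.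
  by rewrite /Phi normrM (gtr0_norm e0) ler_pM2l//; exact: FBd.
have P3 s u w : `|Phi s u - Phi s w| <= e * L * `|u - w|.
  rewrite /Phi -mulrBr normrM (gtr0_norm e0) -mulrA ler_pM2l//.
  apply: (le_trans (FL _ _ _ (clD _) (clD _))); apply: ler_wpM2l; first exact: ltW.
  exact: clamp_lipschitz.
have eL0 : 0 <= e * L by rewrite mulr_ge0// ltW.
have e1E' : e * L * S <= 2^-1 by rewrite -mulrA.
have [v vE] := choice (fun a => picard p a S0 eL0 e1E' P1 P2 P3).
have vD a : `|a - r| < D / 4 -> forall s, `|v a s - r| < D / 2.
  move=> ha s; have [_ _ _ /(_ s)] := vE a; rewrite -mulrA => h.
  rewrite -(subrK a (v a s)) -addrA; apply: (le_lt_trans (ler_normD _ _)).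
  by clear - h ha e2E; lra.
have vDD a : `|a - r| < D / 4 -> forall s, `|v a s - r| < D.
  by move=> ha s; apply: (lt_trans (vD a ha s)); clear - D0; lra.
have dv a : `|a - r| < D / 4 -> forall s, p - 1 < s < q + 1 ->
    is_derive s (1 : R) (v a) (e * F e s (v a s)).
  move=> ha s hs; have [_ _ /(_ s) h _] := vE a.
  apply: (der_eq (h (pS1 s hs))).
  rewrite /Phi; congr (e * F e s _); apply: clamp_id.
  by have := vD a ha s; rewrite ltr_distl => /andP[/ltW -> /ltW ->].
exists v; split.
- move=> a ha; have [cv vp _ vB] := vE a; split=> //; first exact: dv.
    by move=> s; apply: lt_le_trans Dk; exact: vDD.
  by move=> s; apply: (le_trans (vB s)); rewrite -mulrA.
- move=> a b ha hb; pose w s := v a s - v b s.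
  have [cva vap _ _] := vE a; have [cvb vbp _ _] := vE b.
  have wp : w p = a - b by rewrite /w vap vbp.
  have dw s : p <= s <= q -> is_derive s (1 : R) w (e * (F e s (v a s) - F e s (v b s))).
    move=> /sub hs; apply: der_eq (derD (dv a ha s hs) (derN (dv b hb s hs))) _.
    by ring.
  have cw : {within `[p, q], continuous (fun s => `|w s|)}.
    apply: continuous_subspaceT => x; apply: cvg_norm.
    by apply: cvgB; [exact: cva|exact: cvb].
  have [m mI Hm] := EVT_max (ltW pq) cw.
  have wstep s : p <= s <= q -> `|w s - w p| <= e * (L * S) * `|w m|.
    move=> hs; apply: (@le_trans _ _ (e * L * `|w m| * `|s - p|)).
      apply: (@mean_value_cc _ w _ p q _ dw) => // t ht.
      rewrite normrM (gtr0_norm e0) -mulrA ler_pM2l//.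
      apply: (le_trans (FL _ _ _ (vDD a ha t) (vDD b hb t))).
      by rewrite ler_pM2l//; apply: Hm; rewrite in_itv.
    by rewrite mulrAC mulrA; apply: ler_wpM2r => //; apply: ler_wpM2l => //; exact: pS.
  (* The maximum of [|w|] is at most its initial value plus half of itself. *)
  have wm : `|w m| <= 2 * `|a - b|.
    have := wstep m; rewrite in_itv /= in mI => /(_ mI) h.
    have : `|w m| <= `|w m - w p| + `|w p| by rewrite -{1}(subrK (w p) (w m)); exact: ler_normD.
    have : e * (L * S) * `|w m| <= 2^-1 * `|w m| by exact: ler_wpM2r.
    rewrite wp in h *; move=> h1 h2; clear - h h1 h2; lra.
  have ws s : p <= s <= q -> `|w s| <= 2 * `|a - b|.
    by move=> hs; apply: le_trans wm; apply: Hm; rewrite in_itv.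
  (* Subtracting the predicted linear part leaves a function whose derivative is of size [k1] plus
     order [e], times [e * |a - b|]. *)
  pose X s := w s - e * (a - b) * G s.
  have -> : v a q - a - (v b q - b) - e * (G q - G p) * (a - b) = X q - X p.
    by rewrite /X -wp /w vap vbp; ring.
  have ab0 := normr_ge0 (a - b).
  pose C := e * (`|a - b| * (2 * k1 + 2 * B * (L * S) * e)).
  have -> : k * e * `|a - b| = e * (`|a - b| * k) by ring.
  apply: (@le_trans _ _ (C * `|q - p|)).
    apply: (@mean_value_cc _ X (fun s => e * (F e s (v a s) - F e s (v b s)) - e * (a - b) * F1 s) p q) => //.
      move=> s hs; apply: der_eq (derD (dw s hs) (derN (derM (der_cst (e * (a - b)) s) (GE s)))) _.
      by ring.
    move=> s hs.
    have -> : e * (F e s (v a s) - F e s (v b s)) - e * (a - b) * F1 s =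
      e * ((F e s (v a s) - F e s (v b s) - F1 s * (v a s - v b s)) + F1 s * (w s - w p)).
      by rewrite wp /w; ring.
    rewrite normrM (gtr0_norm e0) /C ler_pM2l//.
    have [_ h] := H1 e s _ _ he (lt_le_trans (vDD a ha s) Dd1) (lt_le_trans (vDD b hb s) Dd1).
    apply: (le_trans (ler_normD _ _)); rewrite [leRHS]mulrDr; apply: lerD.
      apply: (le_trans h); apply: (@le_trans _ _ (k1 * (2 * `|a - b|))); last by clear; lra.
      by rewrite ler_pM2l//; exact: ws.
    rewrite normrM; apply: (@le_trans _ _ (B * (e * (L * S) * (2 * `|a - b|)))); last by clear; lra.
    apply: ler_pM => //; first by have [] := FB s.
    apply: (le_trans (wstep s hs)); apply: ler_wpM2l => //.
    by rewrite mulr_ge0// ltW.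
  have qpS : `|q - p| <= S by exact: pS.
  rewrite /C -mulrA ler_pM2l// -[leLHS]mulrA; apply: ler_wpM2l => //.
  apply: (@le_trans _ _ ((2 * k1 + 2 * B * (L * S) * e) * S)); last by clear - k1k e4E; lra.
  by apply: ler_wpM2l => //; apply: addr_ge0; rewrite !mulr_ge0// ltW.
- have rr : `|r - r| < D / 4 by rewrite subrr normr0.
  have [_ vrp _ _] := vE r.
  have vr s : `|v r s - r| < d2.
    have [_ _ _ /(_ s)] := vE r; rewrite -mulrA => h.
    by apply: (le_lt_trans h); clear - e3E d20; lra.
  pose X s := v r s - e * T0 r s.
  have -> : v r q - r - e * (T0 r q - T0 r p) = X q - X p by rewrite /X vrp; ring.
  apply: (@le_trans _ _ (e * k3 * `|q - p|)); last first.
    rewrite [leRHS]mulrC -mulrA ler_pM2l//; apply: le_trans k3k.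
    by apply: ler_wpM2l; [exact: ltW|exact: pS].
  apply: (@mean_value_cc _ X (fun s => e * (F e s (v r s) - F 0 s r)) p q) => //.
    move=> s hs; have h2 : is_derive s (1 : R) (T0 r) (F 0 s r).
      by apply: HT => //; rewrite subrr normr0.
    apply: der_eq (derD (dv r rr s (sub s hs)) (derN (derM (der_cst e s) h2))) _.
    by ring.
  move=> s hs; rewrite normrM (gtr0_norm e0) ler_pM2l//.
  by have [|h _] := H2 e s _ _ _ (vr s) (vr s); first by rewrite (ltW e0).
Qed.

(** * The perturbed half systems *)

Lemma der_horner (R : realType) (p : {poly R}) (f : R -> R) (x a : R) :
  is_derive x (1 : R) f a ->
  is_derive x (1 : R) (fun s => p.[f s]) (p^`().[f x] * a).
Proof.
move=> fa; elim/poly_ind: p => [|p c IH].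
  rewrite deriv0 horner0 mul0r (_ : (fun s => _) = fun=> 0); first exact: der_cst.
  by apply/funext => s; rewrite horner0.
rewrite (_ : (fun s => _) = fun s => p.[f s] * f s + c); last first.
  by apply/funext => s; rewrite hornerMXaddC.
apply: der_eq (derD (derM IH fa) (der_cst c x)) _.
by rewrite derivD derivM derivX derivC !hornerE; ring.
Qed.

(** The argument [A] stands for the derivative of the polynomial called [A] in the Melnikov
    function. *)
Definition right_pert (R : realType) (A B : {poly R}) (z : R * R) : R :=
  A.[z.2] + (1 - z.1) * B.[(1 - z.1) ^+ 2 - z.2 ^+ 2].

Definition right_system (R : realType) (A B : {poly R}) (e : R) (z : R * R) : R * R :=
  (- z.2 + e * right_pert A B z, 1 - z.1).

Definition left_system (R : realType) (f : {poly R}) (e : R) (z : R * R) : R * R :=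
  (- z.2 + e * (z.1 * f.[z.1 ^+ 2 + z.2 ^+ 2]),
   z.1 + e * (z.2 * f.[z.1 ^+ 2 + z.2 ^+ 2])).

(** Along the left system the radius satisfies [v' = e * left_rate f v], and time is the polar
    angle. *)
Definition left_rate (R : realType) (f : {poly R}) (v : R) : R := v * f.[v ^+ 2].

(* On the right half plane put [v = sqrt (1 - (1 - x)^2 + y^2)] and [s = y / v]:
   the section [x = 0] becomes [s = -1] and [s = 1], and
   [1 - x = sqrt (1 - v^2 (1 - s^2))].  The clamp only makes everything bounded
   for all real [s]. *)
Definition sgm (R : realType) (s : R) : R := clamp (-2) 2 s.

Definition right_c (R : realType) (s v : R) : R :=
  Num.sqrt (1 - v ^+ 2 * (1 - sgm s ^+ 2)).

Definition right_psi (R : realType) (A B : {poly R}) (s v : R) : R :=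
  A.[sgm s * v] + right_c s v * B.[1 - v ^+ 2].

(** With [c = 1 - x] and [psi] the perturbation, [dv/dt = e c psi / v] and
    [ds/dt = c (v - e s psi) / v^2]; the quotient is [e] times [right_rate]. *)
Definition right_den (R : realType) (A B : {poly R}) (e s v : R) : R :=
  v - e * (sgm s * right_psi A B s v).

Definition right_rate (R : realType) (A B : {poly R}) (e s v : R) : R :=
  right_psi A B s v * v * (right_den A B e s v)^-1.

Lemma sd_sgm (R : realType) (r : R) : strict_diff r (fun _ s _ => sgm s).
Proof.
apply: (@sd_fun _ r (@sgm R) 2); first exact: clamp_continuous.
move=> s; have : (-2 : R) <= sgm s <= 2 by apply: clamp_itv; lra.
by rewrite ler_norml.
Qed.

Lemma sd_sqr (R : realType) (r : R) (F : R -> R -> R -> R) :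
  strict_diff r F -> strict_diff r (fun e s v => F e s v ^+ 2).
Proof. by move=> SF; exact: (sd_mul SF SF). Qed.

Lemma sd_left (R : realType) (r : R) (f : {poly R}) :
  strict_diff r (fun _ _ v => left_rate f v).
Proof. exact: (sd_mul (sd_var r) (sd_horner f (sd_sqr (sd_var r)))). Qed.

Lemma sd_right_c (R : realType) (r : R) : 0 < r < 1 ->
  strict_diff r (fun _ s v => right_c s v).
Proof.
move=> /andP[r0 r1].
have S1 : strict_diff r (fun _ s v => 1 - v ^+ 2 * (1 - sgm s ^+ 2)).
  apply: (sd_add (sd_cst r 1)); apply: sd_opp; apply: sd_mul (sd_sqr (sd_var r)) _.
  exact: sd_add (sd_cst r 1) (sd_opp (sd_sqr (sd_sgm r))).
apply: (@sd_sqrt _ r (fun _ s v => 1 - v ^+ 2 * (1 - sgm s ^+ 2)) (1 - r ^+ 2)) => //.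
  by nra.
move=> s; have := mulr_ge0 (sqr_ge0 r) (sqr_ge0 (sgm s)); lra.
Qed.

Lemma sd_right_psi (R : realType) (r : R) (A B : {poly R}) : 0 < r < 1 ->
  strict_diff r (fun _ s v => right_psi A B s v).
Proof.
move=> hr; apply: sd_add.
  exact: (sd_horner A (sd_mul (sd_sgm r) (sd_var r))).
apply: (sd_mul (sd_right_c hr)).
exact: (sd_horner B (sd_add (sd_cst r 1) (sd_opp (sd_sqr (sd_var r))))).
Qed.

Lemma sd_right_den (R : realType) (r : R) (A B : {poly R}) : 0 < r < 1 ->
  strict_diff r (right_den A B).
Proof.
move=> hr; apply: (sd_add (sd_var r)); apply: sd_opp; apply: sd_mul (sd_eps r) _.
exact: sd_mul (sd_sgm r) (sd_right_psi A B hr).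
Qed.

Lemma sd_right (R : realType) (r : R) (A B : {poly R}) : 0 < r < 1 ->
  strict_diff r (right_rate A B).
Proof.
move=> hr; apply: (sd_mul (sd_mul (sd_right_psi A B hr) (sd_var r))).
apply: (@sd_inv _ r (right_den A B) r).
- by case/andP: hr.
- by move=> s; rewrite /right_den mul0r subr0.
- exact: sd_right_den.
Qed.

(** Primitive in [s] of the rate at [e = 0]: after [y = s a] it contains the classical primitive of
    [sqrt (h + y^2)] with [h = 1 - a^2]. *)
Definition right_prim (R : realType) (A B : {poly R}) (a s : R) : R :=
  a^-1 * (A.[s * a] + B.[1 - a ^+ 2] * (2^-1 * (s * a * Num.sqrt (1 - a ^+ 2 + (s * a) ^+ 2)
   + (1 - a ^+ 2) * ln (s * a + Num.sqrt (1 - a ^+ 2 + (s * a) ^+ 2))))).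

Lemma der_right_prim (R : realType) (A B : {poly R}) (a s : R) : 0 < a < 1 ->
  -2 <= s <= 2 ->
  is_derive s (1 : R) (right_prim A B a) (right_rate A^`() B 0 s a).
Proof.
move=> /andP[a0 a1] hs; have sE : sgm s = s by exact: clamp_id.
pose h := 1 - a ^+ 2; have h0 : 0 < h by rewrite /h; nra.
pose w t : R := h + (t * a) ^+ 2.
have w0 : 0 < w s by rewrite /w; have := sqr_ge0 (s * a); lra.
have dy : is_derive s (1 : R) (fun t => t * a) a.
  by apply: der_eq (derM (der_id s) (der_cst a s)) _; rewrite mulr0 addr0 mul1r.
have dw : is_derive s (1 : R) w (2 * (s * a) * a).
  by apply: der_eq (derD (der_cst h s) (derX 2 dy)) _; rewrite /= add0r expr1.
have dq := der_sqrt w0 dw.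
pose c := Num.sqrt (w s).
have c0 : 0 < c by rewrite sqrtr_gt0.
have cE : c ^+ 2 = h + (s * a) ^+ 2 by rewrite sqr_sqrtr ?ltW.
have yc : 0 < s * a + c.
  have : `|s * a| < c.
    by rewrite -sqrtr_sqr ltr_sqrt ?/w//; lra.
  by rewrite ltr_norml => /andP[? _]; lra.
have dl := @der_ln _ (fun t => t * a + Num.sqrt (w t)) s _ yc (derD dy dq).
have D := derM (der_cst a^-1 s) (derD (der_horner A dy) (derM (der_cst B.[h] s)
  (derM (der_cst 2^-1 s) (derD (derM dy dq) (derM (der_cst h s) dl))))).
apply: der_eq D _; rewrite -/c.
have dE : right_den A^`() B 0 s a = a by rewrite /right_den mul0r subr0.
rewrite /right_rate dE mulfK ?gt_eqF// /right_psi /right_c sE.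
have -> : 1 - a ^+ 2 * (1 - s ^+ 2) = w s by rewrite /w /h; ring.
rewrite -/c -/h !mul0r !add0r.
have -> : 2^-1 * (a * c + s * a * ((2 * c)^-1 * (2 * (s * a) * a)) +
   h * ((s * a + c)^-1 * (a + (2 * c)^-1 * (2 * (s * a) * a)))) = a * c.
  have -> : h = c ^+ 2 - (s * a) ^+ 2 by rewrite cE; ring.
  by field; rewrite !gt_eqF.
by field; rewrite gt_eqF.
Qed.

Definition melnikov (R : realType) (A B f : {poly R}) (a : R) : R :=
  pi * left_rate f a + (A.[a] - A.[- a]) / a +
  B.[1 - a ^+ 2] * (1 + (1 - a ^+ 2) / (2 * a) * (ln (1 + a) - ln (1 - a))).

(** The two displacements in the shape that [half_map] returns, hence the term with factor [0]. At
    [s = -1] and [s = 1] the square root in [right_prim] equals [1]. *)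
Lemma melnikovE (R : realType) (A B f : {poly R}) (a : R) : a != 0 ->
  melnikov A B f a = (pi * left_rate f a - 0 * left_rate f a) +
    (right_prim A B a 1 - right_prim A B a (-1)).
Proof.
move=> a0; rewrite /melnikov /right_prim !mul1r !mulN1r sqrrN subrK sqrtr1.
rewrite (addrC a 1) (addrC (- a) 1); by field.
Qed.

(** * Time changes and gluing of arcs *)

(** [sg] is the inverse of a primitive of [W]; the lower bound [c] makes that primitive onto, so
    [sg] exists for all times. *)
Lemma reparametrize (R : realType) (W : R -> R) (x0 c : R) :
  continuous W -> 0 < c -> (forall s, c <= W s) ->
  exists sg : R -> R, [/\ sg 0 = x0,
    forall t, is_derive t (1 : R) sg (W (sg t))^-1,
    forall s t, s < t -> sg s < sg t &
    forall y, exists t, sg t = y].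
Proof.
move=> cW c0 Wc; have [t [t0 dt]] := continuous_primitive x0 cW.
have ct : continuous t by move=> x; exact: der_continuous (dt x).
have grow x y : x < y -> c * (y - x) <= t y - t x.
  move=> xy; have [|z [d [_ dz ->]]] := mean_value xy ct.
    by move=> s _; exists (W s).
  by rewrite ler_pM2r ?subr_gt0// (der_uniq dz (dt z)).
have tinc x y : x < y -> t x < t y.
  move=> xy; rewrite -subr_gt0; apply: lt_le_trans (grow _ _ xy).
  by rewrite mulr_gt0// subr_gt0.
have tinj : injective t.
  by move=> x y E; case: (ltgtP x y) => // /tinc; rewrite E ltxx.
have tsurj y : exists x, t x = y.
  pose M := `|y| / c + 1.
  have M0 : 0 < M by rewrite /M ltr_wpDl// divr_ge0// ltW.
  have cM : c * M = `|y| + c by rewrite /M mulrDr mulr1 mulrC divfK// gt_eqF.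
  have h1 : t (x0 - M) <= y.
    have := grow (x0 - M) x0; rewrite t0 (_ : x0 - (x0 - M) = M) ?cM; last by ring.
    move=> h.
    have : `|y| + c <= 0 - t (x0 - M) by apply: h; lra.
    by have := ler_norm (- y); rewrite normrN; lra.
  have h2 : y <= t (x0 + M).
    have := grow x0 (x0 + M); rewrite t0 subr0 (_ : x0 + M - x0 = M) ?cM; last by ring.
    move=> h.
    have : `|y| + c <= t (x0 + M) by apply: h; lra.
    by have := ler_norm y; lra.
  have [||x _ <-] := @IVT R t (x0 - M) (x0 + M) y _ (continuous_subspaceT ct).
  - by lra.
  - by rewrite ge_min h1 le_max h2 orbT.
  - by exists x.
have [g gE] := choice tsurj.
have gK x : g (t x) = x by apply: tinj; rewrite gE.
exists g; split.
- by rewrite -t0 gK.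
- move=> s; rewrite -{1}(gE s); apply: is_derive_inverse (dt _) _.
  + by near=> x; exact: gK.
  + by near=> x; exact: ct.
  + by rewrite gt_eqF// (lt_le_trans c0).
- move=> s u su; rewrite ltNge le_eqVlt; apply/negP => /predU1P[E|/tinc].
    by move: su; rewrite -(gE s) -(gE u) E ltxx.
  by rewrite !gE => h; have := lt_trans su h; rewrite ltxx.
- by move=> y; exists (t y).
Unshelve. all: by end_near. Qed.

Lemma period_int (R : realType) (V : Type) (g : R -> V) (T : R) :
  (forall u, g (u + T) = g u) -> forall (k : int) u, g (u + k%:~R * T) = g u.
Proof.
move=> gT; have N (n : nat) u : g (u + n%:R * T) = g u.
  elim: n u => [|n IH] u; first by rewrite mul0r addr0.
  by rewrite -natr1 mulrDl mul1r addrA gT IH.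
case=> n u; first exact: N.
by rewrite NegzE mulrNz mulNr -[LHS](N n.+1) subrK.
Qed.

Lemma period_reduce (R : realType) (T u : R) : 0 < T ->
  exists k : int, 0 <= u + k%:~R * T < T.
Proof.
move=> T0; exists (- Num.floor (u / T)).
have /andP[h1 h2] := real_floor_itv (num_real (u / T)).
have E : u = u / T * T by rewrite divfK// gt_eqF.
rewrite mulrNz mulNr {1 3}E -mulrBl; apply/andP; split.
  by apply: mulr_ge0; [rewrite subr_ge0|exact: ltW].
rewrite -[ltRHS]mul1r ltr_pM2r// ltrBlDr addrC.
by move: h2; rewrite intrD.
Qed.

Lemma periodic_extension (R : realType) (G : R -> R * R) (T : R) :
  0 < T -> continuous G -> (forall u, u <= 0 -> G u = G 0) ->
  (forall u, T <= u -> G u = G 0) ->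
  exists g : R -> R * R, [/\ continuous g, forall u, g (u + T) = g u &
    forall u, 0 <= u <= T -> g u = G u].
Proof.
move=> T0 cG G0 GT.
have [k kE] := choice (fun u => period_reduce u T0).
have kU u (j : int) : 0 <= u + j%:~R * T < T -> k u = j.
  have := kE u => /andP[h1 h2] /andP[h3 h4].
  have H (i l : int) : 0 <= u + i%:~R * T -> u + l%:~R * T < T -> (l <= i)%R.
    move=> hi hl; rewrite -ltzD1 -(ltr_int R) intrD -(ltr_pM2r T0) mulrDl mul1r.
    by clear - hi hl; lra.
  by apply/eqP; rewrite eq_le H// H.
pose g u := G (u + (k u)%:~R * T).
exists g; split.
- move=> x; pose j := k x.
  (* At every point near [x] at least one of these two translates is in the range where [G] is
     constantly [G 0], so [h] is a single continuous formula for [g] on both sides of a junction. *)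
  pose h u := G (u + j%:~R * T) + G (u + (j + 1)%:~R * T) - G 0.
  have ch : continuous h.
    move=> y; apply: cvgB; last exact: cvg_cst.
    apply: cvgD; apply: (@continuous_comp _ _ _ (fun u => u + _) G); try exact: cG;
      by apply: cvgD; [exact: cvg_id|exact: cvg_cst].
  have gh u : - T <= u + j%:~R * T < T -> g u = h u.
    rewrite /h intrD mulrDl mul1r addrA => /andP[h1 h2].
    case: (leP 0 (u + j%:~R * T)) => h3.
      rewrite [G (_ + T)]GT; last by clear - h3; lra.
      by rewrite addrK /g (kU u j)// h3.
    rewrite [G (u + _)]G0; last exact: ltW.
    rewrite [RHS]addrC addKr /g (kU u (j + 1)).
      by rewrite intrD mulrDl mul1r addrA.
    by rewrite intrD mulrDl mul1r addrA; apply/andP; split; clear - h1 h2 h3; lra.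
  have /andP[hx1 hx2] : 0 <= x + j%:~R * T < T by exact: kE.
  have gx : g x = h x by apply: gh; rewrite hx2 andbT (le_trans _ hx1)// oppr_le0 ltW.
  have : h y @[y --> x] --> g x by rewrite gx; exact: ch.
  apply: cvg_trans; apply: near_eq_cvg.
  have : \forall y \near x, y \in `] - T - j%:~R * T, T - j%:~R * T[.
    by apply: near_in_itvoo; rewrite in_itv /=; apply/andP; split; clear - hx1 hx2 T0; lra.
  apply: filterS => y; rewrite in_itv /= => /andP[h1 h2]; apply/esym/gh.
  by apply/andP; split; clear - h1 h2; lra.
- move=> u; rewrite /g; have -> : k (u + T) = k u - 1.
    apply: kU; have := kE u; rewrite intrD mulrDl mulN1r.
    by rewrite (_ : u + T + _ = u + (k u)%:~R * T)//; ring.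
  by congr G; rewrite intrD; ring.
- move=> u /andP[u0]; rewrite le_eqVlt /g => /predU1P[->|uT].
    rewrite (kU T (-1)) ?mulN1r ?subrr; last by rewrite lexx T0.
    by rewrite [G T]GT.
  by rewrite (kU u 0) ?mul0r ?addr0// u0.
Qed.

Lemma solves_on_near (R : realType) (F : R * R -> R * R) (g h : R -> R * R)
    (s t k : R) :
  (forall u, s < u < t -> g u = h (u + k)) ->
  solves_on F h (s + k) (t + k) -> solves_on F g s t.
Proof.
move=> gh H u hu.
have [|h1 h2] := H (u + k); first by case/andP: hu => ? ?; rewrite !ltrD2r; apply/andP.
rewrite gh//; split.
  by apply: (der_near hu _ (der_shift h1)) => v hv; rewrite gh.
by apply: (der_near hu _ (der_shift h2)) => v hv; rewrite gh.
Qed.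

(** Injectivity of [gl] is asked in the open interval only: its end points belong to [gr], and
    elsewhere the sign of the first coordinate separates the two arcs. *)
Lemma glue_arcs (R : realType) (Fr Fl : R * R -> R * R) (gl gr : R -> R * R)
    (T1 T2 : R) :
  continuous gl -> continuous gr -> 0 < T1 -> 0 < T2 ->
  gl T1 = gr 0 -> gr T2 = gl 0 ->
  Defs.left_arc Fl gl 0 T1 -> Defs.right_arc Fr gr 0 T2 ->
  (forall u v : R, 0 < u < T1 -> 0 < v < T1 -> gl u = gl v -> u = v) ->
  (forall u v : R, 0 <= u <= T2 -> 0 <= v <= T2 -> gr u = gr v -> u = v) ->
  (forall u : R, 0 <= u <= T2 -> 0 <= (gr u).1) ->
  periodic_orbit Fr Fl (gl @` [set u | 0 <= u <= T1] `|` gr @` [set u | 0 <= u <= T2]).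
Proof.
move=> cgl cgr T10 T20 E1 E2 [sl xl] [sr xr] il ir xr'.
(* Concatenation as one formula: outside its own interval each arc is frozen at an end point, so
   continuity is immediate. *)
pose G u := gl (clamp 0 T1 u) + gr (clamp 0 T2 (u - T1)) - gl T1.
have clo (a u : R) : 0 <= a -> u <= 0 -> clamp 0 a u = 0.
  by move=> a0 u0; rewrite /clamp (min_idPr (le_trans u0 a0)) (max_idPl u0).
have chi (a u : R) : 0 <= a -> a <= u -> clamp 0 a u = a.
  by move=> a0 u0; rewrite /clamp (min_idPl u0) (max_idPr a0).
have GL u : 0 <= u <= T1 -> G u = gl u.
  move=> hu; rewrite /G clamp_id// (clo T2); last 2 first.
  - exact: ltW.
  - by rewrite subr_le0; case/andP: hu.
  by rewrite -E1 addrK.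
have GR u : T1 <= u <= T1 + T2 -> G u = gr (u - T1).
  move=> /andP[h1 h2]; rewrite /G (chi T1)//; last exact: ltW.
  rewrite clamp_id; last by rewrite subr_ge0 h1 lerBlDl.
  by rewrite [LHS]addrC addKr.
pose T := T1 + T2.
have T0 : 0 < T by rewrite addr_gt0.
have G00 : G 0 = gl 0 by rewrite GL// lexx ltW.
have [||||g [cg gT gG]] := @periodic_extension _ G T.
- exact: T0.
- move=> x; apply: cvgB; last exact: cvg_cst.
  apply: cvgD.
    apply: (@continuous_comp _ _ _ (clamp 0 T1) gl); last exact: cgl.
    exact: clamp_continuous.
  apply: (@continuous_comp _ _ _ (fun u => clamp 0 T2 (u - T1)) gr); last exact: cgr.
  apply: (@continuous_comp _ _ _ (fun u => u - T1) (clamp 0 T2)); last exact: clamp_continuous.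
  by apply: cvgB; [exact: cvg_id|exact: cvg_cst].
- move=> u u0; rewrite G00 /G (clo T1) ?(ltW T10)// (clo T2) ?(ltW T20)//.
    by rewrite -E1 addrK.
  by rewrite subr_le0; exact: le_trans u0 (ltW T10).
- move=> u uT; rewrite G00 /G (chi T1) ?(ltW T10)//; last first.
    by apply: le_trans uT; rewrite /T lerDl ltW.
  rewrite (chi T2) ?(ltW T20)//; last by rewrite lerBrDl.
  by rewrite [LHS]addrC addKr.
have T1T : T1 <= T by rewrite /T lerDl ltW.
have gL u : 0 <= u <= T1 -> g u = gl u.
  by move=> hu; rewrite gG ?GL//; case/andP: hu => -> /le_trans ->.
have gR u : T1 <= u <= T -> g u = gr (u - T1).
  move=> hu; rewrite gG ?GR//; case/andP: hu => h1 ->; rewrite andbT.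
  by apply: le_trans h1; exact: ltW.
pose tau (i : nat) : R := if i is 0%N then 0 else if i is 1%N then T1 else T.
exists g, T, 2%N, tau; split=> //.
- have W u v : 0 <= u < T -> 0 <= v < T -> u <= v -> g u = g v -> u = v.
    move=> /andP[u0 uT] /andP[v0 vT] uv.
    case: (ltP v T1) => [vT1|vT1].
      have uT1 := le_lt_trans uv vT1.
      rewrite (gL u) ?u0 ?(ltW uT1)// (gL v) ?v0 ?(ltW vT1)// => E.
      have EE : gl 0 = gr T2 by [].
      have xT2 : 0 <= (gr T2).1 by apply: xr'; rewrite lexx ltW.
      move: u0; rewrite le_eqVlt => /predU1P[u0|u0]; last first.
        by apply: il => //; rewrite ?u0//; apply/andP; split=> //; exact: lt_le_trans uv.
      move: v0; rewrite le_eqVlt => /predU1P[<-//|v0].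
      have := xl v; rewrite v0 vT1 -E -u0 EE => /(_ isT).
      by rewrite ltNge xT2.
    have vI : 0 <= v - T1 <= T2 by rewrite subr_ge0 vT1 lerBlDl ltW.
    rewrite (gR v) ?vT1 ?(ltW vT)//.
    case: (ltP u T1) => [uT1|uT1]; last first.
      rewrite (gR u) ?uT1 ?(ltW uT)// => /ir h.
      have : u - T1 = v - T1 by apply: h => //; rewrite subr_ge0 uT1 lerBlDl ltW.
      by move/addIr.
    rewrite (gL u) ?u0 ?(ltW uT1)//.
    move: u0; rewrite le_eqVlt => /predU1P[<-|u0] E; last first.
      have := xl u; rewrite u0 uT1 E => /(_ isT).
      by rewrite ltNge xr'.
    have : T2 = v - T1 by apply: ir => //; [rewrite lexx ltW|rewrite E2].
    by move=> h; move: vT; rewrite /T h addrC subrK ltxx.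
  move=> u v hu hv E; case: (leP u v) => [uv|/ltW vu]; first exact: W.
  by apply/esym; exact: W.
- split=> //; case=> [|[|//]] _ /=; split=> //.
  + right; split.
      apply: (@solves_on_near _ _ _ gl _ _ 0); last by rewrite !addr0.
      by move=> u /andP[h1 h2]; rewrite addr0 gL// !ltW.
    by move=> u /andP[h1 h2]; rewrite gL ?xl ?h1// !ltW.
  + by rewrite /T ltrDl.
  + left; split.
      apply: (@solves_on_near _ _ _ gr _ _ (- T1)).
        by move=> u /andP[h1 h2]; rewrite gR// !ltW.
      by rewrite subrr /T addrC addKr.
    move=> u /andP[h1 h2]; rewrite gR ?(ltW h1) ?(ltW h2)//; apply: xr'.
    by rewrite subr_ge0 (ltW h1) lerBlDl ltW.
- apply/seteqP; split=> [_ [[u /= hu <-]|[u /= hu <-]]|_ [u _ <-]].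
  + by exists u => //; rewrite gL.
  + exists (u + T1) => //; case/andP: hu => h1 h2; rewrite gR ?addrK//.
    by rewrite lerDr h1 /T addrC lerD2l.
  + have [k hk] := period_reduce u T0; rewrite -(period_int gT k).
    case/andP: hk; set w := u + _ => h1 h2.
    case: (leP w T1) => h3.
      by left; exists w; rewrite ?gL ?h1//= h1 h3.
    right; exists (w - T1); last by rewrite gR ?(ltW h3) ?(ltW h2).
    by rewrite /= subr_ge0 (ltW h3) lerBlDl ltW.
Qed.

(** * Periodic orbits near an unperturbed one *)

Lemma locate_arc (R : realType) (tau : nat -> R) (m : nat) (w : R) :
  tau 0%N <= w -> w < tau m -> exists2 i, (i < m)%N & tau i <= w < tau i.+1.
Proof.
move=> t0; elim: m => [|m IH] wm; first by move: (le_lt_trans t0 wm); rewrite ltxx.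
case: (ltP w (tau m)) => [/IH[i im h]|h]; last by exists m => //; rewrite h.
by exists i => //; exact: ltnW.
Qed.

Lemma arc_sub (R : realType) (F : R * R -> R * R) (g : R -> R * R)
    (P : R * R -> Prop) (s t s' t' k : R) :
  (forall u, g (u + k) = g u) -> s <= s' + k -> t' + k <= t ->
  (solves_on F g s t /\ forall u, s < u < t -> P (g u)) ->
  solves_on F g s' t' /\ forall u, s' < u < t' -> P (g u).
Proof.
move=> gk ss tt [H1 H2].
have sub u : s' < u < t' -> s < u + k < t.
  move=> /andP[h1 h2]; apply/andP; split.
    by apply: (le_lt_trans ss); rewrite ltrD2r.
  by apply: (lt_le_trans _ tt); rewrite ltrD2r.
split; last by move=> u /sub/H2; rewrite gk.
apply: (@solves_on_near _ _ _ g _ _ k) => [u _|u hu]; first by rewrite gk.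
by apply: H1; case/andP: hu => h1 h2; rewrite (le_lt_trans ss h1) (lt_le_trans h2 tt).
Qed.

(** Minimality of the period becomes injectivity modulo [T]. Forward arcs exist at every time,
    subdivision points included, after translation into one period. *)
Lemma periodic_orbit_local (R : realType) (Fr Fl : R * R -> R * R) (O : set (R * R)) :
  periodic_orbit Fr Fl O ->
  exists (g : R -> R * R) (T : R),
  [/\ continuous g, 0 < T /\ (forall u, g (u + T) = g u),
      forall u v, g u = g v -> exists k : int, v = u + k%:~R * T,
      forall t, exists2 d, 0 < d &
        (Defs.right_arc Fr g t (t + d) \/ Defs.left_arc Fl g t (t + d)) &
      O = range g].
Proof.
move=> [g [T [m [tau [cg [T0 gT] inj [t0 tm arcs] OE]]]]].
exists g, T; split=> //.
  move=> u v E; have [k hk] := period_reduce u T0; have [j hj] := period_reduce v T0.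
  have := inj _ _ hk hj; rewrite !(period_int gT) => /(_ E) h.
  exists (k - j); rewrite intrB mulrBl addrA h; ring.
move=> t; have [k /andP[h1 h2]] := period_reduce t T0.
have [||i im /andP[i1 i2]] := @locate_arc _ tau m (t + k%:~R * T).
- by rewrite t0.
- by rewrite tm.
exists (tau i.+1 - (t + k%:~R * T)); first by rewrite subr_gt0.
have le : t + (tau i.+1 - (t + k%:~R * T)) + k%:~R * T <= tau i.+1.
  by rewrite le_eqVlt; apply/orP; left; apply/eqP; ring.
have [_ [a|a]] := arcs i im; [left|right].
  exact: (@arc_sub _ Fr g (fun z => 0 <= z.1) _ _ _ _ _ (period_int gT k) i1 le a).
exact: (@arc_sub _ Fl g (fun z => z.1 < 0) _ _ _ _ _ (period_int gT k) i1 le a).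
Qed.

Lemma continuous_bounded (R : realType) (f : R -> R) (a b : R) : a <= b ->
  continuous f -> exists2 C, 0 <= C & forall t, a <= t <= b -> `|f t| <= C.
Proof.
move=> ab cf; have cf' : {within `[a, b], continuous (fun t => `|f t|)}.
  by apply: continuous_subspaceT => x; apply: cvg_norm; exact: cf.
have [c _ Hc] := EVT_max ab cf'; by exists `|f c|.
Qed.

Lemma horner_lipschitz (R : realType) (p : {poly R}) (M : R) : 0 <= M ->
  exists2 K, 0 <= K & forall x y, `|x| <= M -> `|y| <= M ->
    `|p.[x] - p.[y]| <= K * `|x - y|.
Proof.
move=> M0; have MM : - M <= M by rewrite (@le_trans _ _ 0) ?oppr_le0.
have [K K0 HK] := continuous_bounded MM (@continuous_horner _ p^`()).
exists K => // x y xM yM.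
have hx : - M <= x <= M by rewrite -ler_norml.
have hy : - M <= y <= M by rewrite -ler_norml.
apply: (@mean_value_cc _ (fun t => p.[t]) (fun t => p^`().[t]) (- M) M) => // t ht.
by apply: der_eq (der_horner p (der_id t)) _; rewrite mulr1.
Qed.

Lemma fst_continuous (R : realType) (g : R -> R * R) : continuous g ->
  continuous (fun t => (g t).1).
Proof. by move=> cg x; apply: cvg_comp; [exact: cg|exact: cvg_fst]. Qed.

Lemma snd_continuous (R : realType) (g : R -> R * R) : continuous g ->
  continuous (fun t => (g t).2).
Proof. by move=> cg x; apply: cvg_comp; [exact: cg|exact: cvg_snd]. Qed.

(** In the frame turning with unit speed the field is radial: the transverse coordinate [al] solves
    a linear equation with zero initial value, so it vanishes, and then the radial coordinate [be]
    solves the same scalar equation as [u]. Two applications of [gronwall0], with no division by the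
    radius. *)
Lemma left_phase (R : realType) (f : {poly R}) (e s0 t0 t1 : R) (u : R -> R)
    (g : R -> R * R) :
  t0 <= t1 -> continuous g -> continuous u ->
  (forall t, t0 < t < t1 ->
    is_derive (s0 + (t - t0)) (1 : R) u (e * left_rate f (u (s0 + (t - t0))))) ->
  (forall t, t0 <= t < t1 -> exists2 d, 0 < d &
    solves_on (left_system f e) g t (t + d)) ->
  g t0 = (- (u s0 * sin s0), u s0 * cos s0) ->
  forall t, t0 <= t <= t1 -> let s := s0 + (t - t0) in
    g t = (- (u s * sin s), u s * cos s).
Proof.
move=> t01 cg cu du sol g0.
pose S t := s0 + (t - t0).
have dS t : is_derive t (1 : R) S 1.
  apply: der_eq (derD (der_cst s0 t) (derD (der_id t) (der_cst (- t0) t))) _.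
  by rewrite add0r addr0.
have cS : continuous S by move=> t; exact: der_continuous (dS t).
pose x t := (g t).1; pose y t := (g t).2.
have cx : continuous x := fst_continuous cg.
have cy : continuous y := snd_continuous cg.
pose N t := x t ^+ 2 + y t ^+ 2.
have cN : continuous N.
  by move=> t; apply: cvgD; apply: cvgM; [exact: cx|exact: cx|exact: cy|exact: cy].
have ccos : continuous (fun t => cos (S t)).
  by move=> t; apply: (@continuous_comp _ _ _ S cos); [exact: cS|exact: continuous_cos].
have csin : continuous (fun t => sin (S t)).
  by move=> t; apply: (@continuous_comp _ _ _ S sin); [exact: cS|exact: continuous_sin].
pose al t := x t * cos (S t) + y t * sin (S t).
pose be t := y t * cos (S t) - x t * sin (S t).
have cal : continuous al.
  by move=> t; apply: cvgD; apply: cvgM; [exact: cx|exact: ccos|exact: cy|exact: csin].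
have cbe : continuous be.
  by move=> t; apply: cvgB; apply: cvgM; [exact: cy|exact: ccos|exact: cx|exact: csin].
have Nab t : N t = al t ^+ 2 + be t ^+ 2.
  transitivity (N t * (cos (S t) ^+ 2 + sin (S t) ^+ 2)).
    by rewrite cos2Dsin2 mulr1.
  by rewrite /N /al /be; ring.
have St0 : S t0 = s0 by rewrite /S subrr addr0.
have al0 : al t0 = 0.
  by rewrite /al /x /y g0 St0 /=; ring.
have be0 : be t0 = u s0.
  rewrite /be /x /y g0 St0 /= (_ : _ - _ = u s0 * (cos s0 ^+ 2 + sin s0 ^+ 2)); last by ring.
  by rewrite cos2Dsin2 mulr1.
have dal t d s : solves_on (left_system f e) g t (t + d) -> t < s < t + d ->
    is_derive s (1 : R) al (e * f.[N s] * al s).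
  move=> h hs; have [d1 d2] := h s hs.
  apply: der_eq (derD (derM d1 (der_cos (dS s))) (derM d2 (der_sin (dS s)))) _.
  by rewrite /left_system /= -/(x s) -/(y s) -/(N s) /al; ring.
have dbe t d s : solves_on (left_system f e) g t (t + d) -> t < s < t + d ->
    is_derive s (1 : R) be (e * f.[N s] * be s).
  move=> h hs; have [d1 d2] := h s hs.
  apply: der_eq (derD (derM d2 (der_cos (dS s))) (derN (derM d1 (der_sin (dS s))))) _.
  by rewrite /left_system /= -/(x s) -/(y s) -/(N s) /be; ring.
have [C C0 HC] := continuous_bounded t01 (fun t => continuous_comp (cN t) (@continuous_horner _ f (N t))).
have alz : forall t, t0 <= t <= t1 -> al t = 0.
  apply: (@gronwall0 _ al t0 t1 (`|e| * C)) => // t ht.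
  have [d d0 hd] := sol t ht; exists d => // s hs st1.
  exists (e * f.[N s] * al s); first exact: dal hd hs.
  rewrite !normrM; apply: ler_wpM2r => //; apply: ler_wpM2l => //.
  apply: HC; case/andP: ht hs => h1 _ /andP[h2 _].
  by rewrite (ltW (le_lt_trans h1 h2)) ltW.
pose w t := u (S t).
have cw : continuous w.
  by move=> t; apply: (@continuous_comp _ _ _ S u); [exact: cS|exact: cu].
have [M1 M10 HM1] := continuous_bounded t01 cw.
have [M2 M20 HM2] := continuous_bounded t01 cbe.
have M0 : 0 <= M1 + M2 by exact: addr_ge0.
have [K K0 HK] := horner_lipschitz ('X * (f \Po 'X^2)) M0.
have LE v : left_rate f v = ('X * (f \Po 'X^2)).[v].
  by rewrite /left_rate hornerM hornerX horner_comp hornerXn.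
have bez : forall t, t0 <= t <= t1 -> be t - w t = 0.
  apply: (@gronwall0 _ (fun t => be t - w t) t0 t1 (`|e| * K)).
  - by move=> t; apply: cvgB; [exact: cbe|exact: cw].
  - by rewrite be0 /w St0 subrr.
  move=> t ht; have [d d0 hd] := sol t ht; exists d => // s hs st1.
  have hs' : t0 < s < t1.
    by rewrite st1 andbT; case/andP: ht hs => h1 _ /andP[h2 _]; exact: le_lt_trans h2.
  have hs2 : t0 <= s <= t1 by case/andP: hs' => /ltW -> /ltW ->.
  exists (e * (left_rate f (be s) - left_rate f (w s))).
    have dw : is_derive s (1 : R) w (e * left_rate f (w s) * 1).
      exact: (@der_comp _ u S s _ _ (du s hs') (dS s)).
    apply: der_eq (derD (dbe _ _ _ hd hs) (derN dw)) _.
    rewrite Nab alz// expr0n /= add0r /left_rate; ring.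
  rewrite normrM -mulrA; apply: ler_wpM2l => //.
  rewrite !LE; apply: HK.
    by apply: (le_trans (HM2 _ hs2)); rewrite lerDr.
  by apply: (le_trans (HM1 _ hs2)); rewrite lerDl.
move=> t ht /=; rewrite -/(S t) -/(w t).
have a0 := alz t ht; have /eqP := bez t ht; rewrite subr_eq0 => /eqP <-.
have E1 : x t = al t * cos (S t) - be t * sin (S t).
  transitivity (x t * (cos (S t) ^+ 2 + sin (S t) ^+ 2)); last by rewrite /al /be; ring.
  by rewrite cos2Dsin2 mulr1.
have E2 : y t = al t * sin (S t) + be t * cos (S t).
  transitivity (y t * (cos (S t) ^+ 2 + sin (S t) ^+ 2)); last by rewrite /al /be; ring.
  by rewrite cos2Dsin2 mulr1.
rewrite [LHS]surjective_pairing -/(x t) -/(y t) E1 E2 a0.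
by rewrite !mul0r !add0r.
Qed.

(* Unperturbed first integral: [x^2 + y^2] for [x <= 0] and
   [1 - (1 - x)^2 + y^2] for [0 <= x]. *)
Definition energy (R : realType) (z : R * R) : R :=
  z.2 ^+ 2 + z.1 + `|z.1| - z.1 * `|z.1|.

Definition rad (R : realType) (z : R * R) : R := Num.sqrt (energy z).

Lemma energy_right (R : realType) (z : R * R) : 0 <= z.1 ->
  energy z = 1 - (1 - z.1) ^+ 2 + z.2 ^+ 2.
Proof. by move=> x0; rewrite /energy ger0_norm//; ring. Qed.

Lemma energy_left (R : realType) (z : R * R) : z.1 <= 0 ->
  energy z = z.1 ^+ 2 + z.2 ^+ 2.
Proof. by move=> x0; rewrite /energy ler0_norm//; ring. Qed.

Lemma energy_continuous (R : realType) : continuous (@energy R).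
Proof.
move=> z; have c1 : {for z, continuous (fun t : R * R => t.1)} by exact: cvg_fst.
have c2 : {for z, continuous (fun t : R * R => t.2)} by exact: cvg_snd.
apply: cvgB; last by apply: cvgM; [exact: c1|apply: cvg_norm; exact: c1].
apply: cvgD; last by apply: cvg_norm; exact: c1.
by apply: cvgD; [apply: cvgM; exact: c2|exact: c1].
Qed.

Lemma rad_continuous (R : realType) : continuous (@rad R).
Proof.
by move=> z; apply: (@continuous_comp _ _ _ (@energy R) Num.sqrt);
  [exact: energy_continuous|exact: sqrt_continuous].
Qed.

Lemma right_pert_continuous (R : realType) (A B : {poly R}) : continuous (right_pert A B).
Proof.
move=> z; have c1 : {for z, continuous (fun t : R * R => t.1)} by exact: cvg_fst.
have c2 : {for z, continuous (fun t : R * R => t.2)} by exact: cvg_snd.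
have c3 : {for z, continuous (fun t : R * R => 1 - t.1)}.
  by apply: cvgB; [exact: cvg_cst|exact: c1].
apply: cvgD.
  apply: (@continuous_comp _ _ _ (fun t : R * R => t.2) (fun y => A.[y])); first exact: c2.
  exact: continuous_horner.
apply: cvgM; first exact: c3.
apply: (@continuous_comp _ _ _ (fun t : R * R => (1 - t.1) ^+ 2 - t.2 ^+ 2) (fun y => B.[y])).
  by apply: cvgB; apply: cvgM; [exact: c3|exact: c3|exact: c2|exact: c2].
exact: continuous_horner.
Qed.

Lemma right_coord (R : realType) (A B : {poly R}) (z : R * R) :
  0 <= z.1 < 1 -> 0 < rad z ->
  let s := z.2 / rad z in
  [/\ -1 <= s <= 1, sgm s * rad z = z.2, right_c s (rad z) = 1 - z.1 &
      right_psi A B s (rad z) = right_pert A B z].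
Proof.
move=> /andP[x0 x1] v0 s.
have E0 : 0 < energy z by rewrite -sqrtr_gt0.
have v2 : rad z ^+ 2 = energy z by rewrite sqr_sqrtr// ltW.
have sv : s * rad z = z.2 by rewrite /s divfK// gt_eqF.
have s1 : -1 <= s <= 1.
  rewrite -ler_norml -(ler_pM2r v0) mul1r -{1}(gtr0_norm v0) -normrM sv.
  rewrite -(ler_pXn2r (_ : 0 < 2)%N) ?nnegrE// ?(ltW v0)// real_normK ?num_real// v2 energy_right//.
  by nra.
have sE : sgm s = s by apply: clamp_id; case/andP: s1 => h1 h2; apply/andP; split; clear - h1 h2; lra.
have cE : right_c s (rad z) = 1 - z.1.
  have h : rad z ^+ 2 * (1 - s ^+ 2) = energy z - z.2 ^+ 2 by rewrite -v2 -sv; ring.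
  rewrite /right_c sE h energy_right//.
  have -> : 1 - (1 - (1 - z.1) ^+ 2 + z.2 ^+ 2 - z.2 ^+ 2) = (1 - z.1) ^+ 2 by ring.
  by rewrite sqrtr_sqr ger0_norm//; lra.
split=> //; first by rewrite sE.
rewrite /right_psi sE sv cE /right_pert v2 energy_right//.
by congr (_ + _ * B.[_]); ring.
Qed.

Lemma right_coord_inj (R : realType) (z w : R * R) :
  0 <= z.1 < 1 -> 0 <= w.1 < 1 -> 0 < rad z -> rad z = rad w ->
  z.2 / rad z = w.2 / rad w -> z = w.
Proof.
move=> hz hw z0 zw E; have w0 : 0 < rad w by rewrite -zw.
have [_ h1 h2 _] := right_coord 0 0 hz z0; have [_ k1 k2 _] := right_coord 0 0 hw w0.
move: h2 k2; rewrite E zw => -> /subrI e1.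
move: h1 k1; rewrite E zw => -> e2.
by rewrite [z]surjective_pairing [w]surjective_pairing e1 e2.
Qed.

(** The change of time along [g] is not inverted. The derivative of [v - V (S)] is [e * S'] times
    the difference of [right_rate] at [v] and at [V (S)], to which [gronwall0] applies. *)
Lemma right_phase (R : realType) (A B : {poly R}) (e r D L t0 t1 : R) (V : R -> R)
    (g : R -> R * R) :
  D < r -> t0 <= t1 -> continuous g -> continuous V ->
  (forall s : R, -2 < s < 2 -> is_derive s (1 : R) V (e * right_rate A B e s (V s))) ->
  (forall s, `|V s - r| < D) ->
  (forall s v, `|v - r| < D -> 0 < right_den A B e s v) ->
  (forall s v w, `|v - r| < D -> `|w - r| < D ->
    `|right_rate A B e s v - right_rate A B e s w| <= L * `|v - w|) ->
  (forall t, (g t).1 < 1 /\ `|rad (g t) - r| < D) ->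
  (forall t, t0 <= t < t1 -> exists2 d, 0 < d &
    Defs.right_arc (right_system A B e) g t (t + d)) ->
  V ((g t0).2 / rad (g t0)) = rad (g t0) ->
  forall t, t0 <= t <= t1 -> rad (g t) = V ((g t).2 / rad (g t)).
Proof.
move=> Dr t01 cg cV dV VD den lip gD sol start.
pose x t := (g t).1; pose y t := (g t).2; pose v t := rad (g t).
have cx : continuous x := fst_continuous cg.
have cy : continuous y := snd_continuous cg.
have cv : continuous v.
  by move=> t; apply: (@continuous_comp _ _ _ g (@rad R)); [exact: cg|exact: rad_continuous].
have v0 t : 0 < v t.
  by have [_ ] := gD t; rewrite ltr_distl => /andP[h1 h2]; rewrite /v; clear - h1 h2 Dr; lra.
pose S t := y t / v t.
have cS : continuous S.
  move=> t; apply: cvgM; first exact: cy.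
  by apply: cvgV; [rewrite gt_eqF|exact: cv].
pose P t := right_pert A B (g t).
have cP : continuous P.
  by move=> t; apply: (@continuous_comp _ _ _ g (right_pert A B)); [exact: cg|exact: right_pert_continuous].
(* The derivative of [S] along right arcs, as an expression continuous at all times; this gives the
   bound [C]. *)
pose S' t := (1 - x t) / v t ^+ 2 * (v t - e * (S t * P t)).
have cS' : continuous S'.
  move=> t; apply: cvgM.
    apply: cvgM; first by apply: cvgB; [exact: cvg_cst|exact: cx].
    by apply: cvgV; [rewrite expf_neq0// gt_eqF|apply: cvgM; exact: cv].
  apply: cvgB; first exact: cv.
  by apply: cvgM; [exact: cvg_cst|apply: cvgM; [exact: cS|exact: cP]].
have [C C0 HC] := continuous_bounded t01 cS'.
have main : forall t, t0 <= t <= t1 -> v t - V (S t) = 0.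
  apply: (@gronwall0 _ (fun t => v t - V (S t)) t0 t1 (`|e| * C * L)).
  - move=> t; apply: cvgB; first exact: cv.
    by apply: (@continuous_comp _ _ _ S V); [exact: cS|exact: cV].
  - by rewrite /S /v start subrr.
  move=> t ht; have [d d0 [hd hx]] := sol t ht; exists d => // s hs st1.
  have hs2 : t0 <= s <= t1.
    by rewrite (ltW st1) andbT; case/andP: ht hs => h1 _ /andP[h2 _]; exact: le_trans (ltW h2).
  have [d1 d2] := hd s hs.
  have xs : 0 <= x s < 1 by rewrite hx//; exact: (gD s).1.
  have [/andP[s1 s2] sE cE pE] := right_coord A B xs (v0 s).
  rewrite -/(S s) -/(v s) -/(P s) -/(x s) -/(y s) in s1 s2 sE cE pE.
  pose E t := 1 - (1 - x t) ^+ 2 + y t ^+ 2.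
  have Es : E s = v s ^+ 2.
    have h0 : 0 <= (g s).1 by case/andP: xs.
    rewrite sqr_sqrtr ?energy_right//.
    by rewrite -energy_right// -/(energy (g s)) ltW// -sqrtr_gt0; exact: v0.
  have E0 : 0 < E s by rewrite Es exprn_gt0.
  have dE : is_derive s (1 : R) E (2 * (1 - x s) * (e * P s)).
    apply: der_eq (derD (derD (der_cst 1 s) (derN (derX 2 (derD (der_cst 1 s) (derN d1)))))
      (derX 2 d2)) _.
    by rewrite /right_system /= -/(x s) -/(y s) -/(P s); ring.
  have dv : is_derive s (1 : R) v ((1 - x s) * (e * P s) / v s).
    apply: (@der_near _ (fun t => Num.sqrt (E t)) _ t (t + d)) => //.
      by move=> q hq; rewrite /v /rad energy_right// hx.
    apply: der_eq (der_sqrt E0 dE) _; rewrite Es sqrtr_sqr gtr0_norm//.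
    by field; rewrite gt_eqF.
  have dS : is_derive s (1 : R) S (S' s).
    apply: der_eq (derM d2 (derV (lt0r_neq0 (v0 s)) dv)) _.
    rewrite /right_system /= -/(x s) -/(y s) /S' /S.
    by field; rewrite gt_eqF.
  have hden : 0 < v s - e * (S s * P s).
    have := den (S s) (v s) (gD s).2; rewrite /right_den pE.
    by rewrite (_ : sgm (S s) = S s)//; apply: clamp_id; apply/andP; split; clear - s1 s2; lra.
  have rE : right_rate A B e (S s) (v s) * S' s = (1 - x s) * P s / v s.
    rewrite /right_rate /right_den pE (_ : sgm (S s) = S s); last first.
      by apply: clamp_id; apply/andP; split; clear - s1 s2; lra.
    by rewrite /S'; field; rewrite !gt_eqF.
  exists (e * S' s * (right_rate A B e (S s) (v s) - right_rate A B e (S s) (V (S s)))).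
    have hS : -2 < S s < 2 by apply/andP; split; clear - s1 s2; lra.
    apply: der_eq (derD dv (derN (@der_comp _ V S s _ _ (dV _ hS) dS))) _.
    have -> : (1 - x s) * (e * P s) / v s = e * (right_rate A B e (S s) (v s) * S' s).
      by rewrite rE; ring.
    by ring.
  rewrite [leLHS]normrM [X in X * _ <= _]normrM -[leLHS]mulrA -[leRHS]mulrA -[X in _ <= X]mulrA.
  apply: ler_wpM2l => //; apply: ler_pM => //; first exact: (HC _ hs2).
  by apply: lip; [exact: (gD s).2|exact: VD].
by move=> t /main /eqP; rewrite subr_eq0 => /eqP.
Qed.

(* [u a] is the radius along the left orbit of the perturbed system from [(0, a)],
   as a function of the polar angle counted from the positive [y]-axis, and [V b]
   is [rad] along the right orbit from [(0, -b)], as a function of [y / rad]. *)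
Definition half_maps (R : realType) (A B f : {poly R}) (e r D d : R)
    (u V : R -> R -> R) : Prop :=
  [/\ [/\ 0 < e, 0 < d, d <= D, D < r & r + D < 1],
      forall a, `|a - r| < d -> [/\ continuous (u a), u a 0 = a,
        forall s : R, -1 < s < pi + 1 ->
          is_derive s (1 : R) (u a) (e * left_rate f (u a s)) &
        forall s, `|u a s - r| < D],
      forall b, `|b - r| < d -> [/\ continuous (V b), V b (-1) = b,
        forall s : R, -2 < s < 2 ->
          is_derive s (1 : R) (V b) (e * right_rate A B e s (V b s)) &
        forall s, `|V b s - r| < D],
      (forall s v, `|v - r| < D -> 0 < right_den A B e s v) /\
      (exists L, forall s v w, `|v - r| < D -> `|w - r| < D ->
        `|right_rate A B e s v - right_rate A B e s w| <= L * `|v - w|) &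
      forall y, `|y - r| < d -> - y + e * right_pert A B (0, y) < 0].

(** The level sets of [rad] have a second branch beyond the saddle line [x = 1], excluded by the
    first condition. *)
Definition region (R : realType) (r d : R) : set (R * R) :=
  [set z | z.1 < 1 /\ `|rad z - r| < d].

(* The local consequences of [periodic_orbit]: the subdivision into arcs enters
   only through the existence of an arc after each time. *)
Definition traces (R : realType) (Fr Fl : R * R -> R * R) (P : set (R * R))
    (g : R -> R * R) (T : R) : Prop :=
  [/\ continuous g, 0 < T, forall u, g (u + T) = g u,
      forall t, exists2 d, 0 < d &
        (Defs.right_arc Fr g t (t + d) \/ Defs.left_arc Fl g t (t + d)) &
      forall t, P (g t)].

(** * Crossings of the vertical axis by an arbitrary periodic orbit *)

Lemma right_system_continuous (R : realType) (A B : {poly R}) (e : R) :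
  continuous (fun z => (right_system A B e z).1).
Proof.
move=> z; apply: cvgD; first by apply: cvgN; exact: cvg_snd.
by apply: cvgM; [exact: cvg_cst|exact: right_pert_continuous].
Qed.

Lemma left_system_continuous (R : realType) (f : {poly R}) (e : R) :
  continuous (fun z => (left_system f e z).1).
Proof.
move=> z; have c1 : {for z, continuous (fun t : R * R => t.1)} by exact: cvg_fst.
have c2 : {for z, continuous (fun t : R * R => t.2)} by exact: cvg_snd.
apply: cvgD; first by apply: cvgN; exact: c2.
apply: cvgM; first exact: cvg_cst.
apply: cvgM; first exact: c1.
apply: (@continuous_comp _ _ _ (fun t : R * R => t.1 ^+ 2 + t.2 ^+ 2) (fun y => f.[y])).
  by apply: cvgD; apply: cvgM; [exact: c1|exact: c1|exact: c2|exact: c2].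
exact: continuous_horner.
Qed.

(** A mean value argument; [k] is a sign, so both directions of crossing are covered. *)
Lemma drift (R : realType) (F : R * R -> R * R) (g : R -> R * R) (c d k : R) :
  continuous (fun z => (F z).1) -> continuous g -> 0 < d ->
  solves_on F g c (c + d) -> (g c).1 = 0 -> 0 < k * (F (g c)).1 ->
  exists2 h, 0 < h <= d & forall s, c < s < c + h -> 0 < k * (g s).1.
Proof.
move=> cF cg d0 sol gc kF.
have cf : continuous (fun s => k * (F (g s)).1).
  move=> s; apply: cvgM; first exact: cvg_cst.
  by apply: (@continuous_comp _ _ _ g (fun z => (F z).1)); [exact: cg|exact: cF].
have [h h0 H] := continuous_gt (cf c) kF.
exists (Num.min h d); first by rewrite lt_min h0 d0 ge_min lexx orbT.
move=> s /andP[cs]; rewrite -ltrBlDl lt_min => /andP[sh sd].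
have sub t : c < t < s -> c < t < c + d.
  by move=> /andP[-> /lt_trans ts] /=; apply: ts; rewrite -ltrBlDl.
have [|m [q [/andP[cm ms] dq E]]] := mean_value cs (fst_continuous cg).
  by move=> t /sub/sol[? _]; exists (F (g t)).1.
have [dm _] := sol m (sub m (introT andP (conj cm ms))).
move: E; rewrite gc subr0 (der_uniq dq dm) => ->; rewrite mulrA mulr_gt0 ?subr_gt0//.
apply: H; rewrite ger0_norm ?subr_ge0 ?(ltW cm)//.
by apply: lt_trans sh; rewrite ltrD2r.
Qed.

Lemma rad_axis (R : realType) (z : R * R) : z.1 = 0 -> rad z = `|z.2|.
Proof. by move=> x0; rewrite /rad energy_right x0// subr0 expr1n subrr add0r sqrtr_sqr. Qed.

Definition top (R : realType) (g : R -> R * R) (t y : R) := g t = (0, y) /\ 0 < y.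

Lemma top_near (R : realType) (A B f : {poly R}) (e r D d : R)
    (u V : R -> R -> R) (g : R -> R * R) (T : R) (t y : R) :
  half_maps A B f e r D d u V ->
  traces (right_system A B e) (left_system f e) (region r d) g T ->
  top g t y -> `|y - r| < d.
Proof.
move=> H G; have [[e0 d0 dD Dr D1] Hu HV [den [L lip]] Ht] := H.
have [cg T0 gT loc reg] := G; have cx := fst_continuous cg.
move=> [E y0]; have [_] := reg t.
have x0 : (g t).1 = 0 by rewrite E.
by rewrite rad_axis// E /= (gtr0_norm y0).
Qed.

Lemma axis_near (R : realType) (A B f : {poly R}) (e r D d : R)
    (u V : R -> R -> R) (g : R -> R * R) (T : R) (t : R) :
  half_maps A B f e r D d u V ->
  traces (right_system A B e) (left_system f e) (region r d) g T ->
  (g t).1 = 0 -> `| `|(g t).2| - r| < d.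
Proof. by move=> _ [_ _ _ _ reg] E; have [_] := reg t; rewrite rad_axis. Qed.

(** A right arc is impossible here: by the last condition in [half_maps] it would drift at once into
    the left half plane. *)
Lemma top_left (R : realType) (A B f : {poly R}) (e r D d : R)
    (u V : R -> R -> R) (g : R -> R * R) (T : R) (t y : R) :
  half_maps A B f e r D d u V ->
  traces (right_system A B e) (left_system f e) (region r d) g T ->
  top g t y ->
  exists2 h, 0 < h & Defs.left_arc (left_system f e) g t (t + h).
Proof.
move=> H G; have [[e0 d0 dD Dr D1] Hu HV [den [L lip]] Ht] := H.
have [cg T0 gT loc reg] := G; have cx := fst_continuous cg.
move=> ty; have [E y0] := ty.
have [h h0 [ra|la]] := loc t; last by exists h.
have := Ht y (top_near H G ty); rewrite -oppr_gt0 -mulN1r => K.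
have [||h' /andP[h'0 h'h] W] := @drift _ _ g t h (-1) (@right_system_continuous _ A B e) cg h0 ra.1.
- by rewrite E.
- by rewrite E.
have := W (t + h' / 2); have := ra.2 (t + h' / 2).
have i1 : t < t + h' / 2 < t + h by apply/andP; split; clear - h'0 h'h; lra.
have i2 : t < t + h' / 2 < t + h' by apply/andP; split; clear - h'0; lra.
by move=> /(_ i1) p1 /(_ i2) p2; exfalso; clear - p1 p2; lra.
Qed.

Lemma bottom_right (R : realType) (A B f : {poly R}) (e r D d : R)
    (u V : R -> R -> R) (g : R -> R * R) (T : R) (t : R) :
  half_maps A B f e r D d u V ->
  traces (right_system A B e) (left_system f e) (region r d) g T ->
  (g t).1 = 0 -> (g t).2 < 0 ->
  exists2 h, 0 < h & Defs.right_arc (right_system A B e) g t (t + h).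
Proof.
move=> H G; have [[e0 d0 dD Dr D1] Hu HV [den [L lip]] Ht] := H.
have [cg T0 gT loc reg] := G; have cx := fst_continuous cg.
move=> x0 y0; have [h h0 [ra|la]] := loc t; first by exists h.
have [||h' /andP[h'0 h'h] W] := @drift _ _ g t h 1 (@left_system_continuous _ f e) cg h0 la.1.
- exact: x0.
- by rewrite /left_system /= x0 mul0r mulr0 addr0 mul1r oppr_gt0.
have := W (t + h' / 2); have := la.2 (t + h' / 2).
have i1 : t < t + h' / 2 < t + h by apply/andP; split; clear - h'0 h'h; lra.
have i2 : t < t + h' / 2 < t + h' by apply/andP; split; clear - h'0; lra.
by move=> /(_ i1) p1 /(_ i2) p2; exfalso; clear - p1 p2; lra.
Qed.

(** The arc starting at [c] must be a left one, so [c] lies on the axis; [bottom_right] rules out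
    the lower half axis, and the annulus avoids the origin. *)
Lemma exit_top (R : realType) (A B f : {poly R}) (e r D d : R)
    (u V : R -> R -> R) (g : R -> R * R) (T : R) (c : R) :
  half_maps A B f e r D d u V ->
  traces (right_system A B e) (left_system f e) (region r d) g T ->
  0 <= (g c).1 ->
  (forall k, 0 < k -> exists2 s, c < s < c + k & (g s).1 < 0) ->
  top g c (g c).2.
Proof.
move=> H G; have [[e0 d0 dD Dr D1] Hu HV [den [L lip]] Ht] := H.
have [cg T0 gT loc reg] := G; have cx := fst_continuous cg.
move=> xc ex; have [h h0 [ra|la]] := loc c.
  have [s hs sx] := ex h h0; have := ra.2 s hs; by rewrite leNgt sx.
have x0 : (g c).1 = 0.
  apply/eqP; rewrite eq_le xc andbT leNgt; apply/negP => xp.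
  have [k k0 K] := continuous_gt (cx c) xp.
  have [s /andP[cs sk] sx] := ex k k0.
  have : 0 < (g s).1 by apply: K; rewrite ger0_norm ?subr_ge0 ?(ltW cs)// ltrBlDl.
  by rewrite ltNge ltW.
split; first by rewrite {1}[g c]surjective_pairing x0.
case: (ltgtP (g c).2 0) => // y0.
  have [h' h'0 ra] := bottom_right H G x0 y0.
  have [s hs sx] := ex h' h'0; have := ra.2 s hs; by rewrite leNgt sx.
have := axis_near H G x0; rewrite y0 normr0 sub0r normrN => h2.
have := ler_norm r; move: h2 dD Dr d0; clear; lra.
Qed.

Lemma period_beyond (R : realType) (T a b : R) : 0 < T ->
  exists k : int, b < a + k%:~R * T.
Proof.
move=> T0; exists (Posz (Num.truncn (`|b - a| / T)).+1).
have := truncnS_gt (`|b - a| / T); rewrite -(ltr_pM2r T0) divfK ?gt_eqF// => h.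
have := ler_norm (b - a); move: h.
rewrite -[_%:~R]/(_%:R : R); set w := _.+1%:R * T; clear; lra.
Qed.

(** One full turn of an arbitrary orbit in the annulus. The left half takes time exactly [pi]; the
    right half ends because periodicity brings the orbit back to the left. The absence of
    intermediate tops makes this the first return. *)
Lemma next_top (R : realType) (A B f : {poly R}) (e r D d : R)
    (u V : R -> R -> R) (g : R -> R * R) (T : R) (t y : R) :
  half_maps A B f e r D d u V ->
  traces (right_system A B e) (left_system f e) (region r d) g T ->
  top g t y -> exists t',
  [/\ t + pi <= t', top g t' (V (u y pi) 1), `|u y pi - r| < d,
     forall s, t < s < t' -> ~ ((g s).1 = 0 /\ 0 < (g s).2) &
     (forall s, t <= s <= t + pi ->
        g s = (- (u y (s - t) * sin (s - t)), u y (s - t) * cos (s - t))) /\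
     (forall s, t + pi <= s <= t' -> 0 <= (g s).1 /\
        rad (g s) = V (u y pi) ((g s).2 / rad (g s)))].
Proof.
move=> H G; have [[e0 d0 dD Dr D1] Hu HV [den [L lip]] Ht] := H.
have [cg T0 gT loc reg] := G; have cx := fst_continuous cg.
move=> ty; have [gt y0] := ty; have yd := top_near H G ty.
have [cu u0 du uD] := Hu _ yd.
have up s : 0 < u y s.
  by have := uD s; rewrite ltr_distl => /andP[h1 _]; move: h1 Dr; clear; lra.
have pi0 := pi_gt0 R.
have [h h0 la] := top_left H G ty.
(* A time already inside the first left arc and before [t + T], where the first coordinate is zero
   again; the first return [c] to the closed right half plane is sought between them. *)
pose q := t + Num.min h T / 2.
have m0 : 0 < Num.min h T by rewrite lt_min h0.
have mh : Num.min h T <= h by rewrite ge_min lexx.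
have mT : Num.min h T <= T by rewrite ge_min lexx orbT.
have tq : t < q by rewrite /q; move: m0; clear; lra.
have qh : q < t + h by rewrite /q; move: m0 mh; clear; lra.
have qT : q <= t + T by rewrite /q; move: m0 mT; clear; lra.
have xT : 0 <= (g (t + T)).1 by rewrite gT gt.
have [c [/andP[qc cT] xc xneg]] := first_ge0 qT cx xT.
have xneg' s : t < s < c -> (g s).1 < 0.
  move=> /andP[ts sc]; case: (leP q s) => [qs|sq]; first by apply: xneg; rewrite qs.
  by apply: la.2; rewrite ts (lt_trans sq qh).
have tc : t < c by exact: lt_le_trans qc.
have left_loc s : t <= s < c -> exists2 h, 0 < h & solves_on (left_system f e) g s (s + h).
  move=> /andP[ts sc]; have [k k0 [ra|la']] := loc s; last by exists k => //; exact: la'.1.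
  have mk : 0 < Num.min k (c - s) by rewrite lt_min k0 subr_gt0.
  have i1 : Num.min k (c - s) <= k by rewrite ge_min lexx.
  have i2 : Num.min k (c - s) <= c - s by rewrite ge_min lexx orbT.
  have := ra.2 (s + Num.min k (c - s) / 2); have := xneg' (s + Num.min k (c - s) / 2).
  move=> p1 p2; exfalso.
  have : (g (s + Num.min k (c - s) / 2)).1 < 0.
    by apply: p1; apply/andP; split; move: mk i2 ts; clear; lra.
  by rewrite ltNge p2//; apply/andP; split; move: mk i1; clear; lra.
(* The comparison with [u y] is available only while the orbit is on the left and the angle is at
   most [pi]. That [c = t + pi] is then read off from the sign of the sine. *)
pose t1 := Num.min c (t + pi).
have t1c : t1 <= c by rewrite /t1 ge_min lexx.
have t1p : t1 <= t + pi by rewrite /t1 ge_min lexx orbT.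
have tt1 : t <= t1 by rewrite /t1 le_min (ltW tc) lerDl ltW.
have LP := @left_phase _ f e 0 t t1 (u y) g tt1 cg cu.
have {}LP : forall s, t <= s <= t1 -> let w := 0 + (s - t) in
    g s = (- (u y w * sin w), u y w * cos w).
  apply: LP => [s /andP[ts st1]|s /andP[ts st1]|].
  - by rewrite add0r; apply: du; apply/andP; split; move: ts st1 t1p pi0; clear; lra.
  - by apply: left_loc; rewrite ts (lt_le_trans st1).
  - by rewrite gt u0 sin0 cos0 mulr0 mulr1 oppr0.
have {}LP s : t <= s <= t1 -> g s = (- (u y (s - t) * sin (s - t)), u y (s - t) * cos (s - t)).
  by move=> /LP /=; rewrite add0r.
have cpi : t + pi <= c.
  rewrite leNgt; apply/negP => cp.
  have t1E : t1 = c by rewrite /t1; apply/min_idPl/ltW.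
  have := LP c; rewrite t1E lexx (ltW tc) => /(_ isT) E.
  move: xc; rewrite E /= oppr_ge0 leNgt mulr_gt0// sin_gt0_pi//.
  by apply/andP; split; move: tc cp; clear; lra.
have t1E : t1 = t + pi by rewrite /t1; apply/min_idPr.
rewrite t1E in LP.
have tpi : t <= t + pi <= t + pi by rewrite lexx lerDl ltW.
have gb : g (t + pi) = (0, - u y pi).
  rewrite LP// (_ : t + pi - t = pi); last by ring.
  by rewrite sinpi cospi mulr0 oppr0 mulrN1.
have {}cpi : c = t + pi.
  apply/eqP; rewrite eq_le cpi andbT leNgt; apply/negP => pc.
  have := xneg' (t + pi); rewrite gb ltxx => /(_ _); rewrite pc ltrDl pi0 => /(_ isT).
  by [].
have bd : `|u y pi - r| < d.
  have x0 : (g (t + pi)).1 = 0 by rewrite gb.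
  by have := axis_near H G x0; rewrite gb /= normrN (gtr0_norm (up pi)).
have [cV V1 dV VD] := HV _ bd.
have [k k0 ra] : exists2 h, 0 < h & Defs.right_arc (right_system A B e) g (t + pi) (t + pi + h).
  by apply: (bottom_right H G); rewrite gb//= oppr_lt0.
(* A translate of [q] by a multiple of the period lies after [t + pi], and there the orbit is on the
   left; so it leaves the right half plane. *)
have [j hj] := period_beyond q (t + pi) T0.
have xq : (g (q + j%:~R * T)).1 < 0.
  by rewrite (period_int gT); apply: la.2; rewrite tq.
have [|c' [/andP[cc' _] xpos xex]] := exit_ge0 (ltW hj) cx _ xq; first by rewrite gb.
have tc' : top g c' (g c').2.
  apply: (exit_top H G); first by apply: xpos; rewrite cc' lexx.
  by move=> w w0; have [s [s1 _ s2]] := xex w w0; exists s.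
have right_loc s : t + pi <= s < c' -> exists2 h, 0 < h &
    Defs.right_arc (right_system A B e) g s (s + h).
  move=> /andP[ts sc]; have [w w0 [ra'|la']] := loc s; first by exists w.
  have mk : 0 < Num.min w (c' - s) by rewrite lt_min w0 subr_gt0.
  have i1 : Num.min w (c' - s) <= w by rewrite ge_min lexx.
  have i2 : Num.min w (c' - s) <= c' - s by rewrite ge_min lexx orbT.
  have p1 := la'.2 (s + Num.min w (c' - s) / 2); have p2 := xpos (s + Num.min w (c' - s) / 2).
  exfalso.
  have : (g (s + Num.min w (c' - s) / 2)).1 < 0.
    by apply: p1; apply/andP; split; move: mk i1; clear; lra.
  by rewrite ltNge p2//; apply/andP; split; move: mk i2 ts; clear; lra.
have RP : forall s, t + pi <= s <= c' -> rad (g s) = V (u y pi) ((g s).2 / rad (g s)).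
  apply: (@right_phase _ A B e r D L) => //.
  - by move=> s; have [h1 h2] := reg s; split=> //; exact: lt_le_trans dD.
  - have x0 : (g (t + pi)).1 = 0 by rewrite gb.
    by rewrite rad_axis// gb /= normrN (gtr0_norm (up pi)) mulNr divff ?gt_eqF// V1.
exists c'; split=> //.
- have [E yy] := tc'; have x0 : (g c').1 = 0 by rewrite E.
  have := RP c'; rewrite cc' lexx rad_axis// => /(_ isT).
  by rewrite gtr0_norm// divff ?gt_eqF// => <-.
(* On the left half the first coordinate is negative; on the right half a top would start a left
   arc, where only right arcs are possible. *)
- move=> s /andP[ts sc'] [xs ys].
  case: (ltP s (t + pi)) => [sp|sp].
    by have := xneg' s; rewrite cpi ts sp xs ltxx => /(_ isT).
  have ts' : top g s (g s).2 by split=> //; rewrite {1}[g s]surjective_pairing xs.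
  have [w w0 la'] := top_left H G ts'.
  have [|v v0 ra'] := right_loc s; first by rewrite sp.
  have mk : 0 < Num.min w v by rewrite lt_min w0.
  have i1 : Num.min w v <= w by rewrite ge_min lexx.
  have i2 : Num.min w v <= v by rewrite ge_min lexx orbT.
  have p1 := la'.2 (s + Num.min w v / 2); have p2 := ra'.2 (s + Num.min w v / 2).
  have : (g (s + Num.min w v / 2)).1 < 0.
    by apply: p1; apply/andP; split; move: mk i1; clear; lra.
  by rewrite ltNge p2//; apply/andP; split; move: mk i2; clear; lra.
- by split=> // s hs; split; [exact: xpos|exact: RP].
Qed.

(** No orbit in the annulus stays in one half plane. On the left its angle would grow from [s0] to
    [pi] and reach the axis. On the right the second coordinate would have a maximum over a period,
    although its derivative [1 - x] is positive. *)
Lemma exists_top (R : realType) (A B f : {poly R}) (e r D d : R)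
    (u V : R -> R -> R) (g : R -> R * R) (T : R) :
  half_maps A B f e r D d u V ->
  traces (right_system A B e) (left_system f e) (region r d) g T ->
  exists t y, top g t y.
Proof.
move=> H G; have [[e0 d0 dD Dr D1] Hu HV [den [L lip]] Ht] := H.
have [cg T0 gT loc reg] := G; have cx := fst_continuous cg.
have [t1 x1] : exists t, 0 <= (g t).1.
  apply: contrapT => nx; have {}nx t : (g t).1 < 0.
    by rewrite ltNge; apply/negP => h; apply: nx; exists t.
  have x0 := nx 0; pose v := rad (g 0).
  have vd : `|v - r| < d := (reg 0).2.
  have [cu u0 du uD] := Hu _ vd.
  have v0 : 0 < v by move: vd; rewrite ltr_norml => /andP[h _]; move: h dD Dr; clear; lra.
  have v2 : v ^+ 2 = (g 0).1 ^+ 2 + (g 0).2 ^+ 2.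
    rewrite -energy_left ?(ltW x0)// sqr_sqrtr// ltW// -sqrtr_gt0; exact: v0.
  pose q := (g 0).2 / v.
  have q2 : v ^+ 2 * (1 - q ^+ 2) = (g 0).1 ^+ 2.
    by rewrite mulrBr mulr1 /q expr_div_n mulrC divfK ?expf_neq0 ?gt_eqF// v2; ring.
  have q1 : q ^+ 2 < 1.
    rewrite -subr_gt0 -(pmulr_rgt0 _ (exprn_gt0 2 v0)) q2.
    by rewrite -sqrrN exprn_gt0// oppr_gt0.
  have qI : -1 < q < 1.
    by rewrite -ltr_norml -(ltr_pXn2r (_ : 0 < 2)%N)// ?nnegrE// real_normK ?num_real// expr1n.
  have qI' : -1 <= q <= 1 by case/andP: qI => /ltW -> /ltW ->.
  pose s0 := acos q.
  have cs : cos s0 = q by exact: acosK.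
  have sn : v * sin s0 = - (g 0).1.
    rewrite /s0 sin_acos// -{1}(gtr0_norm v0) -sqrtr_sqr -sqrtrM ?sqr_ge0//.
    by rewrite q2 sqrtr_sqr ltr0_norm.
  have s0p : 0 <= s0 <= pi by rewrite acos_ge0//= acos_lepi.
  case/andP: s0p => s00 s0pi.
  have t01 : 0 <= pi - s0 by rewrite subr_ge0.
  (* The rate does not depend on the angle, so the solution starting at angle [0] may be shifted to
     start at [s0]. *)
  pose w s := u v (s + - s0).
  have LP : forall t, 0 <= t <= pi - s0 -> let s := s0 + (t - 0) in
      g t = (- (w s * sin s), w s * cos s).
    apply: (@left_phase _ f e s0 0 (pi - s0) w g) => //.
    - move=> s; apply: (@continuous_comp _ _ _ (fun s => s + - s0) (u v)); last exact: cu.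
      by apply: cvgD; [exact: cvg_id|exact: cvg_cst].
    - move=> t /andP[h1 h2].
      apply: (@der_shift _ (u v)); apply: du.
      by apply/andP; split; move: h1 h2 s00; clear; lra.
    - move=> t _; have [h h0 [ra|la]] := loc t; last by exists h => //; exact: la.1.
      have := ra.2 (t + h / 2); rewrite leNgt nx => W; suff : false by [].
      by apply: W; apply/andP; split; move: h0; clear; lra.
    - by rewrite /w subrr u0 -/v sn opprK cs /q mulrC divfK ?gt_eqF// -surjective_pairing.
  have := LP (pi - s0); rewrite lexx t01 /= => /(_ isT).
  rewrite subr0 (_ : s0 + (pi - s0) = pi); last by ring.
  rewrite sinpi mulr0 oppr0 => E; have := nx (pi - s0).
  by rewrite E ltxx.
have [t2 x2] : exists t, (g t).1 < 0.
  apply: contrapT => nx; have {}nx t : 0 <= (g t).1.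
    by rewrite leNgt; apply/negP => h; apply: nx; exists t.
  have cy := snd_continuous cg.
  have [c _ Hc] := EVT_max (ltW T0) (continuous_subspaceT cy).
  have [h h0 [ra|la]] := loc c; last first.
    have := nx (c + h / 2); rewrite leNgt la.2//.
    by apply/andP; split; move: h0; clear; lra.
  have ch : c < c + h / 2 by move: h0; clear; lra.
  have sub s : c < s < c + h / 2 -> c < s < c + h.
    by move=> /andP[h1 h2]; apply/andP; split; move: h1 h2 h0; clear; lra.
  have [|m [q [mI dq E]]] := mean_value ch cy.
    by move=> s /sub/ra.1[_ ?]; exists (right_system A B e (g s)).2.
  have [_ dm] := ra.1 m (sub m mI).
  have [k /andP[k1 k2]] := period_reduce (c + h / 2) T0.
  have := Hc (c + h / 2 + k%:~R * T); rewrite in_itv /= k1 (ltW k2) => /(_ isT).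
  rewrite (period_int gT) leNgt -subr_gt0 E (der_uniq dq dm) mulr_gt0//=.
    by rewrite subr_gt0; exact: (reg m).1.
  by rewrite subr_gt0.
have [k hk] := period_beyond t2 t1 T0.
have x2' : (g (t2 + k%:~R * T)).1 < 0 by rewrite (period_int gT).
have [c [/andP[tc ct] xp xn]] := exit_ge0 (ltW hk) cx x1 x2'.
exists c, (g c).2; apply: (exit_top H G); first by apply: xp; rewrite tc lexx.
by move=> w w0; have [s [s1 _ s2]] := xn w w0; exists s.
Qed.

(** By hypothesis the return map preserves each side of [a] and moves points there in one fixed
    direction, so an orbit through [y0 != a] never comes back to [y0]. Its period contains only
    finitely many turns, since each lasts at least [pi], and this contradicts periodicity. Orbits
    winding several times are covered. *)
Lemma tops_eq (R : realType) (A B f : {poly R}) (e r D d : R)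
    (u V : R -> R -> R) (g : R -> R * R) (T a k : R) :
  half_maps A B f e r D d u V ->
  traces (right_system A B e) (left_system f e) (region r d) g T ->
  (forall y, `|y - r| < d -> `|u y pi - r| < d -> y != a ->
    0 < (V (u y pi) 1 - a) * (y - a) /\ 0 < k * ((V (u y pi) 1 - y) * (y - a))) ->
  forall t y, top g t y -> y = a.
Proof.
move=> H G Pi t0 y0 ty0; apply/eqP/negP => /negP ya.
have [cg T0 gT loc reg] := G.
have sq : 0 < (y0 - a) * (y0 - a) by rewrite -expr2 exprn_even_gt0//= subr_eq0.
(* After [n] turns the orbit is still within one period, because time [t0 + T] is itself a top and
   [next_top] cannot jump over it; after at least one turn the value has moved strictly away from
   [y0] in the direction given by [k]. *)
have K (n : nat) : exists t y, [/\ top g t y, t0 + n%:R * pi <= t <= t0 + T,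
    0 < (y - a) * (y0 - a) &
    (t = t0 /\ y = y0) \/ 0 < k * ((y - y0) * (y0 - a))].
  elim: n => [|n [t [y [ty /andP[t1 t2] yy dis]]]].
    exists t0, y0; split=> //; last by left.
    by rewrite mul0r addr0 lexx lerDl ltW.
  have ya' : y != a by apply/eqP => E; move: yy; rewrite E subrr mul0r ltxx.
  have [t' [tt' ty' ud no _]] := next_top H G ty.
  have [p1 p2] := Pi y (top_near H G ty) ud ya'.
  have yeq : g t = g (t0 + T) -> y = y0.
    by rewrite gT; case: ty ty0 => -> _ [-> _] [].
  have tT : t < t0 + T.
    rewrite lt_neqAle t2 andbT; apply/eqP => E; have := yeq (congr1 g E) => yE.
    case: dis => [[E' _]|]; last by rewrite yE subrr mul0r mulr0 ltxx.
    by move: T0; rewrite E' in E; move: E; clear; lra.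
  have t'T : t' <= t0 + T.
    rewrite leNgt; apply/negP => h; apply: (no (t0 + T)); first by rewrite tT.
    by rewrite gT; case: ty0 => -> ?.
  exists t', (V (u y pi) 1); split=> //.
  - by rewrite t'T andbT -natr1 mulrDl mul1r addrA; apply: le_trans tt'; rewrite lerD2r.
  - have : 0 < ((V (u y pi) 1 - a) * (y - a)) * ((y - a) * (y0 - a)) by exact: mulr_gt0.
    rewrite (_ : _ * _ = ((V (u y pi) 1 - a) * (y0 - a)) * (y - a) ^+ 2); last by ring.
    by rewrite pmulr_lgt0// exprn_even_gt0//= subr_eq0.
  right.
  have q1 : 0 < k * ((V (u y pi) 1 - y) * (y0 - a)).
    have : 0 < k * ((V (u y pi) 1 - y) * (y - a)) * ((y - a) * (y0 - a)) by exact: mulr_gt0.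
    rewrite (_ : _ * _ = k * ((V (u y pi) 1 - y) * (y0 - a)) * (y - a) ^+ 2); last by ring.
    by rewrite pmulr_lgt0// exprn_even_gt0//= subr_eq0.
  case: dis => [[_ <-]//|q2].
  have := addr_gt0 q1 q2; rewrite (_ : _ + _ = k * ((V (u y pi) 1 - y0) * (y0 - a)))//; ring.
have [n hn] : exists n : nat, T < n%:R * pi.
  exists (Num.truncn (T / pi)).+1.
  have := truncnS_gt (T / pi); rewrite -(ltr_pM2r (pi_gt0 R)) divfK// gt_eqF//; exact: pi_gt0.
have [t [y [_ /andP[h1 h2] _ _]]] := K n.
by move: (le_trans h1 h2); rewrite lerD2l leNgt hn.
Qed.

(** * Cycles from fixed points of the return map *)

Definition left_point (R : realType) (u : R -> R) (s : R) : R * R :=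
  (- (u s * sin s), u s * cos s).

Definition right_point (R : realType) (V : R -> R) (s : R) : R * R :=
  (1 - right_c s (V s), s * V s).

Definition cycle (R : realType) (u V : R -> R) : set (R * R) :=
  left_point u @` [set s | 0 <= s <= pi] `|` right_point V @` [set s | -1 <= s <= 1].

Lemma left_point_rad (R : realType) (u : R -> R) (s : R) :
  0 <= s <= pi -> 0 < u s -> (left_point u s).1 <= 0 /\ rad (left_point u s) = u s.
Proof.
move=> hs us; have x0 : (left_point u s).1 <= 0.
  by rewrite /= oppr_le0 mulr_ge0 ?(ltW us)// sin_ge0_pi.
split=> //; rewrite /rad energy_left//= sqrrN !exprMn addrC -mulrDr cos2Dsin2 mulr1.
by rewrite sqrtr_sqr gtr0_norm.
Qed.

Lemma sgm_id (R : realType) (s : R) : -1 <= s <= 1 -> sgm s = s.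
Proof.
by move=> /andP[h1 h2]; apply: clamp_id; apply/andP; split; move: h1 h2; clear; lra.
Qed.

Lemma right_c_gt0 (R : realType) (s v : R) : 0 < v < 1 ->
  0 < right_c s v /\ right_c s v ^+ 2 = 1 - v ^+ 2 * (1 - sgm s ^+ 2).
Proof.
move=> /andP[v0 v1]; have h : 0 < 1 - v ^+ 2 * (1 - sgm s ^+ 2).
  have h1 := mulr_ge0 (sqr_ge0 v) (sqr_ge0 (sgm s)).
  have h2 : v ^+ 2 < 1 by rewrite expr_lt1// ltW.
  lra.
by rewrite /right_c sqrtr_gt0 h sqr_sqrtr// ltW.
Qed.

Lemma right_point_rad (R : realType) (V : R -> R) (s : R) :
  -1 <= s <= 1 -> 0 < V s < 1 ->
  [/\ 0 <= (right_point V s).1 < 1, rad (right_point V s) = V s &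
      (right_point V s).2 / rad (right_point V s) = s].
Proof.
move=> hs hV; have [c0 c2] := right_c_gt0 s hV; case/andP: (hV) => V0 V1.
rewrite (sgm_id hs) in c2.
have s2 : s ^+ 2 <= 1 by rewrite -real_normK ?num_real// expr_le1// ler_norml.
have c1 : right_c s (V s) <= 1.
  rewrite -(@expr_le1 _ 2) ?(ltW c0)// c2.
  have s2' : 0 <= 1 - s ^+ 2 by rewrite subr_ge0.
  by have := mulr_ge0 (sqr_ge0 (V s)) s2'; lra.
have x01 : 0 <= (right_point V s).1 < 1.
  by rewrite /= subr_ge0 c1 /=; move: c0; clear; lra.
have rE : rad (right_point V s) = V s.
  rewrite /rad energy_right; last by case/andP: x01.
  rewrite /= (_ : 1 - (1 - right_c s (V s)) = right_c s (V s)); last by ring.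
  rewrite c2 (_ : _ + _ = V s ^+ 2); last by ring.
  by rewrite sqrtr_sqr gtr0_norm.
by split=> //; rewrite rE /= mulfK// gt_eqF.
Qed.

Lemma right_point_end (R : realType) (V : R -> R) :
  right_point V (-1) = (0, - V (-1)) /\ right_point V 1 = (0, V 1).
Proof.
have h : -1 <= 1 :> R by lra.
rewrite /right_point /right_c !sgm_id ?lexx ?h// sqrrN expr1n !subrr !mulr0 subr0 sqrtr1 subrr.
by rewrite mulN1r mul1r.
Qed.

Lemma right_c_continuous (R : realType) (V : R -> R) : continuous V ->
  continuous (fun s => right_c s (V s)).
Proof.
move=> cV s; have cs : continuous (@sgm R) by exact: clamp_continuous.
apply: (@continuous_comp _ _ _ (fun s => 1 - V s ^+ 2 * (1 - sgm s ^+ 2)) Num.sqrt);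
  last exact: sqrt_continuous.
apply: cvgB; first exact: cvg_cst.
apply: cvgM; first by apply: cvgM; exact: cV.
by apply: cvgB; [exact: cvg_cst|apply: cvgM; exact: cs].
Qed.

Lemma right_den_continuous (R : realType) (A B : {poly R}) (e : R) (V : R -> R) :
  continuous V -> continuous (fun s => right_den A B e s (V s)).
Proof.
move=> cV s; have cs : continuous (@sgm R) by exact: clamp_continuous.
apply: cvgB; first exact: cV.
apply: cvgM; first exact: cvg_cst.
apply: cvgM; first exact: cs.
apply: cvgD.
  apply: (@continuous_comp _ _ _ (fun s => sgm s * V s) (fun y => A.[y])).
    by apply: cvgM; [exact: cs|exact: cV].
  exact: continuous_horner.
apply: cvgM; first exact: right_c_continuous.
apply: (@continuous_comp _ _ _ (fun s => 1 - V s ^+ 2) (fun y => B.[y])).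
  by apply: cvgB; [exact: cvg_cst|apply: cvgM; exact: cV].
exact: continuous_horner.
Qed.

(** Converse of [right_phase]: a solution in the clock [s] is turned into a solution in time. *)
Lemma right_arc_flow (R : realType) (A B : {poly R}) (e : R) (V : R -> R) :
  continuous V -> (forall s, 0 < V s < 1) ->
  (forall s, 0 < right_den A B e s (V s)) ->
  (forall s : R, -2 < s < 2 -> is_derive s (1 : R) V (e * right_rate A B e s (V s))) ->
  exists (sg : R -> R) (T : R),
  [/\ 0 < T, sg 0 = -1 /\ sg T = 1,
      continuous sg /\ (forall s t, s < t -> sg s < sg t),
      (forall s, -1 <= s <= 1 -> exists2 t, 0 <= t <= T & sg t = s) &
      solves_on (right_system A B e) (fun t => right_point V (sg t)) 0 T].
Proof.
move=> cV V01 den dV.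
have N11 : -1 <= 1 :> R by lra.
(* This is [dt/ds]. Clamping [s] below gives it a positive minimum on the whole line. *)
pose W0 s := V s ^+ 2 / (right_c s (V s) * right_den A B e s (V s)).
have cp s : 0 < right_c s (V s) * right_den A B e s (V s).
  by rewrite mulr_gt0//; have [] := right_c_gt0 s (V01 s).
have W0p s : 0 < W0 s.
  by rewrite divr_gt0// exprn_gt0//; case/andP: (V01 s).
have cW0 : continuous W0.
  move=> s; apply: cvgM; first by apply: cvgM; exact: cV.
  apply: cvgV; first by rewrite gt_eqF.
  by apply: cvgM; [exact: right_c_continuous|exact: right_den_continuous].
have [m _ Hm] := EVT_min N11 (continuous_subspaceT cW0).
pose W s := W0 (clamp (-1) 1 s).
have cW : continuous W.
  by move=> s; apply: (@continuous_comp _ _ _ (clamp (-1) 1) W0); [exact: clamp_continuous|exact: cW0].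
have WE s : -1 <= s <= 1 -> W s = W0 s by move=> hs; rewrite /W clamp_id.
have [sg [sg0 dsg sgi sgs]] := @reparametrize _ W (-1) (W0 m) cW (W0p m)
  (fun s => Hm _ (clamp_itv s N11)).
have [T T1] := sgs 1.
have mono s t : (sg s < sg t) = (s < t).
  apply/idP/idP; last exact: sgi.
  by apply: contraTT; rewrite -!leNgt le_eqVlt => /predU1P[->//|/sgi/ltW].
have T0 : 0 < T by rewrite -mono sg0 T1; lra.
have csg : continuous sg by move=> t; exact: der_continuous (dsg t).
exists sg, T; split=> //.
  move=> s /andP[h1 h2]; have [t E] := sgs s; exists t => //.
  by rewrite !leNgt -(mono t 0) -(mono T t) E sg0 T1 -!leNgt h1.
move=> t /andP[t0 tT]; pose s := sg t.
have sI v : 0 < v < T -> -1 < sg v < 1 by rewrite -(mono 0) -(mono v T) sg0 T1.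
have sI' v : 0 < v < T -> -1 <= sg v <= 1 by move=> /sI/andP[/ltW -> /ltW ->].
have hs : -1 <= s <= 1 by apply: sI'; rewrite t0.
have sE : sgm s = s by exact: sgm_id.
have hs2 : -2 < s < 2 by case/andP: hs => h1 h2; apply/andP; split; move: h1 h2; clear; lra.
pose v := V s; pose c := right_c s v; pose P := right_psi A B s v.
pose q := v - e * (s * P).
have qE : right_den A B e s v = q by rewrite /right_den sE.
have q0 : 0 < q by rewrite -qE; exact: den.
have [c0 c2] := right_c_gt0 s (V01 s).
rewrite -/v -/c sE in c0 c2.
have v0 : 0 < v by case/andP: (V01 s).
have ds : is_derive t (1 : R) sg (c * q / v ^+ 2).
  by apply: der_eq (dsg t) _; rewrite -/s WE// /W0 -/v -/c qE invf_div.
have dv : is_derive t (1 : R) (fun t => V (sg t)) (e * P * c / v).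
  apply: der_eq (@der_comp _ V sg t _ _ (dV s hs2) ds) _.
  by rewrite /right_rate -/v -/P qE; field; rewrite !gt_eqF.
have dy : is_derive t (1 : R) (fun t => sg t * V (sg t)) c.
  apply: der_eq (derM ds dv) _; rewrite -/s -/v /q.
  by field; rewrite gt_eqF.
pose Q t := 1 - V (sg t) ^+ 2 * (1 - sg t ^+ 2).
have Qt : Q t = c ^+ 2 by rewrite c2.
have dQ : is_derive t (1 : R) Q (2 * c * (s * v - e * P)).
  apply: der_eq (derD (der_cst 1 t) (derN (derM (derX 2 dv) (derD (der_cst 1 t) (derN (derX 2 ds)))))) _.
  by rewrite -/s -/v /q /= !expr1; field; rewrite gt_eqF.
have dx : is_derive t (1 : R) (fun t => 1 - right_c (sg t) (V (sg t))) (- (s * v) + e * P).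
  apply: (@der_near _ (fun t => 1 - Num.sqrt (Q t)) _ 0 T); first by rewrite t0.
    by move=> w hw; rewrite /right_c sgm_id ?sI'.
  have Q0 : 0 < Q t by rewrite Qt exprn_gt0.
  apply: der_eq (derD (der_cst 1 t) (derN (der_sqrt Q0 dQ))) _.
  by rewrite Qt sqrtr_sqr gtr0_norm//; field; rewrite gt_eqF.
have pE : right_pert A B (right_point V s) = P.
  rewrite /right_pert /= -/v -/c /P /right_psi sE -/c.
  rewrite (_ : 1 - (1 - c) = c); last by ring.
  by rewrite c2; congr (_ + _ * B.[_]); ring.
split.
  by apply: der_eq dx _; rewrite /right_system -/s pE.
by apply: der_eq dy _; rewrite /right_system -/s /= -/v -/c; ring.
Qed.

Lemma cycle_periodic (R : realType) (A B f : {poly R}) (e : R) (u V : R -> R) :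
  continuous u -> continuous V -> (forall s, 0 < u s) -> (forall s, 0 < V s < 1) ->
  (forall s : R, -1 < s < pi + 1 -> is_derive s (1 : R) u (e * left_rate f (u s))) ->
  (forall s, 0 < right_den A B e s (V s)) ->
  (forall s : R, -2 < s < 2 -> is_derive s (1 : R) V (e * right_rate A B e s (V s))) ->
  V (-1) = u pi -> V 1 = u 0 ->
  periodic_orbit (right_system A B e) (left_system f e) (cycle u V).
Proof.
move=> cu cV u0 V0 du den dV E1 E2.
have [sg [T [T0 [sg0 sgT] [csg sgi] sgs sol]]] := right_arc_flow cV V0 den dV.
have mono s t : (sg s < sg t) = (s < t).
  apply/idP/idP; last exact: sgi.
  by apply: contraTT; rewrite -!leNgt le_eqVlt => /predU1P[->//|/sgi/ltW].
have sI t : 0 <= t <= T -> -1 <= sg t <= 1.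
  by rewrite -sg0 -sgT !leNgt !mono -!leNgt.
have pi0 := pi_gt0 R.
have [e1 e2] := right_point_end V.
pose gr t := right_point V (sg t).
have grE : gr @` [set t | 0 <= t <= T] = right_point V @` [set s | -1 <= s <= 1].
  apply/seteqP; split=> [_ [t /= ht <-]|_ [s /= hs <-]].
    by exists (sg t) => //; exact: sI.
  by have [t ht <-] := sgs s hs; exists t.
rewrite /cycle -grE; apply: glue_arcs => //.
- apply: continuous_pair => s; last by apply: cvgM; [exact: cu|exact: continuous_cos].
  by apply: cvgN; apply: cvgM; [exact: cu|exact: continuous_sin].
- have cp : continuous (right_point V).
    apply: continuous_pair => s; last by apply: cvgM; [exact: cvg_id|exact: cV].
    by apply: cvgB; [exact: cvg_cst|exact: right_c_continuous].
  by move=> t; apply: (@continuous_comp _ _ _ sg (right_point V)); [exact: csg|exact: cp].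
- by rewrite /gr sg0 e1 E1 /left_point sinpi cospi mulr0 oppr0 mulrN1.
- by rewrite /gr sgT e2 E2 /left_point sin0 cos0 mulr0 oppr0 mulr1.
- split.
    move=> s /andP[s0 s1]; have hs : -1 < s < pi + 1.
      by apply/andP; split; move: s0 s1; clear; lra.
    have hs' : 0 <= s <= pi by rewrite (ltW s0) ltW.
    have N : (left_point u s).1 ^+ 2 + (left_point u s).2 ^+ 2 = u s ^+ 2.
      by rewrite /= sqrrN !exprMn addrC -mulrDr cos2Dsin2 mulr1.
    have d := du s hs; rewrite /left_system N /=; split.
      apply: der_eq (derN (derM d (der_sin (der_id s)))) _.
      by rewrite /left_rate; ring.
    apply: der_eq (derM d (der_cos (der_id s))) _.
    by rewrite /left_rate; ring.
  by move=> s hs; rewrite /= oppr_lt0 mulr_gt0// sin_gt0_pi.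
- split=> // t /andP[t0 t1]; have ht : 0 <= t <= T by rewrite (ltW t0) ltW.
  by have [/andP[]] := right_point_rad (sI t ht) (V0 _).
- move=> s t hs ht E.
  have hs' : 0 <= s <= pi by case/andP: hs => /ltW -> /ltW ->.
  have ht' : 0 <= t <= pi by case/andP: ht => /ltW -> /ltW ->.
  have us : u s = u t.
    have [_ <-] := left_point_rad hs' (u0 s); have [_ <-] := left_point_rad ht' (u0 t).
    by rewrite E.
  have := congr1 snd E; rewrite /= us => /(mulfI (lt0r_neq0 (u0 t))).
  by move=> ce; apply: cos_inj ce; rewrite in_itv.
- move=> s t /sI hs /sI ht E.
  have [_ _ h1] := right_point_rad hs (V0 _); have [_ _ h2] := right_point_rad ht (V0 _).
  have : sg s = sg t by rewrite -h1 -h2 -[right_point V (sg s)]/(gr s) E.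
  by case: (ltgtP s t) => // /sgi + E'; rewrite E' ltxx.
- by move=> t ht; have [/andP[]] := right_point_rad (sI t ht) (V0 _).
Qed.

Lemma cycle_unique (R : realType) (A B f : {poly R}) (e r D d a : R)
    (u V : R -> R -> R) (g : R -> R * R) (T : R) :
  half_maps A B f e r D d u V ->
  traces (right_system A B e) (left_system f e) (region r d) g T ->
  (forall s t, g s = g t -> exists k : int, t = s + k%:~R * T) ->
  (forall t y, top g t y -> y = a) ->
  range g = cycle (u a) (V (u a pi)).
Proof.
move=> H G inj tops; have [[e0 d0 dD Dr D1] Hu HV [den [L lip]] Ht] := H.
have [cg T0 gT loc reg] := G.
have [t [y ty]] := exists_top H G.
have ya := tops _ _ ty; subst y.
have [t' [tt' ty' ud _ [LP RP]]] := next_top H G ty.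
have Va := tops _ _ ty'; rewrite Va in ty'.
set b := u a pi in ud Va RP *.
have pi0 := pi_gt0 R.
have tlt : t < t' by apply: lt_le_trans tt'; rewrite ltrDl.
(* Both tops are the point [(0, a)], so [t' - t] is a positive multiple of [T]: one turn covers a
   full period. *)
have tT : t + T <= t'.
  have [k E] : exists k : int, t' = t + k%:~R * T by apply: inj; rewrite ty.1 ty'.1.
  have k0 : (0 < k)%R by rewrite -(ltr_int R) -(ltr_pM2r T0) mul0r; move: tlt; rewrite E ltrDl.
  by rewrite E lerD2l -{1}[T]mul1r ler_pM2r// ler1z.
have [cV V1 dV VD] := HV _ ud.
have V01 s : 0 < V b s < 1.
  by have := VD s; rewrite ltr_distl => /andP[h1 h2]; apply/andP; split; move: h1 h2 Dr D1; clear; lra.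
have rp s : 0 < rad (g s).
  by have [_] := reg s; rewrite ltr_distl => /andP[h1 _]; move: h1 dD Dr; clear; lra.
have onR s : t + pi <= s <= t' ->
    -1 <= (g s).2 / rad (g s) <= 1 /\ g s = right_point (V b) ((g s).2 / rad (g s)).
  move=> hs; have [x0 E] := RP s hs; have x1 := (reg s).1.
  have xI : 0 <= (g s).1 < 1 by rewrite x0.
  have [sI _ _ _] := right_coord 0 0 xI (rp s).
  split=> //; have [w1 w2 w3] := right_point_rad sI (V01 _).
  by apply: right_coord_inj => //; rewrite ?w2 -?E// w3 E.
apply/seteqP; split=> [_ [s _ <-]|_ [[s /= hs <-]|[s /= hs <-]]].
- have [k /andP[h1 h2]] := period_reduce (s - t) T0.
  pose w := s + k%:~R * T.
  have -> : g s = g w by rewrite (period_int gT).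
  have w1 : t <= w by move: h1; rewrite /w; clear; lra.
  have w2 : w <= t' by move: h2 tT; rewrite /w; clear; lra.
  case: (leP w (t + pi)) => h.
    left; exists (w - t); last by rewrite LP// w1.
    by apply/andP; split; move: w1 h; clear; lra.
  right; have [sI E] := onR w (introT andP (conj (ltW h) w2)).
  by exists ((g w).2 / rad (g w)).
- exists (s + t) => //; rewrite LP ?addrK//.
  by rewrite lerDr addrC lerD2l.
(* For the reverse inclusion, [S] runs continuously from [-1] to [1] during the right half and so
   takes every value [s]. *)
- pose S w := (g w).2 / rad (g w).
  have cS : continuous S.
    move=> w; apply: cvgM; first exact: snd_continuous.
    apply: cvgV; first by rewrite gt_eqF.
    by apply: (@continuous_comp _ _ _ g (@rad R)); [exact: cg|exact: rad_continuous].
  have St' : S t' = 1.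
    rewrite /S; have x0 : (g t').1 = 0 by rewrite ty'.1.
    rewrite rad_axis// ty'.1 /= (gtr0_norm ty'.2) divff// gt_eqF//; exact: ty'.2.
  have b0 : 0 < b by move: ud; rewrite ltr_distl => /andP[h1 _]; move: h1 dD Dr; clear; lra.
  have Stp : S (t + pi) = -1.
    have gb : g (t + pi) = (0, - b).
      rewrite addrC LP ?addrK; last by rewrite lerDr ltW//= addrC.
      by rewrite sinpi cospi mulr0 oppr0 mulrN1.
    have x0 : (g (t + pi)).1 = 0 by rewrite gb.
    by rewrite /S rad_axis// gb /= normrN (gtr0_norm b0) mulNr divff// gt_eqF.
  have [|w wI Sw] := @IVT R S (t + pi) t' s tt' (continuous_subspaceT cS).
    by rewrite Stp St'; case/andP: hs => h1 h2; rewrite ge_min h1 le_max h2 orbT.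
  exists w => //; rewrite in_itv in wI; have [_ E] := onR w wI.
  by rewrite E -/(S w) Sw.
Qed.

Lemma region_open (R : realType) (r d : R) : open (region r d).
Proof.
apply: openI.
  apply: (@open_comp _ _ (fun z : R * R => z.1) [set x | x < 1]); last exact: open_lt.
  by move=> z _; exact: cvg_fst.
apply: (@open_comp _ _ (fun z : R * R => `|rad z - r|) [set x | x < d]); last exact: open_lt.
move=> z _; apply: cvg_norm; apply: cvgB; [exact: rad_continuous|exact: cvg_cst].
Qed.

Lemma cycle_region (R : realType) (u V : R -> R) (r d : R) :
  (forall s, `|u s - r| < d) -> (forall s, `|V s - r| < d) -> d < r -> r + d < 1 ->
  cycle u V `<=` region r d.
Proof.
move=> hu hV dr rd.
have u0 s : 0 < u s.
  by have := hu s; rewrite ltr_distl => /andP[h1 _]; move: h1 dr; clear; lra.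
have V0 s : 0 < V s < 1.
  by have := hV s; rewrite ltr_distl => /andP[h1 h2]; apply/andP; split; move: h1 h2 dr rd; clear; lra.
move=> _ [[s /= hs <-]|[s /= hs <-]]; split=> /=.
- by have [h _] := left_point_rad hs (u0 s); exact: le_lt_trans h ltr01.
- by have [_ ->] := left_point_rad hs (u0 s).
- by have [/andP[]] := right_point_rad hs (V0 s).
- by have [_ ->] := right_point_rad hs (V0 s).
Qed.

Lemma limit_cycle_of_fixpoint (R : realType) (A B f : {poly R}) (e r D d a k : R)
    (u V : R -> R -> R) :
  half_maps A B f e r D d u V ->
  (forall y, `|y - r| < d -> `|u y pi - r| < d -> y != a ->
    0 < (V (u y pi) 1 - a) * (y - a) /\ 0 < k * ((V (u y pi) 1 - y) * (y - a))) ->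
  (forall s, `|u a s - r| < d) -> (forall s, `|V (u a pi) s - r| < d) ->
  `|a - r| < d -> V (u a pi) 1 = a ->
  limit_cycle (right_system A B e) (left_system f e) (cycle (u a) (V (u a pi))).
Proof.
move=> H Pi ud Vd ad Va; have [[e0 d0 dD Dr D1] Hu HV [den _] Ht] := H.
have dr : d < r by exact: le_lt_trans Dr.
have rd : r + d < 1 by apply: le_lt_trans D1; rewrite lerD2l.
have u0 s : 0 < u a s.
  by have := ud s; rewrite ltr_distl => /andP[h1 _]; move: h1 dr; clear; lra.
have V0 s : 0 < V (u a pi) s < 1.
  by have := Vd s; rewrite ltr_distl => /andP[h1 h2]; apply/andP; split; move: h1 h2 dr rd; clear; lra.
have [cu uE du _] := Hu _ ad; have [cV VE dV _] := HV _ (ud pi).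
have sub := cycle_region ud Vd dr rd.
have pi0 := pi_gt0 R.
split.
- apply: cycle_periodic => //; last by rewrite Va uE.
  by move=> s; apply: den; exact: lt_le_trans dD.
- split.
    exists (left_point (u a) (pi / 2)).
      by left; exists (pi / 2) => //=; apply/andP; split; move: pi0; clear; lra.
    by rewrite /= sin_pihalf mulr1 oppr_lt0.
  have h0 : (-1 <= 0 :> R) && (0 <= 1 :> R) by rewrite lerN10 ler01.
  exists (right_point (V (u a pi)) 0); first by right; exists 0.
  rewrite /= subr_gt0 -(@expr_lt1 _ 2) ?sqrtr_ge0//.
  have [_ ->] := right_c_gt0 0 (V0 0).
  rewrite sgm_id// expr0n /= subr0 mulr1 ltrBlDr ltrDl exprn_gt0//.
  by case/andP: (V0 0).
- exists (region r d).
    by apply/set_nbhsP; exists (region r d); split=> //; exact: region_open.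
  move=> O' /periodic_orbit_local[g [T [cg [T0 gT] inj loc ->]]] sub'.
  have G : traces (right_system A B e) (left_system f e) (region r d) g T.
    by split=> // t; apply: sub'; exists t.
  exact: (cycle_unique H G inj (tops_eq H G Pi)).
Qed.

(* [y], [b] and [c] are the increments of the initial value, of the left
   half-return and of the full return. *)
Lemma slope_step (R : realType) (e J1 J2 k m y b c : R) :
  0 < e -> 0 < k -> 16 * k <= `|m| -> m = J1 + J2 ->
  e * (`|J1| + k) <= 1 -> e * (`|J2| * (`|J1| + k)) * 16 <= `|m| ->
  `|b - y - e * J1 * y| <= k * e * `|y| ->
  `|c - b - e * J2 * b| <= k * e * `|b| ->
  `|c - y - e * m * y| <= e * (`|m| / 2) * `|y|.
Proof.
move=> e0 k0 + mE; rewrite {m}mE => km h1 h2 hb hc.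
have y0 := normr_ge0 y.
have by_ : `|b - y| <= e * (`|J1| + k) * `|y|.
  rewrite -[b - y](subrK (e * J1 * y)); apply: (le_trans (ler_normD _ _)).
  by rewrite !normrM (gtr0_norm e0); move: hb; clear; lra.
have b2 : `|b| <= 2 * `|y|.
  rewrite -(subrK y b); apply: (le_trans (ler_normD _ _)).
  have : e * (`|J1| + k) * `|y| <= 1 * `|y| by exact: ler_wpM2r.
  by move: by_; clear; lra.
have -> : c - y - e * (J1 + J2) * y =
  (c - b - e * J2 * b) + (b - y - e * J1 * y) + e * J2 * (b - y) by ring.
apply: (le_trans (ler_normD _ _)); apply: (le_trans (lerD (ler_normD _ _) (lexx _))).
have ke0 : 0 <= k * e by rewrite mulr_ge0// ltW.
have ey0 : 0 <= e * `|y| by rewrite mulr_ge0// ltW.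
have p1 : k * e * `|b| <= k * e * (2 * `|y|) by apply: ler_wpM2l.
have p2 : `|e * J2 * (b - y)| <= e * `|J2| * (e * (`|J1| + k) * `|y|).
  by rewrite !normrM (gtr0_norm e0); apply: ler_wpM2l => //; rewrite mulr_ge0// ltW.
have p3 : e * `|y| * (e * (`|J2| * (`|J1| + k)) * 16) <= e * `|y| * `|J1 + J2|.
  exact: ler_wpM2l.
have p4 : e * `|y| * (16 * k) <= e * `|y| * `|J1 + J2|.
  exact: ler_wpM2l.
have p5 : 0 <= e * `|y| * `|J1 + J2| by exact: mulr_ge0.
by move: p1 p2 p3 p4 p5 hb hc; clear; lra.
Qed.

(** [b] and [c] are the left and right displacements, both from [r], and [b0] is the displacement of
    the full return. The last bound accounts for the right half starting at [r + b]; the first-order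
    terms cancel because [J1 + J2] is the Melnikov function at its zero. *)
Lemma defect_step (R : realType) (e J1 J2 K2 k k2 q b c b0 : R) :
  0 < e -> 0 < k -> 0 < k2 -> J1 + J2 = 0 ->
  4 * k2 <= q -> 2 * (e * ((`|K2| + k) * (`|J1| + k2))) <= q ->
  `|b - e * J1| <= k2 * e -> `|c - e * J2| <= k2 * e ->
  `|(b0 - c - b) - e * K2 * b| <= k * e * `|b| ->
  `|b0| <= e * q.
Proof.
move=> e0 k0 k20 J0 kq eq hb hc h.
have b1 : `|b| <= e * (`|J1| + k2).
  rewrite -[b](subrK (e * J1)); apply: (le_trans (ler_normD _ _)).
  by rewrite normrM (gtr0_norm e0); move: hb; clear; lra.
have -> : b0 = (b0 - c - b - e * K2 * b) + (c - e * J2) + (b - e * J1) + e * K2 * b + e * (J1 + J2) by ring.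
rewrite J0 mulr0 addr0.
apply: (le_trans (ler_normD _ _)); apply: (le_trans (lerD (ler_normD _ _) (lexx _))).
apply: (le_trans (lerD (lerD (ler_normD _ _) (lexx _)) (lexx _))).
have p1 : `|e * K2 * b| <= e * `|K2| * (e * (`|J1| + k2)).
  by rewrite !normrM (gtr0_norm e0); apply: ler_wpM2l => //; rewrite mulr_ge0// ltW.
have p2 : k * e * `|b| <= k * e * (e * (`|J1| + k2)).
  by apply: ler_wpM2l b1; rewrite mulr_ge0// ltW.
have p3 : e * (2 * (e * ((`|K2| + k) * (`|J1| + k2)))) <= e * q by rewrite ler_pM2l.
have p4 : e * (4 * k2) <= e * q by rewrite ler_pM2l.
by move: h hb hc p1 p2 p3 p4; clear; lra.
Qed.

Lemma der_horner_left (R : realType) (f : {poly R}) (a s : R) :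
  is_derive s (1 : R) (fun s => s * left_rate f a) (left_rate f a).
Proof.
apply: der_eq (derM (der_id s) (der_cst (left_rate f a) s)) _.
by rewrite mulr0 addr0 mul1r.
Qed.

Lemma right_bounds (R : realType) (A B : {poly R}) (r eta : R) :
  0 < r < 1 -> 0 < eta ->
  exists D L e0, [/\ 0 < D /\ 0 < e0, D < r, r + D < 1, D <= eta &
   forall e, 0 < e < e0 ->
   [/\ forall s v, `|v - r| < D -> 0 < right_den A B e s v,
      forall s v w, `|v - r| < D -> `|w - r| < D ->
        `|right_rate A B e s v - right_rate A B e s w| <= L * `|v - w| &
      forall y, `|y - r| < D -> - y + e * right_pert A B (0, y) < 0]].
Proof.
move=> hr eta0; have /andP[r0 r1] := hr.
have [G1 [M [_ _ K _]]] := sd_right_den A B hr.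
have r20 : 0 < r / 2 by move: r0; clear; lra.
have [d1 d10 H1] := K _ r20.
have [F1 [L [_ FB K2 _]]] := sd_right A B hr.
have [d2 d20 H2] := K2 1 ltr01.
have cp : continuous (fun y : R => right_pert A B (0, y)).
  move=> y; apply: (@continuous_comp _ _ _ (fun y : R => (0 : R, y)) (right_pert A B)).
    apply: (@continuous_pair _ _ _ (fun=> 0) (fun y => y)) => x; [exact: cvg_cst|exact: cvg_id].
  exact: right_pert_continuous.
have [C C0 HC] := continuous_bounded ler01 cp.
have [d3 /andP[d30 _] d3C] := small_factor r20 C0.
pose D := Num.min (Num.min d1 d2) (Num.min (Num.min (r / 2) ((1 - r) / 2)) eta).
have D0 : 0 < D.
  by rewrite !lt_min d10 d20 r20 eta0 !andbT /=; move: r1; clear; lra.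
have [Dd1 Dd2 Dr Dr1 De] : [/\ D <= d1, D <= d2, D <= r / 2, D <= (1 - r) / 2 & D <= eta].
  by rewrite !ge_min !lexx !orbT.
clearbody D.
exists D, (L + 1), (Num.min (Num.min d1 d2) d3); split.
- by rewrite !lt_min d10 d20 d30.
- by move: Dr r0; clear; lra.
- by move: Dr1 r1; clear; lra.
- exact: De.
move=> e; rewrite !lt_min => /andP[e0 /andP[/andP[ed1 ed2] ed3]]; split.
- move=> s v hv; have hv1 := lt_le_trans hv Dd1.
  have [|h _] := H1 e s v v _ hv1 hv1; first by rewrite (ltW e0).
  move: h; rewrite {2}/right_den mul0r subr0 ler_norml => /andP[h _].
  by move: h r0; clear; lra.
- move=> s v w hv hw.
  have [|_ h] := H2 e s v w _ (lt_le_trans hv Dd2) (lt_le_trans hw Dd2); first by rewrite (ltW e0).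
  rewrite -[X in `|X|](subrK (F1 s * (v - w))); apply: (le_trans (ler_normD _ _)).
  rewrite normrM mulrDl addrC; apply: lerD => //.
  by apply: ler_wpM2r => //; have [] := FB s.
- move=> y; rewrite ltr_distl => /andP[h1 h2].
  have := HC y => /(_ _) W.
  have p1 : `|right_pert A B (0, y)| <= C.
    by apply: W; apply/andP; split; move: h1 h2 Dr Dr1 r0 r1; clear; lra.
  have p2 : e * right_pert A B (0, y) <= d3 * C.
    apply: (le_trans (ler_norm _)); rewrite normrM (gtr0_norm e0).
    by apply: ler_pM => //; exact: ltW.
  by move: p2 d3C h1 Dr; clear; lra.
Qed.

Lemma small_product (R : realType) (k C : R) : 0 < k -> 0 <= C ->
  exists2 e0, 0 < e0 & forall e, 0 < e < e0 -> e * C <= k.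
Proof.
move=> k0 C0; have [e0 /andP[e00 _] h] := small_factor k0 C0; exists e0 => // e /andP[_ ee].
by apply: le_trans h; apply: ler_wpM2r => //; exact: ltW.
Qed.

Lemma clamp_IVT (R : realType) (F : R -> R) (r d L : R) : 0 < d ->
  (forall y z, `|y - r| <= d -> `|z - r| <= d -> `|F y - F z| <= L * `|y - z|) ->
  F (r - d) * F (r + d) < 0 -> exists2 a, `|a - r| <= d & F a = 0.
Proof.
move=> d0 lip sgn; pose cl := clamp (r - d) (r + d).
have clI y : `|cl y - r| <= d.
  by rewrite ler_distl; apply: clamp_itv; move: d0; clear; lra.
have L0 : 0 <= L.
  have h : 0 <= L * `|r - (r + d)|.
    have h1 : `|r - r| <= d by rewrite subrr normr0 ltW.
    have h2 : `|r + d - r| <= d by rewrite addrAC subrr add0r gtr0_norm.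
    exact: le_trans (lip _ _ h1 h2).
  by move: h; rewrite pmulr_lge0// normr_gt0; apply/eqP; move: d0; clear; lra.
have cF : continuous (fun y => F (cl y)).
  apply: (@lipschitz_continuous _ _ L) => y z; apply: (le_trans (lip _ _ (clI y) (clI z))).
  by apply: ler_wpM2l => //; exact: clamp_lipschitz.
have le : r - d <= r + d by move: d0; clear; lra.
have [|c _ Fc] := IVT le (continuous_subspaceT cF) (_ : _ <= 0 <= _); last by exists (cl c).
rewrite /cl !clamp_id ?lexx ?le// ge_min le_max.
by case: (ltgtP (F (r - d)) 0) sgn => h1; case: (ltgtP (F (r + d)) 0) => h2 //=;
  rewrite ?h1 ?h2 ?mul0r ?mulr0 ?ltxx// ltNge;
  [rewrite nmulr_rge0// ltW|rewrite pmulr_rge0// ltW].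
Qed.

(** The displacement of the return map has difference quotients within [e |m| / 2] of [e m] and is
    at most [e |m| d / 16] at [r]. Over a distance [d / 4] it varies by at least [e |m| d / 8], so
    it changes sign around [r]; the slope bound then gives the sign conditions of
    [limit_cycle_of_fixpoint]. *)
Theorem melnikov_limit_cycle (R : realType) (A B f : {poly R}) (r m eta : R) :
  0 < r < 1 -> melnikov A B f r = 0 -> is_derive r (1 : R) (melnikov A B f) m ->
  m != 0 -> 0 < eta ->
  exists2 e0, 0 < e0 & forall e, 0 < e < e0 -> exists2 O,
    limit_cycle (right_system A^`() B e) (left_system f e) O & O `<=` region r eta.
Proof.
move=> hr M0 dM m0 eta0; have /andP[r0 r1] := hr.
have pi0 := pi_gt0 R.
have [D [L [eb [[D0 eb0] Dr D1 Deta bounds]]]] := right_bounds A^`() B hr eta0.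
have [|JL dJL HL] := @half_map _ r 0 pi (fun _ _ v => left_rate f v)
    (fun a s => s * left_rate f a) pi0 (sd_left r f).
  by exists 1 => // a s _ _; exact: der_horner_left.
have [||JR dJR HR] := @half_map _ r (-1) 1 (right_rate A^`() B) (right_prim A B) _ (sd_right A^`() B hr).
- by clear; lra.
- exists (Num.min r (1 - r)); first by rewrite lt_min r0 subr_gt0.
  move=> a s; rewrite lt_min => /andP[]; rewrite !ltr_distl => /andP[h1 _] /andP[_ h2] /andP[h3 h4].
  apply: der_right_prim; apply/andP; split.
  + by move: h1; rewrite subrr.
  + by move: h2; clear; lra.
  + by move: h3; clear; lra.
  + by move: h4; clear; lra.
have mE : m = JL + JR.
  apply: der_uniq dM _; apply: (@der_near _ _ _ 0 1) (derD dJL dJR); first by rewrite r0.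
  by move=> a /andP[a0 _]; rewrite [RHS]melnikovE ?gt_eqF.
have am0 : 0 < `|m| by rewrite normr_gt0.
(* [D] confines the solutions, [|m| / 16] is the slope precision required by [slope_step]. *)
pose k := Num.min D (`|m| / 16).
have k0 : 0 < k by rewrite lt_min D0 divr_gt0.
have kD : k <= D by rewrite ge_min lexx.
have km : 16 * k <= `|m|.
  have : k <= `|m| / 16 by rewrite ge_min lexx orbT.
  by clear; lra.
clearbody k.
have [dL dL0 {}HL] := HL k k0; have [dR dR0 {}HR] := HR k k0.
pose d := Num.min D (Num.min dL dR).
have d0 : 0 < d by rewrite !lt_min D0 dL0.
have [dD ddL ddR] : [/\ d <= D, d <= dL & d <= dR] by rewrite !ge_min !lexx !orbT.
clearbody d.
pose q := `|m| * d / 16.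
have qE : q = `|m| * d / 16 by [].
have q0 : 0 < q by rewrite divr_gt0// mulr_gt0.
clearbody q.
(* [q / 4] serves [defect_step]; [d / 8] ensures that an orbit starting within [d / 4] of [r] stays
   within [d / 2] through both halves. *)
pose k2 := Num.min (q / 4) (d / 8).
have k20 : 0 < k2 by rewrite lt_min !divr_gt0.
have k2q : 4 * k2 <= q.
  have : k2 <= q / 4 by rewrite ge_min lexx.
  by clear; lra.
have k2d : k2 <= d / 8 by rewrite ge_min lexx orbT.
clearbody k2.
have [eL eL0 {}HL] := HL k2 k20; have [eR eR0 {}HR] := HR k2 k20.
pose J1 := pi * left_rate f r - 0 * left_rate f r.
pose J2 := right_prim A B r 1 - right_prim A B r (-1).
have J12 : J1 + J2 = 0 by rewrite -melnikovE// gt_eqF.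
have JLk : 0 <= `|JL| + k by rewrite addr_ge0// ltW.
have [e1 e10 E1] := small_product ltr01 JLk.
have am16 : 0 < `|m| / 16 by rewrite divr_gt0.
have [e2 e20 E2] := small_product am16 (mulr_ge0 (normr_ge0 JR) JLk).
have q20 : 0 < q / 2 by rewrite divr_gt0.
have C3 : 0 <= (`|JR| + k) * (`|J1| + k2) by rewrite mulr_ge0// addr_ge0// ltW.
have [e3 e30 E3] := small_product q20 C3.
have m20 : 0 <= 2 * `|m| by rewrite mulr_ge0.
(* With [2 e |m| <= 1] the displacement is at most three quarters of [|y - a|], so the return map
   does not jump across [a]. *)
have [e4 e40 E4] := small_product ltr01 m20.
exists (Num.min (Num.min eb (Num.min eL eR)) (Num.min (Num.min e1 e2) (Num.min e3 e4))).
  by rewrite !lt_min eb0 eL0 eR0 e10 e20 e30.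
move=> e; rewrite !lt_min => /andP[e0 /andP[/and3P[eeb eeL eeR] /andP[/andP[ee1 ee2] /andP[ee3 ee4]]]].
have [|den lip trans] := bounds e; first by rewrite e0.
have [|u [Hu slu defu]] := HL e; first by rewrite e0.
have [|V [HV slV defV]] := HR e; first by rewrite e0.
have {}E1 := E1 e (introT andP (conj e0 ee1)).
have {}E2 := E2 e (introT andP (conj e0 ee2)).
have {}E3 := E3 e (introT andP (conj e0 ee3)).
have {}E4 := E4 e (introT andP (conj e0 ee4)).
have hm : half_maps A^`() B f e r D d u V.
  split=> //.
  - move=> a ha; have [cu u0 du uk _] := Hu a (lt_le_trans ha ddL).
    split=> //; first by move=> s hs; apply: du; rewrite sub0r.
    by move=> s; exact: lt_le_trans (uk s) kD.
  - move=> b hb; have [cV V0 dV Vk _] := HV b (lt_le_trans hb ddR).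
    split=> //.
      move=> s /andP[h1 h2]; apply: dV; apply/andP; split; move: h1 h2; clear; lra.
    by move=> s; exact: lt_le_trans (Vk s) kD.
  - split; [exact: den|by exists L].
  - by move=> y hy; apply: trans; exact: lt_le_trans dD.
pose P y := V (u y pi) 1.
have slope y z : `|y - r| < d -> `|u y pi - r| < d -> `|z - r| < d -> `|u z pi - r| < d ->
    `|(P y - y) - (P z - z) - e * m * (y - z)| <= e * (`|m| / 2) * `|y - z|.
  move=> hy huy hz huz.
  have := slu y z (lt_le_trans hy ddL) (lt_le_trans hz ddL) => s1.
  have := slV (u y pi) (u z pi) (lt_le_trans huy ddR) (lt_le_trans huz ddR) => s2.
  rewrite (_ : P y - y - (P z - z) = P y - P z - (y - z)); last by ring.
  apply: (@slope_step _ e JL JR k m (y - z) (u y pi - u z pi) (P y - P z)) => //.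
  - by move: E2; clear; lra.
  - by rewrite (_ : u y pi - u z pi - (y - z) = u y pi - y - (u z pi - z)); last by ring.
  - by rewrite (_ : P y - P z - (u y pi - u z pi) = P y - u y pi - (P z - u z pi)); last by ring.
have near y : `|y - r| <= d / 4 -> `|y - r| < d /\ `|u y pi - r| < d / 2.
  move=> hy; have yd : `|y - r| < d by move: hy d0; clear; lra.
  split=> //; have [_ _ _ _ h] := Hu y (lt_le_trans yd ddL).
  rewrite -(subrK y (u y pi)) -addrA; apply: (le_lt_trans (ler_normD _ _)).
  by have := h pi; move: hy k2d d0; clear; lra.
have d2 : d / 2 < d by move: d0; clear; lra.
have near' y : `|y - r| <= d / 4 -> `|y - r| < d /\ `|u y pi - r| < d.
  by move=> /near[h1 h2]; split=> //; exact: lt_trans h2 d2.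
have rr : `|r - r| <= d / 4 by rewrite subrr normr0 divr_ge0// ltW.
have Pr : `|P r - r| <= e * q.
  have [r2 r3] := near' _ rr.
  apply: (@defect_step _ e J1 J2 JR k k2 q (u r pi - r) (V r 1 - r)) => //.
  - by move: E3; clear; lra.
  - have := slV (u r pi) r (lt_le_trans r3 ddR) (lt_le_trans r2 ddR).
    by rewrite (_ : P r - r - (V r 1 - r) - (u r pi - r) = P r - u r pi - (V r 1 - r)); last by (rewrite /P; ring).
have ed0 : 0 < e * (d / 4) by rewrite mulr_gt0// divr_gt0.
have eq0 : e * q = `|m| * (e * (d / 4)) / 4 by rewrite qE; field.
have [a ad /eqP] : exists2 a, `|a - r| <= d / 4 & P a - a = 0.
  apply: (@clamp_IVT _ (fun y => P y - y) r (d / 4) (e * (2 * `|m|))).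
  - by rewrite divr_gt0.
  - move=> y z /near'[y1 y2] /near'[z1 z2]; have := slope y z y1 y2 z1 z2 => h.
    rewrite -[P y - y - _](subrK (e * m * (y - z))); apply: (le_trans (ler_normD _ _)).
    rewrite !normrM (gtr0_norm e0).
    have := mulr_ge0 (mulr_ge0 (ltW e0) (normr_ge0 m)) (normr_ge0 (y - z)).
    by move: h; clear; lra.
  have hp : `|r + d / 4 - r| <= d / 4 by rewrite addrAC subrr add0r gtr0_norm// divr_gt0.
  have hn : `|r - d / 4 - r| <= d / 4 by rewrite addrAC subrr add0r normrN gtr0_norm// divr_gt0.
  have [r2 r3] := near' _ rr; have [p2 p3] := near' _ hp; have [n2 n3] := near' _ hn.
  have := slope _ _ p2 p3 r2 r3; have := slope _ _ n2 n3 r2 r3; move: Pr; rewrite eq0.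
  rewrite (_ : r - d / 4 - r = - (d / 4)); last by ring.
  rewrite (_ : r + d / 4 - r = d / 4); last by ring.
  rewrite normrN (gtr0_norm (_ : 0 < d / 4)) ?divr_gt0//.
  rewrite !ler_norml.
  move: (P r - r) (P (r - d / 4) - (r - d / 4)) (P (r + d / 4) - (r + d / 4)) => x y z.
  have [mp|mn|E] := ltgtP 0 m; last by move: m0; rewrite -E eqxx.
  - rewrite gtr0_norm// => /andP[x1 x2] /andP[y1 y2] /andP[z1 z2].
    have w : 0 < m * (e * (d / 4)) by rewrite mulr_gt0.
    have yn : y < 0 by move: x1 x2 y1 y2 w; clear; lra.
    have zp : 0 < z by move: x1 x2 z1 z2 w; clear; lra.
    by rewrite nmulr_rlt0.
  - rewrite ltr0_norm// => /andP[x1 x2] /andP[y1 y2] /andP[z1 z2].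
    have w : m * (e * (d / 4)) < 0 by rewrite pmulr_llt0.
    have yn : 0 < y by move: x1 x2 y1 y2 w; clear; lra.
    have zp : z < 0 by move: x1 x2 z1 z2 w; clear; lra.
    by rewrite pmulr_rlt0.
rewrite subr_eq0 => /eqP Pa.
have [a1 a2] := near _ ad.
have [_ _ _ _ ua] := Hu a (lt_le_trans a1 ddL).
have [_ _ _ _ Va] := HV (u a pi) (lt_le_trans (lt_trans a2 d2) ddR).
have ud s : `|u a s - r| < d.
  rewrite -(subrK a (u a s)) -addrA; apply: (le_lt_trans (ler_normD _ _)).
  by have := ua s; move: ad k2d d0; clear; lra.
have Vd s : `|V (u a pi) s - r| < d.
  rewrite -(subrK (u a pi) (V (u a pi) s)) -addrA; apply: (le_lt_trans (ler_normD _ _)).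
  by have := Va s; move: a2 k2d d0; clear; lra.
exists (cycle (u a) (V (u a pi))).
  apply: (@limit_cycle_of_fixpoint _ _ _ _ e r D d a m) => //.
  move=> y y1 y2 ya; have := slope y a y1 y2 a1 (ud pi).
  rewrite Pa subrr subr0 -/(P y).
  have : y - a != 0 by rewrite subr_eq0.
  have -> : P y - a = (P y - y) + (y - a) by ring.
  move: (P y - y) (y - a) => x w w0 h.
  have w2 : 0 < w ^+ 2 by rewrite exprn_even_gt0.
  have aw : `|w| * `|w| = w ^+ 2 by rewrite -expr2 real_normK ?num_real.
  have p1 : `|x * w - e * m * w ^+ 2| <= e * (`|m| / 2) * w ^+ 2.
    rewrite (_ : _ - _ = (x - e * m * w) * w); last by ring.
    by rewrite normrM -aw mulrA; exact: ler_wpM2r.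
  have E4w : e * (2 * `|m|) * w ^+ 2 <= 1 * w ^+ 2 by apply: ler_wpM2r => //; exact: ltW.
  move: p1; rewrite ler_norml => /andP[p1 p2].
  have mw := mulr_gt0 e0 w2.
  split.
    have h1 : - `|m| * (e * w ^+ 2) <= m * (e * w ^+ 2).
      by apply: ler_wpM2r; [exact: ltW|rewrite lerNl -normrN ler_norm].
    by move: p1 E4w w2 h1; clear; lra.
  have [mp|mn|E] := ltgtP 0 m; last by move: m0; rewrite -E eqxx.
  - apply: mulr_gt0 => //; rewrite gtr0_norm// in p1.
    by have := mulr_gt0 mp mw; move: p1; clear; lra.
  - rewrite nmulr_rgt0//; rewrite ltr0_norm// in p2.
    have : m * (e * w ^+ 2) < 0 by rewrite pmulr_llt0.
    by move: p2; clear; lra.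
have dr : d < r by exact: le_lt_trans Dr.
have rd : r + d < 1 by apply: le_lt_trans D1; rewrite lerD2l.
apply: subset_trans (cycle_region ud Vd dr rd) _ => z [h1 h2]; split=> //.
exact: lt_le_trans h2 (le_trans dD Deta).
Qed.

(** * Zeros of the Melnikov function *)

Definition comb (R : realType) (N : nat) (phi : 'I_N -> R -> R) (v : 'rV[R]_N) (t : R) : R :=
  \sum_i v 0 i * phi i t.

Lemma comb_linear (R : realType) (N : nat) (phi : 'I_N -> R -> R) (v w : 'rV[R]_N) (a b t : R) :
  comb phi (a *: v + b *: w) t = a * comb phi v t + b * comb phi w t.
Proof.
rewrite /comb !big_distrr -big_split /=; apply: eq_bigr => i _.
by rewrite !mxE; ring.
Qed.

Lemma der_comb (R : realType) (N : nat) (phi phi' : 'I_N -> R -> R) (v : 'rV[R]_N) (t : R) :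
  (forall i, is_derive t (1 : R) (phi i) (phi' i t)) ->
  is_derive t (1 : R) (comb phi v) (comb phi' v t).
Proof.
move=> d; rewrite /comb; elim: (index_enum _) => [|i s IH].
  rewrite big_nil (_ : (fun t => _) = fun=> 0); first exact: der_cst.
  by apply/funext => x; rewrite big_nil.
rewrite big_cons (_ : (fun t => _) = fun x => v 0 i * phi i x + \sum_(j <- s) v 0 j * phi j x).
  apply: der_eq (derD (derM (der_cst (v 0 i) t) (d i)) IH) _.
  by rewrite mul0r add0r.
by apply/funext => x; rewrite big_cons.
Qed.

(** The columns of [C] are the evaluations at the points of [ts] and, last, the [j]-th coordinate;
    having more rows than columns, [C] has a nonzero left kernel. *)
Lemma exists_kernel (R : realType) (N : nat) (phi : 'I_N -> R -> R) (ts : seq R) (j : 'I_N) :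
  ((size ts).+1 < N)%N ->
  exists b : 'rV[R]_N, [/\ b != 0, b 0 j = 0 & forall t, t \in ts -> comb phi b t = 0].
Proof.
move=> kN; pose C : 'M[R]_(N, (size ts).+1) :=
  \matrix_(i, c) if (c < size ts)%N then phi i ts`_c else (i == j)%:R.
have : kermx C != 0.
  rewrite kermx_eq0 /row_free; apply/eqP => E.
  by have := rank_leq_col C; rewrite E leqNgt kN.
move=> /rowV0Pn[b /sub_kermxP bC b0]; exists b; split=> //.
  have := congr1 (fun M : 'rV_(_) => M 0 ord_max) bC; rewrite !mxE => <-.
  rewrite (bigD1 j)//= big1 ?addr0 => [|i ij]; rewrite !mxE ltnn; first by rewrite eqxx mulr1.
  by rewrite (negbTE ij) mulr0.
move=> t /(nthP 0)[c ck <-].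
have := congr1 (fun M : 'rV_(_) => M 0 (Ordinal (ltnW ck : (c < (size ts).+1)%N))) bC.
by rewrite !mxE => {2}<-; apply: eq_bigr => i _; rewrite !mxE /= ck.
Qed.

(** Shrink the interval once for each combination: independence on the current interval gives a
    nonzero value, continuity a smaller interval. *)
Lemma common_nonzero (R : realType) (N : nat) (phi phi' : 'I_N -> R -> R) (p q : R)
    (es : seq 'rV[R]_N) :
  (forall i t, p < t < q -> is_derive t (1 : R) (phi i) (phi' i t)) ->
  (forall v a b, p <= a -> a < b -> b <= q ->
     (forall t, a < t < b -> comb phi v t = 0) -> v = 0) ->
  p < q -> (forall e, e \in es -> e != 0) ->
  exists a b, [/\ p <= a, a < b, b <= q &
    forall e t, e \in es -> a < t < b -> comb phi e t != 0].
Proof.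
move=> d ind pq; elim: es => [|e es IH] es0; first by exists p, q.
have [|a [b [pa ab bq H]]] := IH; first by move=> e' h; apply: es0; rewrite inE h orbT.
have [t tI te] : exists2 t, a < t < b & comb phi e t != 0.
  apply: contrapT => nex; have /negP : e != 0 by apply: es0; rewrite inE eqxx.
  apply; apply/eqP; apply: (ind _ _ _ pa ab bq) => t ht; apply/eqP; apply/negPn/negP => h.
  by apply: nex; exists t.
have ct : {for t, continuous (fun s => `|comb phi e s|)}.
  apply: cvg_norm; apply: der_continuous (der_comb e _) => i; apply: d.
  by case/andP: tI => h1 h2; rewrite (le_lt_trans pa h1) (lt_le_trans h2 bq).
have [|h h0 Hh] := @continuous_gt _ _ _ 0 ct; first by rewrite normr_gt0.
case/andP: tI => t1 t2.
exists (Num.max a (t - h)), (Num.min b (t + h)); split.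
- by rewrite le_max pa.
- by rewrite gt_max !lt_min ab /=; apply/andP; split; [|apply/andP; split]; move: t1 t2 h0; clear; lra.
- by rewrite ge_min bq.
move=> e' s; rewrite inE gt_max lt_min => /predU1P[->|h'] /andP[/andP[s1 s2] /andP[s3 s4]].
  by rewrite -normr_gt0; apply: Hh; rewrite ltr_distl; apply/andP; split; move: s2 s4; clear; lra.
by apply: H => //; rewrite s1.
Qed.

(* Given [v] with simple zeros [ts], take [b] independent of [v] and vanishing on
   [ts]; then [b(t) v - v(t) b] also vanishes at [t], and all its zeros are simple
   unless the Wronskian of [b] and [v], or one of finitely many combinations,
   vanishes at [t]. *)
Lemma simple_zeros (R : realType) (N : nat) (phi phi' : 'I_N -> R -> R) (p q : R) :
  (forall i t, p < t < q -> is_derive t (1 : R) (phi i) (phi' i t)) ->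
  (forall v a b, p <= a -> a < b -> b <= q ->
     (forall t, a < t < b -> comb phi v t = 0) -> v = 0) ->
  p < q -> forall k, (k < N)%N ->
  exists (v : 'rV[R]_N) (ts : seq R), [/\ v != 0, size ts = k, uniq ts &
    forall t, t \in ts -> [/\ p < t < q, comb phi v t = 0 & comb phi' v t != 0]].
Proof.
move=> d ind pq; elim=> [|k IH] kN.
  exists (\row_i (i == Ordinal kN)%:R), [::]; split=> //; apply/eqP => /rowP/(_ (Ordinal kN)).
  by rewrite !mxE eqxx => /eqP; rewrite oner_eq0.
have [v [ts [v0 sz un H]]] := IH (ltnW kN).
have [j vj] : exists j, v 0 j != 0.
  apply: contrapT => nex; case/negP: v0; apply/eqP/rowP => j; rewrite mxE.
  by apply/eqP/negPn/negP => h; apply: nex; exists j.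
have [|b [b0 bj bz]] := @exists_kernel _ _ phi ts j; first by rewrite sz.
(* Evaluated at the new point, [ee t] is the derivative at the old zero [t] of the new combination;
   it is nonzero because [v] has a simple zero at [t] and [b] is independent of [v]. *)
pose ee t := comb phi' v t *: b + (- comb phi' b t) *: v.
have ee0 e : e \in v :: [seq ee t | t <- ts] -> e != 0.
  rewrite inE => /predU1P[->//|/mapP[t tts ->]].
  have [_ _ dv] := H t tts.
  apply/eqP => E; have := congr1 (fun M : 'rV_N => M 0 j) E.
  rewrite !mxE bj mulr0 add0r => /eqP; rewrite mulf_eq0 (negbTE vj) orbF oppr_eq0 => /eqP E'.
  move: E; rewrite /ee E' oppr0 scale0r addr0 => /eqP; rewrite scaler_eq0.
  by rewrite (negbTE dv) (negbTE b0).
have [a [c [pa ac cq nz]]] := common_nonzero d ind pq ee0.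
have vnz t : a < t < c -> comb phi v t != 0 by move=> ht; apply: nz; rewrite ?inE ?eqxx.
have sub t : a < t < c -> p < t < q.
  by move=> /andP[h1 h2]; rewrite (le_lt_trans pa h1) (lt_le_trans h2 cq).
pose W t := comb phi b t * comb phi' v t - comb phi v t * comb phi' b t.
have [t tI Wt] : exists2 t, a < t < c & W t != 0.
  apply: contrapT => nex; have W0 t : a < t < c -> W t = 0.
    by move=> ht; apply/eqP/negPn/negP => h; apply: nex; exists t.
  (* A vanishing Wronskian makes this quotient constant, so [b] is a multiple of [v]; the coordinate
     [j] forces the factor to be [0], against [b != 0]. *)
  pose g t := comb phi b t * (comb phi v t)^-1.
  have dg t : a < t < c -> is_derive t (1 : R) g 0.
    move=> ht; have dv := der_comb v (fun i => d i t (sub t ht)).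
    have db := der_comb b (fun i => d i t (sub t ht)).
    apply: der_eq (derM db (derV (vnz t ht) dv)) _.
    have := W0 t ht; rewrite /W => /eqP; rewrite subr_eq0 => /eqP E.
    have -> : comb phi' b t / comb phi v t + comb phi b t * (- comb phi v t ^- 2 * comb phi' v t) =
       (comb phi v t * comb phi' b t - comb phi b t * comb phi' v t) / comb phi v t ^+ 2.
      by field; exact: vnz.
    by rewrite E subrr mul0r.
  pose m := (a + c) / 2.
  have mI : a < m < c by apply/andP; split; move: ac; rewrite /m; clear; lra.
  have bv : b - g m *: v = 0.
    apply: (ind _ _ _ pa ac cq) => t ht.
    rewrite -[b]scale1r -scaleNr comb_linear mul1r.
    rewrite (der0_eq dg mI ht) /g mulNr divfK ?subrr//; exact: vnz.
  have /eqP gm0 : g m == 0.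
    have := congr1 (fun M : 'rV_N => M 0 j) bv; rewrite !mxE bj add0r => /eqP.
    by rewrite oppr_eq0 mulf_eq0 (negbTE vj) orbF.
  by move: bv; rewrite gm0 scale0r subr0 => E; rewrite E eqxx in b0.
have tts : t \notin ts.
  by apply/negP => /H[_ E _]; have := vnz t tI; rewrite E eqxx.
pose w := comb phi b t *: v + (- comb phi v t) *: b.
have wt : comb phi' w t != 0.
  by rewrite comb_linear mulNr.
exists w, (t :: ts); split.
- apply/eqP => E; case/negP: wt; rewrite E /comb big1// => i _; by rewrite mxE mul0r.
- by rewrite /= sz.
- by rewrite /= tts.
move=> s; rewrite inE => /predU1P[->|sts].
  split; [exact: sub| |exact: wt].
  by rewrite comb_linear; ring.
have [sI vs dvs] := H s sts; split=> //.
  by rewrite comb_linear vs (bz s)// !mulr0 addr0.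
have := nz (ee s) t; rewrite inE map_f ?orbT// => /(_ isT tI).
rewrite !comb_linear; congr (_ != 0); ring.
Qed.

(** * Independence of the Melnikov basis *)

Lemma poly_itv0 (R : realType) (p : {poly R}) (a b : R) : a < b ->
  (forall t, a < t < b -> p.[t] = 0) -> p = 0.
Proof.
move=> ab H; apply/eqP/negPn/negP => p0.
(* The shift by two puts every point strictly inside the interval. *)
pose pt (k : nat) := a + (b - a) / k.+2%:R : R.
have ab0 : 0 < b - a by rewrite subr_gt0.
have := @max_poly_roots _ p [seq pt k | k <- iota 0 (size p)] p0.
rewrite size_map size_iota ltnn => W; suff : false by []; apply: W.
  apply/allP => _ /mapP[k _ ->]; apply/rootP; apply: H.
  have k0 : 0 < k.+2%:R :> R by [].
  have k1 : 1 < k.+2%:R :> R by rewrite ltr1n.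
  rewrite /pt ltrDl divr_gt0//= -ltrBrDl ltr_pdivrMr//.
  by rewrite ltr_pMr.
rewrite map_inj_uniq ?iota_uniq// => i j /addrI /(mulfI (lt0r_neq0 ab0)) /invr_inj /eqP.
by rewrite eqr_nat => /eqP [].
Qed.

(* [Q + S * ln ((1 + r) / (1 - r)) = 0] is impossible for polynomials with
   [S <> 0]: differentiating [Q / S] gives the identity below, and the orders
   of vanishing at [1] of its two sides differ. *)
Lemma log_identity (R : realType) (Q S : {poly R}) :
  (1 - 'X^2) * (Q^`() * S - S^`() * Q) + 2%:R *: S ^+ 2 = 0 -> S = 0.
Proof.
move=> H; apply/eqP/negPn/negP => S0.
have Q0 : Q != 0.
  apply/eqP => E; move: H; rewrite E deriv0 mul0r mulr0 subrr mulr0 add0r => /eqP.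
  by rewrite scaler_eq0 pnatr_eq0 /= expf_eq0 (negbTE S0).
have [c [Q1 q1 QE]] := multiplicity_XsubC Q 1; have [a [S1 s1 SE]] := multiplicity_XsubC S 1.
rewrite Q0 /= in q1; rewrite S0 /= in s1.
pose u : {poly R} := 'X - 1%:P.
rewrite -/u in QE SE.
have du n : u * (u ^+ n)^`() = n%:R *: u ^+ n.
  case: n => [|n]; first by rewrite expr0 -polyC1 derivC mulr0 scale0r.
  by rewrite deriv_exp derivB derivX derivC subr0 mul1r /= mulrnAr -exprS scaler_nat.
(* [Y] is what remains of [u] times the Wronskian after extracting [u ^+ (a + c)]. At [1] it is
   [c - a] times a nonzero number, so it vanishes there only when the two orders agree. *)
pose Y := u * (Q1^`() * S1 - S1^`() * Q1) + (c%:R - a%:R) *: (Q1 * S1).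
have EY : u * (Q^`() * S - S^`() * Q) = u ^+ (a + c) * Y.
  rewrite QE SE !derivM exprD /Y.
  have h1 := du c; have h2 := du a.
  transitivity (u * Q1^`() * u ^+ c * S1 * u ^+ a + Q1 * (u * (u ^+ c)^`()) * S1 * u ^+ a
    - u * S1^`() * u ^+ a * Q1 * u ^+ c - S1 * (u * (u ^+ a)^`()) * Q1 * u ^+ c); first by ring.
  rewrite h1 h2 -!mul_polyC; ring.
have E : u ^+ (a + c) * (('X + 1) * Y) = 2%:R *: (u ^+ (a + a) * S1 ^+ 2).
  have : (1 - 'X^2) = - (u * ('X + 1)) :> {poly R} by rewrite /u polyC1; ring.
  move=> E1; move: H; rewrite E1 mulNr -mulrA mulrCA EY SE => /eqP.
  rewrite addrC subr_eq0 => /eqP H; rewrite mulrCA -H exprMn -exprM muln2 -addnn.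
  by rewrite mulrC.
have u0 k : u ^+ k != 0 by rewrite expf_neq0// polyXsubC_eq0.
have u1 : u.[1] = 0 by rewrite /u !hornerE subrr.
have s10 : S1.[1] != 0 by [].
have q10 : Q1.[1] != 0 by [].
clearbody u; case: (ltnP c a) => ca.
  have : ('X + 1) * Y = 2%:R *: (u ^+ (a - c) * S1 ^+ 2).
    apply: (mulfI (u0 (a + c)%N)); rewrite E -scalerAr [u ^+ (a + c) * _]mulrA -exprD.
    by congr (_ *: (u ^+ _ * _)); rewrite -addnA subnKC// ltnW.
  move=> /(congr1 (fun p => p.[1])).
  rewrite /Y !hornerE u1 expr0n subn_eq0 leqNgt ca /= ?mulr0n mulr0 !mul0r add0r => /eqP.
  rewrite !mulf_eq0 (negbTE q10) (negbTE s10) !orbF subr_eq0 eqr_nat ltn_eqF// orbF.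
  by rewrite paddr_eq0// oner_eq0.
have : u ^+ (c - a) * (('X + 1) * Y) = 2%:R *: S1 ^+ 2.
  apply: (mulfI (u0 (a + a)%N)); rewrite -scalerAr -E [LHS]mulrA -exprD.
  by congr (u ^+ _ * _); rewrite -addnA subnKC.
move=> /(congr1 (fun p => p.[1])).
have -> : (u ^+ (c - a) * (('X + 1) * Y)).[1] = 0.
  rewrite 2!hornerM horner_exp u1; move: ca; rewrite leq_eqVlt => /predU1P[ac|ca].
    by rewrite /Y -ac subrr scale0r addr0 (hornerM u) u1 mul0r !mulr0.
  by rewrite expr0n subn_eq0 leqNgt ca /= ?mulr0n mul0r.
rewrite !hornerE => /esym/eqP.
by rewrite !mulf_eq0 (negbTE s10) !orbF pnatr_eq0.
Qed.

Definition logf (R : realType) (a : R) : R :=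
  1 + (1 - a ^+ 2) / (2 * a) * (ln (1 + a) - ln (1 - a)).

(** Multiplication by [2 t] clears the denominator and gives [Q + S L = 0] with polynomials [Q] and
    [S]. Eliminating [L] between this relation and its derivative gives the hypothesis of
    [log_identity] on an interval, hence as an identity of polynomials. *)
Lemma log_independent (R : realType) (P B : {poly R}) (a b : R) :
  0 <= a -> a < b -> b <= 1 ->
  (forall t, a < t < b -> P.[t] + B.[1 - t ^+ 2] * logf t = 0) ->
  P = 0 /\ B = 0.
Proof.
move=> a0 ab b1 H.
pose w : {poly R} := 1 - 'X^2.
pose S := (B \Po w) * w; pose Q := 2%:R *: ('X * (P + (B \Po w))).
have w1 t : w.[t] = 1 - t ^+ 2 by rewrite /w !hornerE.
pose L (t : R) := ln (1 + t) - ln (1 - t).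
have E1 t : a < t < b -> Q.[t] + S.[t] * L t = 0.
  move=> ht; have t0 : t != 0 by rewrite gt_eqF//; case/andP: ht => h _; exact: le_lt_trans h.
  rewrite /Q /S hornerZ !hornerM hornerX hornerD horner_comp w1; have := H t ht; rewrite /logf -/(L t) => /(congr1 (fun x => 2 * t * x)).
  rewrite mulr0 => <-; by field.
have dL t : a < t < b -> is_derive t (1 : R) L (2 / (1 - t ^+ 2)).
  move=> /andP[h1 h2]; have p0 : 0 < 1 + t by move: h1 a0; clear; lra.
  have q0 : 0 < 1 - t by move: h2 b1; clear; lra.
  have d1 := der_ln p0 (derD (der_cst 1 t) (der_id t)).
  have d2 := @der_ln _ (fun t => 1 - t) t _ q0 (derD (der_cst 1 t) (derN (der_id t))).
  apply: der_eq (derD d1 (derN d2)) _.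
  have -> : 1 - t ^+ 2 = (1 + t) * (1 - t) by ring.
  by field; rewrite !gt_eqF.
have S0 : S = 0.
  apply: (@log_identity _ Q); apply: (poly_itv0 ab) => t ht.
  have D : Q^`().[t] + (S^`().[t] * L t + S.[t] * (2 / (1 - t ^+ 2))) = 0.
    have d := derD (der_horner Q (der_id t)) (derM (der_horner S (der_id t)) (dL t ht)).
    rewrite !mulr1 in d; apply: (der_uniq d).
    by apply: (der_near ht _ (der_cst 0 t)) => s hs; rewrite E1.
  have n0 : 1 - t ^+ 2 != 0.
    by rewrite gt_eqF// subr_gt0 expr_lt1//; case/andP: ht => h1 h2; move: h1 h2 a0 b1; clear; lra.
  have QE : Q.[t] = - (S.[t] * L t) by apply/eqP; rewrite -addr_eq0 E1.
  rewrite -/w hornerD hornerZ hornerM w1 horner_exp hornerD hornerN (hornerM Q^`()) (hornerM S^`()) QE; move: D => /(congr1 (fun x => (1 - t ^+ 2) * S.[t] * x)).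
  rewrite mulr0 => <-; by field.
have wn0 : w != 0.
  apply/eqP => E; have := w1 0; rewrite E horner0 expr0n /= subr0 => /esym/eqP.
  by rewrite oner_eq0.
have B0 : B = 0.
  apply/eqP; have := S0; rewrite /S => /eqP; rewrite mulf_eq0 (negbTE wn0) orbF comp_poly_eq0//.
  rewrite /w -opprB size_polyN size_addl ?size_polyXn//.
  by rewrite size_polyN size_poly1.
split=> //; apply: (poly_itv0 ab) => t ht.
by have := H t ht; rewrite B0 horner0 mul0r addr0.
Qed.

(* The coefficients of [r^i], [i <= n], go to odd powers of the primitive of
   the right perturbation when [i] is even, and to the left perturbation when
   [i] is odd; the logarithmic functions come from the right. *)
Definition melnikov_basis (R : realType) (n m : nat) (i : 'I_(n.+1 + m)) (t : R) : R :=
  match fintype.split i with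
  | inl i => t ^+ i
  | inr j => (1 - t ^+ 2) ^+ j * logf t
  end.

(** The factor [1/2] offsets the doubling of odd powers in [A(a) - A(-a)]. *)
Definition poly_prim (R : realType) (n m : nat) (v : 'rV[R]_(n.+1 + m)) : {poly R} :=
  \sum_(i < n.+1) (if odd i then 0 else v 0 (lshift m i) / 2) *: 'X^(i.+1).

Definition poly_left (R : realType) (n m : nat) (v : 'rV[R]_(n.+1 + m)) : {poly R} :=
  \sum_(i < n.+1) (if odd i then v 0 (lshift m i) / pi else 0) *: 'X^(i./2).

Definition poly_right (R : realType) (n m : nat) (v : 'rV[R]_(n.+1 + m)) : {poly R} :=
  \sum_(j < m) v 0 (rshift n.+1 j) *: 'X^j.

Lemma comb_basis (R : realType) (n m : nat) (v : 'rV[R]_(n.+1 + m)) (t : R) :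
  comb (@melnikov_basis R n m) v t =
  \sum_(i < n.+1) v 0 (lshift m i) * t ^+ i +
  (\sum_(j < m) v 0 (rshift n.+1 j) * (1 - t ^+ 2) ^+ j) * logf t.
Proof.
rewrite /comb big_split_ord /= big_distrl /=; congr (_ + _); apply: eq_bigr => i _.
  by rewrite /melnikov_basis (unsplitK (inl i)).
by rewrite /melnikov_basis (unsplitK (inr i)) mulrA.
Qed.

Lemma melnikov_comb (R : realType) (n m : nat) (v : 'rV[R]_(n.+1 + m)) (t : R) : 0 < t ->
  melnikov (poly_prim v) (poly_right v) (poly_left v) t = comb (@melnikov_basis R n m) v t.
Proof.
move=> t0; rewrite comb_basis /melnikov -/(logf t); congr (_ + _ * _); last first.
  rewrite /poly_right horner_sum; apply: eq_bigr => j _.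
  by rewrite hornerZ hornerXn.
have pi0 : pi != 0 :> R by rewrite gt_eqF// pi_gt0.
rewrite /left_rate /poly_left /poly_prim !horner_sum -sumrB !big_distrr big_distrl -big_split /=.
apply: eq_bigr => i _; rewrite !hornerZ !hornerXn -exprM mul2n.
have io := odd_double_half i; move: io; case: (odd i) => /= io.
  rewrite !mul0r subrr mul0r addr0 -[in RHS]io add1n exprS.
  by move: (pi : R) pi0 => w w0; field.
rewrite mul0r !mulr0 add0r -[in RHS]io add0n.
have -> : (- t) ^+ i.+1 = - t ^+ i.+1.
  by rewrite exprNn -signr_odd /= -io oddD odd_double /= expr1 mulN1r.
rewrite -[in LHS]io add0n !exprS; field.
by rewrite gt_eqF.
Qed.

Lemma basis_independent (R : realType) (n m : nat) (v : 'rV[R]_(n.+1 + m)) (a b : R) :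
  0 <= a -> a < b -> b <= 1 ->
  (forall t, a < t < b -> comb (@melnikov_basis R n m) v t = 0) -> v = 0.
Proof.
move=> a0 ab b1 H.
pose P : {poly R} := \poly_(i < n.+1) v 0 (lshift m (inord i)).
pose B : {poly R} := \sum_(j < m) v 0 (rshift n.+1 j) *: 'X^j.
have [t ht|P0 B0] := @log_independent _ P B a b a0 ab b1.
  rewrite -(H t ht) comb_basis horner_poly /B horner_sum; congr (_ + _ * _).
    by apply: eq_bigr => i _; rewrite inord_val.
  by apply: eq_bigr => j _; rewrite hornerZ hornerXn.
apply/rowP => i; rewrite mxE -[i]splitK; case: (fintype.split i) => /= j.
  have := congr1 (fun p : {poly R} => p`_j) P0.
  by rewrite coef_poly ltn_ord coef0 inord_val.
have := congr1 (fun p : {poly R} => p`_j) B0.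
rewrite /B coef_sum coef0 (bigD1 j)//= big1 ?addr0 => [|k kj].
  by rewrite coefZ coefXn eqxx mulr1.
rewrite coefZ coefXn; case: eqP => [E|_]; last by rewrite mulr0.
by case/eqP: kj; apply/val_inj.
Qed.

Lemma der_basis (R : realType) (n m : nat) (i : 'I_(n.+1 + m)) (t : R) : 0 < t < 1 ->
  is_derive t (1 : R) (@melnikov_basis R n m i) ('D_1 (@melnikov_basis R n m i) t).
Proof.
move=> /andP[t0 t1]; suff [d h] : exists d, is_derive t (1 : R) (@melnikov_basis R n m i) d.
  by have E := @derive_val _ _ _ _ _ _ _ h; rewrite E.
rewrite /melnikov_basis; case: (fintype.split i) => j; first by eexists; exact: derX (der_id t).
have p0 : 0 < 1 + t by move: t0; clear; lra.
have q0 : 0 < 1 - t by rewrite subr_gt0.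
have dq := derD (der_cst 1 t) (derN (derX 2 (der_id t))).
have d1 := der_ln p0 (derD (der_cst 1 t) (der_id t)).
have d2 := @der_ln _ (fun t => 1 - t) t _ q0 (derD (der_cst 1 t) (derN (der_id t))).
have n2 : 2 * t != 0 by rewrite mulf_neq0// gt_eqF.
have d3 := @derV _ (fun t => 2 * t) t _ n2 (derM (der_cst 2 t) (der_id t)).
eexists; apply: derM (derX j dq) (derD (der_cst 1 t) (derM (derM dq d3) (derD d1 (derN d2)))).
Qed.

(** Division by the sum of the absolute coefficients preserves simple zeros and bounds the
    coefficients independently of [p] and [q], so one compact set serves all neighbourhoods. *)
Lemma melnikov_zeros (R : realType) (n m : nat) (p q : R) :
  0 <= p -> p < q -> q <= 1 -> forall k, (k < n.+1 + m)%N ->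
  exists (v : 'rV[R]_(n.+1 + m)) (ts : seq R),
  [/\ forall i, `|v 0 i| <= 1, size ts = k, uniq ts &
    forall t, t \in ts -> [/\ p < t < q,
      melnikov (poly_prim v) (poly_right v) (poly_left v) t = 0 &
      exists2 d, d != 0 &
        is_derive t (1 : R) (melnikov (poly_prim v) (poly_right v) (poly_left v)) d]].
Proof.
move=> p0 pq q1 k kN.
have sub t : p < t < q -> 0 < t < 1.
  by move=> /andP[h1 h2]; rewrite (le_lt_trans p0 h1) (lt_le_trans h2 q1).
have [||v [ts [v0 sz un H]]] := @simple_zeros _ _ (@melnikov_basis R n m)
    (fun i t => 'D_1 (@melnikov_basis R n m i) t) p q _ _ pq k kN.
- by move=> i t /sub; exact: der_basis.
- move=> v a b pa ab bq; apply: basis_independent => //; first exact: le_trans pa.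
  exact: le_trans q1.
pose C := \sum_i `|v 0 i|.
have C0 : 0 < C.
  rewrite lt_neqAle sumr_ge0// andbT eq_sym; apply: contraNneq v0 => E.
  apply/eqP/rowP => i; rewrite mxE; apply/eqP; rewrite -normr_le0.
  by rewrite -[leRHS]E /C (bigD1 i)//= lerDl sumr_ge0.
exists (C^-1 *: v), ts; split=> //.
  move=> i; rewrite mxE normrM gtr0_norm ?invr_gt0// mulrC ler_pdivrMr// mul1r.
  by rewrite /C (bigD1 i)//= lerDl sumr_ge0.
move=> t /H[tI Z dZ]; have t0 : 0 < t by have /andP[] := sub t tI.
have cE phi s : comb phi (C^-1 *: v) s = C^-1 * comb phi v s.
  have := @comb_linear _ _ phi v v C^-1 0 s; rewrite scale0r addr0 => ->.
  by rewrite mul0r addr0.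
split=> //; first by rewrite melnikov_comb// cE Z mulr0.
exists (C^-1 * comb (fun i t => 'D_1 (@melnikov_basis R n m i) t) v t).
  by rewrite mulf_neq0// invr_neq0// gt_eqF.
apply: (@der_near _ (comb (@melnikov_basis R n m) (C^-1 *: v)) _ 0 1); first exact: sub.
  by move=> s /andP[s0 _]; rewrite melnikov_comb.
rewrite -cE; apply: der_comb => i; apply: der_basis; exact: sub.
Qed.

(** * Coefficients of the perturbation *)

Lemma poly2_linear (R : realType) (n : nat) (c d : 'M[R]_n.+1) (a b : R) (z : R * R) :
  poly2 (a *: c + b *: d) z = a * poly2 c z + b * poly2 d z.
Proof.
rewrite /poly2 !big_distrr -big_split /=; apply: eq_bigr => i _.
rewrite !big_distrr -big_split /=; apply: eq_bigr => j _.
by rewrite !mxE; ring.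
Qed.

Definition is_poly2 (R : realType) (n : nat) (F : R * R -> R) : Prop :=
  exists c : 'M[R]_n.+1, forall z, poly2 c z = F z.

Lemma is_poly2_eq (R : realType) (n : nat) (F G : R * R -> R) :
  is_poly2 n F -> (forall z, F z = G z) -> is_poly2 n G.
Proof. by move=> [c cE] FG; exists c => z; rewrite cE. Qed.

Lemma is_poly2_comb (R : realType) (n : nat) (F G : R * R -> R) (a b : R) :
  is_poly2 n F -> is_poly2 n G -> is_poly2 n (fun z => a * F z + b * G z).
Proof.
by move=> [c cE] [d dE]; exists (a *: c + b *: d) => z; rewrite poly2_linear cE dE.
Qed.

Lemma is_poly2_monomial (R : realType) (n i j : nat) : (i + j <= n)%N ->
  is_poly2 n (fun z : R * R => z.1 ^+ i * z.2 ^+ j).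
Proof.
move=> ij; have hi : (i < n.+1)%N by rewrite ltnS (leq_trans (leq_addr j i)).
have hj : (j < n.+1)%N by rewrite ltnS (leq_trans (leq_addl i j)).
exists (delta_mx (Ordinal hi) (Ordinal hj)) => z.
rewrite /poly2 (bigD1 (Ordinal hi))//= (bigD1 (Ordinal hj))//= mxE !eqxx /=.
rewrite big1 => [|k /andP[_ kj]]; last by rewrite mxE (negbTE kj) andbF !mul0r.
rewrite big1 => [|k kj]; last by rewrite big1// => l _; rewrite mxE (negbTE kj) !mul0r.
by rewrite !addr0 mul1r.
Qed.

Lemma is_poly2_zero (R : realType) (n : nat) : is_poly2 n (fun=> 0 : R).
Proof.
exists 0 => z; rewrite /poly2 big1// => i _; rewrite big1// => j _.
by rewrite mxE !mul0r.
Qed.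

Lemma is_poly2_sum (R : realType) (n : nat) (I : Type) (s : seq I) (P : pred I)
    (a : I -> R) (F : I -> R * R -> R) :
  (forall i, P i -> is_poly2 n (F i)) -> is_poly2 n (fun z => \sum_(i <- s | P i) a i * F i z).
Proof.
move=> H; elim: s => [|i s IH].
  by apply: is_poly2_eq (is_poly2_zero _ _) _ => z; rewrite big_nil.
case Pi : (P i); last by apply: is_poly2_eq IH _ => z; rewrite big_cons Pi.
apply: is_poly2_eq (is_poly2_comb (a i) 1 (H i Pi) IH) _ => z.
by rewrite big_cons Pi mul1r.
Qed.

Lemma is_poly2_mul (R : realType) (n m : nat) (F G : R * R -> R) :
  is_poly2 n F -> is_poly2 m G -> is_poly2 (n + m) (fun z => F z * G z).
Proof.
move=> [c cE] [d dE].
have mono (i j : nat) : (i + j <= n)%N -> is_poly2 (n + m) (fun z => z.1 ^+ i * z.2 ^+ j * G z).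
  move=> ij; have h : is_poly2 (n + m) (fun z : R * R =>
      \sum_(k <- index_enum 'I_m.+1) 1 * \sum_(l <- index_enum 'I_m.+1 | (k + l <= m)%N)
        d k l * (z.1 ^+ (i + k) * z.2 ^+ (j + l))).
    apply: is_poly2_sum => k _; apply: is_poly2_sum => l kl.
    by apply: is_poly2_monomial; rewrite addnACA leq_add.
  apply: is_poly2_eq h _ => z; rewrite -dE /poly2 big_distrr /=; apply: eq_bigr => k _.
  rewrite mul1r big_distrr /=; apply: eq_bigr => l _; rewrite !exprD; ring.
have h : is_poly2 (n + m) (fun z : R * R =>
      \sum_(k <- index_enum 'I_n.+1) 1 * \sum_(l <- index_enum 'I_n.+1 | (k + l <= n)%N)
        c k l * (z.1 ^+ k * z.2 ^+ l * G z)).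
  by apply: is_poly2_sum => k _; apply: is_poly2_sum => l kl; exact: mono.
apply: is_poly2_eq h _ => z; rewrite -cE /poly2 big_distrl /=; apply: eq_bigr => k _.
rewrite mul1r big_distrl /=; apply: eq_bigr => l _; ring.
Qed.

Lemma is_poly2_exp (R : realType) (n k : nat) (F : R * R -> R) :
  is_poly2 n F -> is_poly2 (k * n) (fun z => F z ^+ k).
Proof.
move=> hF; elim: k => [|k IH].
  apply: is_poly2_eq (@is_poly2_monomial R _ 0 0 _) _ => // z.
  by rewrite !expr0 mulr1.
rewrite mulSn; apply: is_poly2_eq (is_poly2_mul hF IH) _ => z.
by rewrite exprS.
Qed.

Lemma is_poly2_widen (R : realType) (n m : nat) (F : R * R -> R) :
  (n <= m)%N -> is_poly2 n F -> is_poly2 m F.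
Proof.
move=> nm hF; rewrite -(subnKC nm).
have h : is_poly2 (m - n) (fun z : R * R => z.1 ^+ 0 * z.2 ^+ 0) by exact: is_poly2_monomial.
by apply: is_poly2_eq (is_poly2_mul hF h) _ => z; rewrite !expr0 !mulr1.
Qed.

Lemma is_poly2_x (R : realType) : is_poly2 1 (fun z : R * R => z.1).
Proof. by apply: is_poly2_eq (@is_poly2_monomial R 1 1 0 _) _ => // z; rewrite expr1 mulr1. Qed.

Lemma is_poly2_y (R : realType) : is_poly2 1 (fun z : R * R => z.2).
Proof. by apply: is_poly2_eq (@is_poly2_monomial R 1 0 1 _) _ => // z; rewrite expr1 mul1r. Qed.

Lemma is_poly2_1x (R : realType) : is_poly2 1 (fun z : R * R => 1 - z.1).
Proof.
have h : is_poly2 1 (fun z : R * R => z.1 ^+ 0 * z.2 ^+ 0) by exact: is_poly2_monomial.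
apply: is_poly2_eq (is_poly2_comb 1 (-1) h (is_poly2_x R)) _ => z.
by rewrite !expr0; ring.
Qed.

Definition right_term (R : realType) (n m : nat) (i : 'I_(n.+1 + m)) (z : R * R) : R :=
  match fintype.split i with
  | inl i => if odd i then 0 else i.+1%:R / 2 * z.2 ^+ i
  | inr j => (1 - z.1) * ((1 - z.1) ^+ 2 - z.2 ^+ 2) ^+ j
  end.

Definition left_term (R : realType) (n m : nat) (i : 'I_(n.+1 + m)) (z : R * R) : R :=
  match fintype.split i with
  | inl i => if odd i then (z.1 ^+ 2 + z.2 ^+ 2) ^+ i./2 / pi else 0
  | inr j => 0
  end.

Lemma right_pertE (R : realType) (n m : nat) (v : 'rV[R]_(n.+1 + m)) (z : R * R) :
  right_pert (poly_prim v)^`() (poly_right v) z = \sum_i v 0 i * right_term i z.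
Proof.
rewrite /right_pert big_split_ord /= /poly_prim /poly_right raddf_sum /= !horner_sum.
rewrite big_distrr /=; congr (_ + _); apply: eq_bigr => i _.
  rewrite /right_term (unsplitK (inl i)) derivZ derivXn hornerZ hornerMn hornerXn /= -mulr_natl.
  by case: (odd i); [rewrite mul0r mulr0|ring].
by rewrite /right_term (unsplitK (inr i)) hornerZ hornerXn; ring.
Qed.

Lemma left_pertE (R : realType) (n m : nat) (v : 'rV[R]_(n.+1 + m)) (z : R * R) (w : R) :
  w * (poly_left v).[z.1 ^+ 2 + z.2 ^+ 2] = \sum_i v 0 i * (w * left_term i z).
Proof.
rewrite big_split_ord /= [X in _ = _ + X]big1 ?addr0 => [|j _]; last first.
  by rewrite /left_term (unsplitK (inr j)) !mulr0.
rewrite /poly_left horner_sum big_distrr /=; apply: eq_bigr => i _.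
rewrite /left_term (unsplitK (inl i)) hornerZ hornerXn.
by case: (odd i); [ring|rewrite mul0r !mulr0].
Qed.

(** Origin of the integer part of [(n + 1) / 2]: the logarithmic term of index [j] has degree
    [2 j + 1], which must not exceed [n] for any [j < m]. *)
Lemma right_term_poly2 (R : realType) (n m : nat) (i : 'I_(n.+1 + m)) : (m.*2 <= n.+1)%N ->
  is_poly2 n (@right_term R n m i).
Proof.
move=> mn; rewrite /right_term; case: (fintype.split i) => j.
  case: (odd j); first exact: is_poly2_zero.
  have h : is_poly2 n (fun z : R * R => z.1 ^+ 0 * z.2 ^+ j).
    by apply: is_poly2_monomial; rewrite add0n -ltnS.
  apply: is_poly2_eq (is_poly2_comb (j.+1%:R / 2) 0 h h) _ => z.
  by rewrite expr0; ring.
have h2 : is_poly2 2 (fun z : R * R => (1 - z.1) ^+ 2 - z.2 ^+ 2).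
  apply: is_poly2_eq (is_poly2_comb 1 (-1) (is_poly2_exp 2 (is_poly2_1x R)) (is_poly2_exp 2 (is_poly2_y R))) _ => z.
  by ring.
apply: is_poly2_widen (is_poly2_mul (is_poly2_1x R) (is_poly2_exp j h2)).
rewrite muln2 add1n -ltnS (leq_trans _ mn)// -doubleS leq_double; exact: ltn_ord.
Qed.

Lemma left_term_poly2 (R : realType) (n m : nat) (i : 'I_(n.+1 + m)) (L : R * R -> R) :
  is_poly2 1 L -> is_poly2 n (fun z => L z * @left_term R n m i z).
Proof.
move=> hL; rewrite /left_term; case: (fintype.split i) => j; last first.
  by apply: is_poly2_eq (is_poly2_zero _ _) _ => z; rewrite mulr0.
case oj : (odd j); last by apply: is_poly2_eq (is_poly2_zero _ _) _ => z; rewrite mulr0.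
have h2 : is_poly2 2 (fun z : R * R => z.1 ^+ 2 + z.2 ^+ 2).
  apply: is_poly2_eq (is_poly2_comb 1 1 (is_poly2_exp 2 (is_poly2_x R)) (is_poly2_exp 2 (is_poly2_y R))) _ => z.
  by ring.
have h : is_poly2 n (fun z => L z * (z.1 ^+ 2 + z.2 ^+ 2) ^+ j./2).
  apply: is_poly2_widen (is_poly2_mul hL (is_poly2_exp j./2 h2)).
  by rewrite muln2 -[X in (X + _)%N]/(nat_of_bool true) -oj odd_double_half -ltnS.
apply: is_poly2_eq (is_poly2_comb pi^-1 0 h h) _ => z.
by rewrite mul0r addr0 mulrC mulrA.
Qed.

Lemma poly2_sum (R : realType) (n N : nat) (v : 'rV[R]_N) (C : 'I_N -> 'M[R]_n.+1) (z : R * R) :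
  poly2 (\sum_i v 0 i *: C i) z = \sum_i v 0 i * poly2 (C i) z.
Proof.
elim/big_rec2: _ => [|i y1 y2 _ IH].
  by rewrite /poly2 big1// => i _; rewrite big1// => j _; rewrite mxE !mul0r.
by rewrite -[y2]scale1r poly2_linear mul1r -IH.
Qed.

(** The compact set is the image of a cube under the continuous linear map from combinations to
    coefficients. *)
Lemma coef_family (R : realType) (n m : nat) : (m.*2 <= n.+1)%N ->
  exists (D : set (coef_space R n)) (c : 'rV[R]_(n.+1 + m) -> coef_space R n),
  [/\ compact D, forall v : 'rV[R]_(n.+1 + m), (forall i, `|v 0 i| <= 1) -> D (c v) &
    forall (v : 'rV[R]_(n.+1 + m)) e,
      right_field (c v) e = right_system (poly_prim v)^`() (poly_right v) e /\
      left_field (c v) e = left_system (poly_left v) e].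
Proof.
move=> mn.
have [C1 C1E] := choice (fun i => @right_term_poly2 R n m i mn).
have [C2 C2E] := choice (fun i => @left_term_poly2 R n m i _ (is_poly2_x R)).
have [C3 C3E] := choice (fun i => @left_term_poly2 R n m i _ (is_poly2_y R)).
pose lc (C : 'I_(n.+1 + m) -> 'M[R]_n.+1) (v : 'rV[R]_(n.+1 + m)) := \sum_i v 0 i *: C i.
pose c v : coef_space R n := ((lc C1 v, 0), (lc C2 v, lc C3 v)).
have csum (C : 'I_(n.+1 + m) -> 'M[R]_n.+1) (s : seq 'I_(n.+1 + m)) :
    continuous (fun v : 'rV[R]_(n.+1 + m) => \sum_(i <- s) v 0 i *: C i).
  elim: s => [|i s IH].
    rewrite (_ : (fun v => _) = fun=> 0); first exact: cst_continuous.
    by apply/funext => x; rewrite big_nil.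
  rewrite (_ : (fun v => _) = fun v : 'rV[R]_(n.+1 + m) => v 0 i *: C i + \sum_(j <- s) v 0 j *: C j).
    move=> v; apply: (@continuousD _ _ _ _ _ v); last exact: IH.
    apply: (@continuous_comp _ _ _ (fun v : 'rV[R]_(n.+1 + m) => v 0 i) (fun k => k *: C i)).
      exact: coord_continuous.
    exact: scalel_continuous.
  by apply/funext => x; rewrite big_cons.
have clc C : continuous (lc C) by exact: csum.
have cc : continuous c.
  have c0 : continuous (fun _ : 'rV[R]_(n.+1 + m) => 0 : 'M[R]_n.+1) by exact: cst_continuous.
  exact: continuous_pair (continuous_pair (clc C1) c0) (continuous_pair (clc C2) (clc C3)).
pose K := [set v : 'rV[R]_(n.+1 + m) | forall i, `[-1, 1]%classic (v 0 i)].
have cK : compact K.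
  by apply: (@rV_compact R _ (fun _ => `[-1, 1]%classic)) => i; exact: segment_compact.
exists (c @` K), c; split.
- apply: continuous_compact => //; exact: continuous_subspaceT.
- by move=> v hv; exists v => // i /=; rewrite in_itv /= -ler_norml.
move=> v e; split; apply/funext => z.
  rewrite /right_field /right_system /c /= poly2_sum right_pertE; congr (_ + _ * _, _).
    by apply: eq_bigr => i _; rewrite C1E.
  by rewrite /poly2 big1 ?mulr0 ?addr0// => i _; rewrite big1// => j _; rewrite mxE !mul0r.
rewrite /left_field /left_system /c /= !poly2_sum !left_pertE.
by congr (_ + _ * _, _ + _ * _); apply: eq_bigr => i _; rewrite ?C2E ?C3E.
Qed.

(** * Neighbourhoods of the origin and of the loop *)

(** Compactness of the parameter interval gives one radius for the whole curve. *)
Lemma uniform_nbhs (R : realType) (gam : R -> R * R) (U : set (R * R)) (a b : R) :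
  continuous gam -> open U -> (forall y, a <= y <= b -> U (gam y)) ->
  exists2 e, 0 < e & forall y z, a <= y <= b -> ball (gam y) e z -> U z.
Proof.
move=> cg oU gU.
have /compact_near_coveringP K := @segment_compact R a b.
have H : \forall e \near 0^'+, `[a, b]%classic `<=` (fun y => ball (gam y) e `<=` U).
  apply: K => y; rewrite /= in_itv /= => hy.
  have /nbhs_ballP[d d0 hd] : nbhs (gam y) U by apply: open_nbhs_nbhs; split=> //; exact: gU.
  have d20 : 0 < d / 2 by rewrite divr_gt0.
  have : \forall y' \near y, ball (gam y) (d / 2) (gam y').
    by apply: cg; exact: nbhsx_ballx.
  move=> h; near=> y' e => z /= hz; apply: hd.
  apply: (@ball_splitl _ _ (gam y')); last first.
    apply: ball_sym; apply: (le_ball _ hz); near: e; apply: nbhs_right_le; exact: d20.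
  by near: y'; exact: h.
have [e e0 he] : exists2 e, 0 < e & `[a, b]%classic `<=` (fun y => ball (gam y) e `<=` U).
  near (0 : R)^'+ => e; exists e; first by near: e; exact: nbhs_right_gt.
  by near: e.
by exists e => // y z hy hz; apply: he hz; rewrite /= in_itv.
Unshelve. all: by end_near. Qed.

Lemma rad_sqr (R : realType) (z : R * R) : 0 < rad z -> rad z ^+ 2 = energy z.
Proof. by move=> r0; rewrite sqr_sqrtr// ltW// -sqrtr_gt0. Qed.

(** For [0 <= x < 1] the energy is [x (2 - x) + y^2], at least [x + y^2], and for [x < 0] [rad] is
    the Euclidean norm; so a small [rad] makes both coordinates small. *)
Lemma hopf_nbhs (R : realType) (U : set (R * R)) :
  set_nbhs [set ((0, 0) : R * R)] U ->
  exists2 d, 0 < d & forall z, z.1 < 1 -> 0 < rad z < d -> U z.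
Proof.
move=> /set_nbhsP[W [oW W0 WU]].
have /nbhs_ballP[e /= e0 He] : nbhs ((0, 0) : R * R) W.
  by apply: open_nbhs_nbhs; split=> //; exact: W0.
exists (Num.min e 1); first by rewrite lt_min e0 ltr01.
move=> z x1; rewrite lt_min => /and3P[r0 re r1]; apply: WU; apply: He.
have E := rad_sqr r0.
have r2 : rad z ^+ 2 <= rad z by rewrite expr2 -[leRHS]mulr1; apply: ler_wpM2l; exact: ltW.
suff [hx hy] : `|z.1| < e /\ `|z.2| < e.
  by split; rewrite /= /ball /= sub0r normrN.
have y2 : z.2 ^+ 2 <= energy z.
  case: (leP 0 z.1) => x0.
    by rewrite (energy_right x0); move: x0 x1; clear; nra.
  by rewrite (energy_left (ltW x0)); move: (sqr_ge0 z.1); clear; lra.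
have yr : `|z.2| <= rad z.
  by rewrite -(ler_pXn2r (_ : 0 < 2)%N) ?nnegrE ?(ltW r0)// real_normK ?num_real// E.
split; last exact: le_lt_trans re.
apply: le_lt_trans re; case: (leP 0 z.1) => x0.
  rewrite ger0_norm//; apply: le_trans r2; rewrite E (energy_right x0).
  by have := sqr_ge0 z.2; move: x0 x1; clear; nra.
rewrite -(ler_pXn2r (_ : 0 < 2)%N) ?nnegrE ?(ltW r0)// real_normK ?num_real// E.
by rewrite (energy_left (ltW x0)); move: (sqr_ge0 z.2); clear; lra.
Qed.

Lemma homoc_nbhs (R : realType) (U : set (R * R)) :
  set_nbhs (@homoclinic_loop R) U ->
  exists2 d, 0 < d & forall z, z.1 < 1 -> 0 < rad z -> 1 - d < rad z < 1 -> U z.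
Proof.
move=> /set_nbhsP[W [oW W0 WU]].
pose g1 (y : R) := (1 - `|y|, y).
pose g2 (y : R) := (- Num.sqrt (1 - y ^+ 2), y).
have cid : continuous (fun y : R => y) by move=> y; exact: cvg_id.
have cg1 : continuous g1.
  apply: continuous_pair => // y; apply: cvgB; first exact: cvg_cst.
  by apply: cvg_norm; exact: cvg_id.
have cg2 : continuous g2.
  apply: continuous_pair => // y; apply: cvgN.
  apply: (@continuous_comp _ _ _ (fun y : R => 1 - y ^+ 2) (@Num.sqrt R)).
    by apply: cvgB; [exact: cvg_cst|apply: cvgM; exact: cvg_id].
  exact: sqrt_continuous.
have [|e1 e10 H1] := @uniform_nbhs _ g1 W (-1) 1 cg1 oW.
  by move=> y hy; apply: W0; left; split=> //=; rewrite ler_norml.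
have [|e2 e20 H2] := @uniform_nbhs _ g2 W (-1) 1 cg2 oW.
  move=> y hy; apply: W0.
  have y1 : `|y| <= 1 by rewrite ler_norml.
  have y2 : y ^+ 2 <= 1 by rewrite -real_normK ?num_real// expr_le1.
  have [y2'|y2'] := ltP (y ^+ 2) 1.
    right; split => /=; last by rewrite oppr_lt0 sqrtr_gt0 subr_gt0.
    by rewrite sqrrN sqr_sqrtr ?subr_ge0// subrK.
  (* The end points of the closed half circle belong to the other piece of the loop. *)
  left; split=> //=; have -> : y ^+ 2 = 1 by apply: le_anti; rewrite y2.
  rewrite subrr sqrtr0 oppr0; apply/esym/eqP; rewrite subr_eq0 eq_sym eq_le y1 /=.
  by rewrite -(@expr_ge1 _ 2)// real_normK ?num_real.
(* On the right, [z] is compared with the loop point at the same height: with [X = 1 - x] the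
   squared distance is at most [X^2 - y^2 = 1 - rad^2 < 2 d]. On the left, it is compared with its
   radial projection, and each coordinate moves by at most [1 - rad < d]. *)
pose d := Num.min e2 (e1 ^+ 2 / 2).
have d0 : 0 < d by rewrite lt_min e20 divr_gt0// exprn_gt0.
have de2 : d <= e2 by rewrite ge_min lexx.
have de1 : d <= e1 ^+ 2 / 2 by rewrite ge_min lexx orbT.
exists d => // z x1 r0 /andP[rd r1]; apply: WU.
have E := rad_sqr r0.
case: (leP 0 z.1) => x0.
  have h0 : energy z < 1 by rewrite -E expr_lt1// ltW.
  rewrite (energy_right x0) in E h0.
  pose X := 1 - z.1.
  have X0 : 0 <= X by rewrite /X; move: x1; clear; lra.
  have X1 : X <= 1 by rewrite /X; move: x0; clear; lra.
  have hX : z.2 ^+ 2 <= X ^+ 2 by rewrite /X; move: h0; clear; lra.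
  have yX : `|z.2| <= X.
    by rewrite -(ler_pXn2r (_ : 0 < 2)%N) ?nnegrE// real_normK ?num_real.
  have yI : -1 <= z.2 <= 1 by rewrite -ler_norml (le_trans yX).
  apply: (H1 z.2) => //; split; rewrite /= /ball /=; last by rewrite subrr normr0.
  have -> : 1 - `|z.2| - z.1 = X - `|z.2| by rewrite /X; ring.
  rewrite ger0_norm ?subr_ge0//.
  rewrite -(ltr_pXn2r (_ : 0 < 2)%N) ?nnegrE ?subr_ge0 ?(ltW e10)//.
  have a2 : `|z.2| ^+ 2 = z.2 ^+ 2 by rewrite real_normK ?num_real.
  have p1 : (X - `|z.2|) ^+ 2 <= X ^+ 2 - z.2 ^+ 2.
    have := mulr_ge0 (normr_ge0 z.2) (_ : 0 <= X - `|z.2|); rewrite subr_ge0 => /(_ yX).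
    by rewrite -a2; clear; lra.
  have p2 : X ^+ 2 - z.2 ^+ 2 = 1 - rad z ^+ 2 by rewrite E /X; ring.
  have p3 : 1 - rad z ^+ 2 < 2 * d by move: rd r1 r0; clear; nra.
  by move: p1 p2 p3 de1; clear; lra.
rewrite (energy_left (ltW x0)) in E.
pose y := z.2 / rad z.
have r2 : 0 < rad z ^+ 2 by rewrite exprn_gt0.
have y2 : 1 - y ^+ 2 = (z.1 / rad z) ^+ 2.
  rewrite /y !expr_div_n; apply: (mulIf (lt0r_neq0 r2)).
  by rewrite mulrBl !divfK ?gt_eqF// mul1r E; ring.
have yI : -1 <= y <= 1.
  rewrite -ler_norml -(@expr_le1 _ 2)// real_normK ?num_real// -subr_ge0 y2.
  exact: sqr_ge0.
have sE : Num.sqrt (1 - y ^+ 2) = - (z.1 / rad z).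
  by rewrite y2 sqrtr_sqr ler0_norm// (mulr_le0_ge0 (ltW x0))// invr_ge0 ltW.
have small w : w ^+ 2 <= rad z ^+ 2 -> `|w / rad z - w| < d.
  move=> hw; have wr : `|w| <= rad z.
    by rewrite -(ler_pXn2r (_ : 0 < 2)%N) ?nnegrE ?(ltW r0)// real_normK ?num_real.
  have -> : w / rad z - w = w / rad z * (1 - rad z) by field; rewrite gt_eqF.
  rewrite normrM normrM normfV (gtr0_norm r0) (gtr0_norm (_ : 0 < 1 - rad z)) ?subr_gt0//.
  apply: (@le_lt_trans _ _ (1 * (1 - rad z))).
    by apply: ler_wpM2r; [rewrite subr_ge0 ltW|rewrite ler_pdivrMr// mul1r].
  by move: rd; clear; lra.
apply: (H2 y) => //; split; rewrite /= /ball /=.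
  rewrite sE opprK; apply: lt_le_trans de2; apply: small; rewrite E; move: (sqr_ge0 z.2); clear; lra.
by apply: lt_le_trans de2; apply: small; rewrite E; move: (sqr_ge0 z.1); clear; lra.
Qed.

(** * Several limit cycles in disjoint annuli *)

Lemma near_right0 (R : realType) (P : R -> Prop) (h : R) :
  0 < h -> (forall x, 0 < x < h -> P x) -> \forall x \near 0^'+, P x.
Proof. by move=> h0 H; near=> x; apply: H; apply/andP. Unshelve. all: by end_near. Qed.

Lemma near_right0_ex (R : realType) (P : R -> Prop) :
  (\forall x \near 0^'+, P x) -> exists2 h, 0 < h & forall x, 0 < x < h -> P x.
Proof.
move=> [h /= h0 H]; exists h => // x /andP[x0 xh]; apply: H => //.
by rewrite /ball_ /= sub0r normrN gtr0_norm.
Qed.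

Lemma bifurcate_near_of_annuli (R : realType) (n m k : nat) (A : set (R * R)) :
  (m.*2 <= n.+1)%N -> (k < n.+1 + m)%N ->
  (forall U, set_nbhs A U -> exists p q : R, [/\ 0 <= p, p < q, q <= 1 &
    forall t, p < t < q -> exists2 eta, 0 < eta & region t eta `<=` U]) ->
  bifurcate_near n A k.
Proof.
move=> mn kn HA; have [D [c [cD Dc Fc]]] := @coef_family R n m mn.
exists D => // U /HA[p [q [p0 pq q1 HU]]].
have [v [ts [v1 sz un Hts]]] := @melnikov_zeros R n m p q p0 pq q1 k kn.
exists (c v); first exact: Dc.
pose t (i : 'I_k) := ts`_i.
have tin i : t i \in ts by rewrite mem_nth// sz.
have tne i j : i != j -> 0 < `|t i - t j|.
  by move=> ij; rewrite normr_gt0 subr_eq0 /t nth_uniq ?sz.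
have : \forall x \near (0 : R)^'+, forall i j,
    region (t i) x `<=` U /\ (i != j -> x + x < `|t i - t j|).
  apply: filter_forall => i; apply: filter_forall => j.
  have [tI _ _] := Hts _ (tin i); have [eta eta0 hU] := HU _ tI.
  (* The value [1] for [i = j] is a placeholder; half the distance makes the annuli around distinct
     zeros disjoint. *)
  have h0 : 0 < Num.min eta (if i == j then 1 else `|t i - t j| / 2).
    by rewrite lt_min eta0; case: eqVneq => [_|ij]; [exact: ltr01|rewrite divr_gt0// tne].
  apply: near_right0 h0 _ => x /andP[x0]; rewrite lt_min => /andP[xe xt]; split.
    by move=> z [z1 hz]; apply: hU; split=> //; exact: lt_trans xe.
  by move=> /negbTE ij; move: xt; rewrite ij; lra.
move=> /near_right0_ex[h h0 Hh].
pose x := h / 2; have x0 : 0 < x by rewrite divr_gt0.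
have xh : 0 < x < h by rewrite x0 /x; lra.
have : \forall e \near (0 : R)^'+, forall i, exists2 O,
    limit_cycle (right_field (c v) e) (left_field (c v) e) O & O `<=` region (t i) x.
  apply: filter_forall => i; have [tI Z [d dn dd]] := Hts _ (tin i).
  have t01 : 0 < t i < 1.
    by case/andP: tI => h1 h2; rewrite (le_lt_trans p0 h1) (lt_le_trans h2 q1).
  have [e0 e00 He] := melnikov_limit_cycle t01 Z dd dn x0.
  apply: near_right0 e00 _ => e he.
  by have [-> ->] := Fc v e; exact: He.
move=> /near_right0_ex[e0 e00 He]; exists e0 => // e he.
have [W HW] := choice (fun i => let: ex_intro2 C h1 h2 := He e he i in ex_intro _ C (conj h1 h2)).
exists W => [i j E|i]; last by have [L S] := HW i; split=> // z /S; apply: (Hh x xh i i).1.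
(* Nonempty cycles in disjoint annuli are distinct. *)
apply/eqP/negPn/negP => ij.
have [[_ [[z Oz _] _] _] /(_ z Oz)[_ z1]] := HW i.
have [_ /(_ z)] := HW j; rewrite -E => /(_ Oz)[_ z2].
have := (Hh x xh i j).2 ij; apply/negP; rewrite -leNgt.
have -> : t i - t j = (rad z - t j) - (rad z - t i) by ring.
by apply: le_trans (ler_normB _ _) _; apply: ltW; rewrite ltrD.
Qed.

Theorem theorem1p1 (R : realType) (n : nat) (hn : (1 <= n)%N) :
  N_Hopf_ge R n (n + (n + 1) %/ 2)%N /\ N_homoc_ge R n (n + (n + 1) %/ 2)%N.
Proof.
have mn : (((n + 1) %/ 2).*2 <= n.+1)%N by rewrite -muln2 -(addn1 n) leq_divM.
split; apply: bifurcate_near_of_annuli mn _ _ => // U.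
- move=> /hopf_nbhs[d d0 H].
  (* With half-width [t] the annulus around [t] is [0 < rad < 2 t], and [2 t < d]. *)
  exists 0, (Num.min d 1 / 2); rewrite lexx divr_gt0 ?lt_min ?d0 ?ltr01//.
  have m1 : Num.min d 1 <= 1 by rewrite ge_min lexx orbT.
  have md : Num.min d 1 <= d by rewrite ge_min lexx.
  split=> //; first by move: m1; lra.
  move=> t /andP[t0 tm]; exists t => // z [z1]; rewrite ltr_distl => /andP[h1 h2].
  apply: H => //; apply/andP; split; first by move: h1; lra.
  by move: tm md h2; lra.
- move=> /homoc_nbhs[d d0 H].
  exists (Num.max 0 (1 - d)), 1; split=> //.
  + by rewrite le_max lexx.
  + by rewrite gt_max ltr01 /=; move: d0; lra.
  move=> t /andP[]; rewrite gt_max => /andP[t0 td] t1.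
  (* The three entries keep [rad] above [0], below [1] and above [1 - d]. *)
  exists (Num.min t (Num.min (1 - t) (t - (1 - d)))).
    by rewrite !lt_min t0 !subr_gt0 t1.
  move=> z [z1]; rewrite !lt_min !ltr_distl => /and3P[/andP[h1 _] /andP[_ h2] /andP[h3 _]].
  by apply: H => //; [|apply/andP; split]; move: h1 h2 h3; lra.
Qed.
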